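(* Let $k\to\infty$ and for $i=1,\dots,k$, $t=1,\dots,T_i$, let $x_{it}\in\mathbb{R}^p$ be fixed covariate vectors, with $\max_i T_i$ bounded. Suppose the claim counts are generated by the saturated random effect model: $\{\theta_{it}\}$ are i.i.d. with $E(\theta_{it})=1$ and $\mathrm{Var}(\theta_{it})=\tau^2>0$, and conditionally on the $\theta$'s the $N_{it}$ are independent with $N_{it}\mid\theta_{it}\sim\mathrm{Pois}(\theta_{it}\lambda_{it})$, where $\lambda_{it}=\exp(x_{it}^T\beta)$. Let $\widehat{\beta}$ be the maximum likelihood estimator of $\beta$ in the Poisson regression model $N_{it}\sim\mathrm{Pois}(\lambda_{it})$ (independent), and let $\widehat{\lambda}_{it}=\exp(x_{it}^T\widehat{\beta})$. Assume that $\frac1k\sum_{i}\big(\sum_{t}\lambda_{it}\big)^2$ converges to a positive constant. Consider the score statistic $$\mathcal{T}_{\rm pin}=\frac{\sum_{i}\Big(\big(\sum_{t}(N_{it}-\widehat{\lambda}_{it})\big)^2-\sum_{t}N_{it}\Big)}{\sqrt{2\sum_{i}\big(\sum_{t}\widehat{\lambda}_{it}\big)^2}},$$ and the test that rejects $H_0:\mathrm{Var}(\theta_i)=0$ (in the shared random effect model) when $\mathcal{T}_{\rm pin}$ is at least the $1-\alpha$ quantile of $N(0,1)$. Then this test rejects the null hypothesis with probability tending to one as $k\to\infty$.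
   Context: The shared random effect model is: $N_{it}\mid\theta_i\sim\mathrm{Pois}(\theta_i\lambda_{it})$ with $\theta_i$ i.i.d., mean 1 and variance $\sigma^2$; $H_0$ is $\sigma^2=0$. The statistic $\mathcal{T}_{\rm pin}$ is the score statistic for this $H_0$, which is asymptotically $N(0,1)$ under $H_0$. Here the data are instead generated from the model with a saturated (observation-level) random effect $\theta_{it}$, in which counts from the same policyholder are uncorrelated. *)

(* Defs.v *)
From HB Require Import structures.
From mathcomp Require Import all_boot all_order all_algebra.
From mathcomp Require Import all_classical all_reals all_analysis.
Set Implicit Arguments. Unset Strict Implicit. Unset Printing Implicit Defensive.
Import Order.TTheory GRing.Theory Num.Theory.
Local Open Scope classical_set_scope.
Local Open Scope ring_scope.

(* Index of an observation: (i, t) = (policyholder, period).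
   Policyholder i has periods t = 0, ..., T i - 1. *)
Definition obs_dom (T : nat -> nat) : set (nat * nat) :=
  [set it | (it.2 < T it.1)%N].

Definition dotp {R : realType} (p : nat) (u v : 'rV[R]_p) : R :=
  \sum_(j < p) u 0 j * v 0 j.

(* Poisson pmf with mean mu >= 0 (correct also at mu = 0, where it is the
   Dirac mass at 0; note the library's poisson_pmf returns 1 at rate 0). *)
Definition pois_pmf {R : realType} (mu : R) (n : nat) : R :=
  mu ^+ n / (n`!)%:R * expR (- mu).

Definition mutually_independent {R : realType} d (Omega : measurableType d)
    (P : probability Omega R) (I : eqType) (X : I -> Omega -> R) (J : set I) :=
  forall (s : seq I) (B : I -> set R),
    uniq s -> (forall i, i \in s -> J i) -> (forall i, measurable (B i)) ->
    P (\bigcap_(i in [set` s]) (X i @^-1` B i)) =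
    (\prod_(i <- s) P (X i @^-1` B i))%E.

Definition identically_distributed {R : realType} d (Omega : measurableType d)
    (P : probability Omega R) (I : eqType) (X : I -> Omega -> R) (J : set I) :=
  forall i j (B : set R), J i -> J j -> measurable B ->
    P (X i @^-1` B) = P (X j @^-1` B).

(* Conditionally on the theta's, the N's are independent with
   N_s | theta ~ Pois(theta_s * lam_s).  Stated through the finite-dimensional
   joint laws of (theta, N): for every finite set s of observations, Borel sets
   B and counts n,
   P(theta_s in B_s, N_s = n_s for all s) = E[prod_s 1_{B_s}(theta_s) pmf(n_s; theta_s lam_s)]. *)
Definition cond_poisson {R : realType} d (Omega : measurableType d)
    (P : probability Omega R) (I : eqType) (theta N : I -> Omega -> R)
    (lam : I -> R) (J : set I) :=
  forall (s : seq I) (B : I -> set R) (n : I -> nat),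
    uniq s -> (forall i, i \in s -> J i) -> (forall i, measurable (B i)) ->
    P (\bigcap_(i in [set` s]) (theta i @^-1` B i `&` N i @^-1` [set (n i)%:R])) =
    (\int[P]_w (\prod_(i <- s)
        (\1_(B i) (theta i w) * pois_pmf (theta i w * lam i) (n i)))%:E)%E.

(* Poisson log-likelihood (up to the additive term -sum log N!, which does not
   depend on b) of the first k policyholders at parameter b. *)
Definition pois_loglik {R : realType} (p : nat) (T : nat -> nat)
    (x : nat -> nat -> 'rV[R]_p) (Nobs : nat * nat -> R) (k : nat) (b : 'rV[R]_p) : R :=
  \sum_(i < k) \sum_(t < T i)
     (Nobs (nat_of_ord i, nat_of_ord t) * dotp (x i t) b - expR (dotp (x i t) b)).

Definition T_pin {R : realType} (T : nat -> nat) (Nobs : nat * nat -> R)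
    (lamhat : nat * nat -> R) (k : nat) : R :=
  (\sum_(i < k) ((\sum_(t < T i) (Nobs (nat_of_ord i, nat_of_ord t)
                                   - lamhat (nat_of_ord i, nat_of_ord t))) ^+ 2
                 - \sum_(t < T i) Nobs (nat_of_ord i, nat_of_ord t)))
  / Num.sqrt (2 * \sum_(i < k) (\sum_(t < T i) lamhat (nat_of_ord i, nat_of_ord t)) ^+ 2).

Definition std_normal_cdf {R : realType} (z : R) : \bar R :=
  (\int[@lebesgue_measure R]_(x in `]-oo, z]) (normal_pdf 0 1 x)%:E)%E.

(* Main.v *)
Require Import Defs.
From HB Require Import structures.
From mathcomp Require Import all_boot all_order all_algebra.
From mathcomp Require Import zify ring lra.
Import Order.TTheory GRing.Theory Num.Theory.
Set Implicit Arguments. Unset Strict Implicit. Unset Printing Implicit Defensive.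
Local Open Scope ring_scope.

(** Put A_i = sum_t (N_it - lambda_it) and l_i(b) = sum_t exp(x_it b), so that
    lambda_i = l_i(beta).  The numerator of the statistic evaluated at b is
      sum_i (A_i^2 - sum_t N_it) - 2 sum_i A_i (l_i(b) - lambda_i)
        + sum_i (l_i(b) - lambda_i)^2.
    The residuals N_it - lambda_it are orthogonal with variance
    lambda_it + tau^2 lambda_it^2, so by a truncated weak law the first sum is
    at least a constant times k.  The cross term is o(k + sum_i l_i(b)^2)
    uniformly in b: the level sets of i |-> exp(x_it b), relative to the weights
    m_i = 1 + lambda_i, are half-spaces, which for any finite measure have an L1
    cover whose size depends only on the dimension (Pajor's lemma and Dudley's
    sampling argument), so Chebyshev's inequality on the finitely many sets of
    the cover suffices; large residuals are removed by uniform integrability.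
    Hence the numerator eventually dominates any multiple of the denominator,
    simultaneously for all b, in particular at the estimator. *)

(** * Half-space traces *)

(** Arbitrary covariates need not make the estimator consistent, or even make a maximizer exist.
    This is possible because the last term of the expansion is a square: as l_i(b)^2 <= 2 (l_i(b) -
    lambda_i)^2 + 2 lambda_i^2, a small multiple of sum_i l_i(b)^2, coming from the cross term or
    from the denominator, is absorbed by that square and by the linear gain. Only second moments of
    theta are available, so squared residuals may have infinite variance and are truncated at
    multiples of m_i before Chebyshev is applied; a product of residuals from two periods has finite
    variance by independence. The rates may be unbounded too: dividing by m_i normalizes them, and
    convergence of the mean of lambda_i^2 yields sum_i m_i^4 = o(k^2), which makes all the variances
    negligible. The gain is linear in k because sum_t lambda_it^2 >= lambda_i^2 / max T by
    Cauchy-Schwarz. *)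

Definition shatters (T : finType) (F : {set {set T}}) (A : {set T}) :=
  [forall B : {set T}, (B \subset A) ==> [exists S in F, S :&: A == B]].

Lemma shattersP (T : finType) (F : {set {set T}}) (A : {set T}) :
  reflect (forall B : {set T}, B \subset A -> exists2 S, S \in F & S :&: A = B)
          (shatters F A).
Proof.
apply: (iffP forallP) => [h B BA|h B].
  by have /existsP[S /andP[SF /eqP e]] := implyP (h B) BA; exists S.
apply/implyP => /h[S SF e]; apply/existsP; exists S; by rewrite SF e eqxx.
Qed.

(** If [x] were in [A], the traces [set0] and [A] would need members of [F] that disagree at [x]. *)
Lemma shatters_notin (T : finType) (F : {set {set T}}) (A : {set T}) (x : T) (b : bool) :
  (forall S, S \in F -> (x \in S) = b) -> shatters F A -> x \notin A.
Proof.
move=> hF /shattersP hA; apply/negP => xA.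
have [S0 /hF e0 /setP/(_ x)] := hA set0 (sub0set _).
rewrite !inE e0 xA andbT => b0.
have [S1 /hF e1 /setP/(_ x)] := hA A (subxx _).
by rewrite !inE e1 xA andbT b0.
Qed.

Lemma shatters_sub (T : finType) (F G : {set {set T}}) (A : {set T}) :
  F \subset G -> shatters F A -> shatters G A.
Proof.
move=> /subsetP FG /shattersP hA; apply/shattersP => B /hA[S /FG SG e].
by exists S.
Qed.

(** Induction on the size of the family, split by membership of a point [x] that some members
    contain and others do not. Sets shattered by either half avoid [x]; a set [A] shattered by both
    halves counts twice, because [F] shatters both [A] and [x |: A]. *)
Lemma pajor (T : finType) (F : {set {set T}}) :
  (#|F| <= #|[set A | shatters F A]|)%N.
Proof.
have [n] := ubnP #|F|; elim: n F => // n IHn F /ltnSE leFn.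
have [lt1F|] := ltnP 1 #|F|; last first.
  move=> leF1; have [->|[S SF]] := set_0Vmem F; first by rewrite cards0.
  apply: leq_trans leF1 _; apply/card_gt0P; exists set0; rewrite inE.
  by apply/shattersP => B; rewrite subset0 => /eqP->; exists S; rewrite ?setI0.
have [x [S1 [S2 [S1F S2F xS1 xS2]]]] : exists x S1 S2,
    [/\ S1 \in F, S2 \in F, x \in S1 & x \notin S2].
  have [S1 [S2 [S1F S2F]]] := card_gt1P lt1F.
  rewrite eqEsubset negb_and => /orP[]/subsetPn[x xS1 xS2]; exists x.
    by exists S1, S2.
  by exists S2, S1.
pose F1 := [set S in F | x \in S]; pose F0 := [set S in F | x \notin S].
pose G1 := [set A | shatters F1 A]; pose G0 := [set A | shatters F0 A].
have F1F : F1 \subset F by apply/subsetP => S; rewrite inE => /andP[].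
have F0F : F0 \subset F by apply/subsetP => S; rewrite inE => /andP[].
have cF : (#|F1| + #|F0| = #|F|)%N.
  rewrite -(cardsID [set S : {set T} | x \in S] F); congr (_ + _)%N; apply: eq_card => S.
    by rewrite !inE.
  by rewrite !inE andbC.
have F1p : (0 < #|F1|)%N by apply/card_gt0P; exists S1; rewrite inE S1F.
have F0p : (0 < #|F0|)%N by apply/card_gt0P; exists S2; rewrite inE S2F.
have le1 : (#|F1| <= #|G1|)%N.
  by apply: IHn; rewrite (leq_trans _ leFn)// -cF -addn1 leq_add2l.
have le0 : (#|F0| <= #|G0|)%N.
  by apply: IHn; rewrite (leq_trans _ leFn)// -cF -addn1 addnC leq_add2r.
have xG1 A : A \in G1 -> x \notin A.
  rewrite inE; apply: (@shatters_notin _ _ _ _ true) => S.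
  by rewrite inE => /andP[_ ->].
have xG0 A : A \in G0 -> x \notin A.
  rewrite inE; apply: (@shatters_notin _ _ _ _ false) => S.
  by rewrite inE => /andP[_ /negbTE->].
rewrite -cF; apply: (leq_trans (leq_add le1 le0)).
(* [H] supplies the second copy of each set shattered by both halves; its members contain [x], so
   they are disjoint from [G1 :|: G0]. *)
pose H := (fun A => x |: A) @: (G1 :&: G0).
have cH : #|H| = #|G1 :&: G0|.
  apply: card_in_imset => A B; rewrite !inE => /andP[A1 _] /andP[B1 _] e.
  have xA : x \notin A by apply: xG1; rewrite inE.
  have xB : x \notin B by apply: xG1; rewrite inE.
  by rewrite -(setU1K xA) e setU1K.
have dH : [disjoint G1 :|: G0 & H].
  apply/pred0P => A /=; apply/negbTE/negP => /andP[hA /imsetP[B _ e]].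
  have: x \in A by rewrite e setU11.
  by apply/negP; move: hA; rewrite in_setU => /orP[/xG1|/xG0].
have /eqP cU : #|(G1 :|: G0) :|: H| == (#|G1 :|: G0| + #|H|)%N.
  by rewrite (leq_card_setU _ _).2.
rewrite -cardsUI -cH -cU.
apply: subset_leq_card; apply/subsetP => A; rewrite !in_setU => /orP[/orP[]|].
- by rewrite !inE; exact: shatters_sub.
- by rewrite !inE; exact: shatters_sub.
move=> /imsetP[B]; rewrite !inE => /andP[B1 B0] ->.
have xB : x \notin B by apply: xG1; rewrite inE.
apply/shattersP => C CB; have [xC|xC] := boolP (x \in C).
  have [|S SF e] := shattersP _ _ B1 (C :\ x).
    by rewrite subDset.
  exists S; first exact: (subsetP F1F).
  rewrite setIUr e setIC (_ : [set x] :&: S = [set x]) ?setD1K//.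
  by apply/setIidPl; rewrite sub1set; move: SF; rewrite inE => /andP[].
have [|S SF e] := shattersP _ _ B0 C.
  by rewrite -(setU1K xB) subsetD1 CB.
exists S; first exact: (subsetP F0F).
rewrite setIUr e (_ : S :&: [set x] = set0) ?set0U//.
apply/setP => z; rewrite !inE; apply/negbTE/negP => /andP[zS /eqP zx].
by move: SF; rewrite inE -zx zS andbF.
Qed.

(** A set with at most [D] elements is the set of non-[None] values of a function from ['I_D] to
    [option T], with [None] as padding; there are [#|T|.+1 ^ D] such functions. *)
Lemma card_small_sets (T : finType) (D : nat) :
  (#|[set A : {set T} | (#|A| <= D)%N]| <= #|T|.+1 ^ D)%N.
Proof.
pose im (f : {ffun 'I_D -> option T}) := [set x : T | Some x \in codom f].
rewrite -(card_option T) -{2}(card_ord D) -card_ffun.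
apply: leq_trans (leq_imset_card im predT).
apply: subset_leq_card; apply/subsetP => A; rewrite inE => AD.
apply/imsetP; exists [ffun j : 'I_D => onth (enum A) j] => //.
apply/setP => x; rewrite inE; apply/idP/idP => [xA|/codomP[j]].
  have xs : (index x (enum A) < #|A|)%N by rewrite cardE index_mem mem_enum.
  apply/codomP; exists (Ordinal (leq_trans xs AD)); rewrite ffunE /=.
  by rewrite onthE (nth_map x) ?nth_index ?mem_enum// -cardE.
rewrite ffunE onthE => /esym; have [lt|ge] := ltnP j (size (enum A)).
  by rewrite (nth_map x)// => -[<-]; rewrite -mem_enum mem_nth.
by rewrite nth_default ?size_map.
Qed.

Definition halfspace {R : realFieldType} (D n : nat) (y : 'I_n -> 'rV[R]_D)
  (v : 'cV[R]_D) : {set 'I_n} := [set i | 0 < (y i *m v) 0 0].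

(** More than [D] vectors are linearly dependent. A half-space that selects exactly the vectors with
    positive coefficient makes every term of the vanishing combination nonnegative, and one of them
    positive. *)
Lemma halfspace_shatter_card {R : realFieldType} (D n : nat) (y : 'I_n -> 'rV[R]_D)
    (A : {set 'I_n}) :
  (forall B : {set 'I_n}, B \subset A -> exists v, halfspace y v :&: A = B) -> (#|A| <= D)%N.
Proof.
move=> hA; rewrite leqNgt; apply/negP => ltDA.
pose Y := \matrix_(j < #|A|) y (enum_val j).
have [c c0 cY] : exists2 c : 'rV[R]_#|A|, c != 0 & c *m Y = 0.
  have : kermx Y != 0.
    rewrite kermx_eq0 -row_leq_rank -ltnNge.
    exact: leq_ltn_trans (rank_leq_col _) ltDA.
  case/rowV0Pn => c /sub_kermxP cY c0; by exists c.
wlog [j cj] : c c0 cY / exists j, 0 < c 0 j.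
  move=> hw; have [j cj] : exists j, c 0 j != 0 by apply/rV0Pn.
  have [lt0|gt0|e] := ltgtP 0 (c 0 j); last by rewrite e eqxx in cj.
    by apply: (hw c) => //; exists j.
  apply: (hw (- c)); rewrite ?oppr_eq0// ?mulNmx ?cY ?oppr0//.
  by exists j; rewrite mxE oppr_gt0.
have [|v hv] := hA [set enum_val j | j in [pred j | 0 < c 0 j]].
  by apply/subsetP => _ /imsetP[i _ ->]; exact: enum_valP.
have hvj i : (0 < (Y *m v) i 0) = (0 < c 0 i).
  transitivity (enum_val i \in halfspace y v :&: A).
    rewrite !inE enum_valP andbT; congr (0 < _).
    by rewrite !mxE; apply: eq_bigr => l _; rewrite !mxE.
  rewrite hv mem_imset ?inE//; exact: enum_val_inj.
have /matrixP/(_ 0 0) : c *m (Y *m v) = 0 by rewrite mulmxA cY mul0mx.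
rewrite mxE [RHS]mxE => /eqP; apply/negP; rewrite gt_eqF//.
rewrite (bigD1 j)//= ltr_pwDl//; first by rewrite mulr_gt0 ?hvj.
apply: sumr_ge0 => i _; have := hvj i; case: (ltrP 0 (c 0 i)) => ci.
  by move=> h; rewrite mulr_ge0// ltW.
by move/negbT; rewrite -leNgt => h; rewrite mulr_le0.
Qed.

Lemma card_halfspace_traces {R : realFieldType} (D n : nat) (y : 'I_n -> 'rV[R]_D)
    (F : {set {set 'I_n}}) :
  (forall S, S \in F -> exists v, S = halfspace y v) -> (#|F| <= n.+1 ^ D)%N.
Proof.
move=> hF; apply: leq_trans (pajor F) _.
have := card_small_sets 'I_n D; rewrite card_ord; apply: leq_trans.
apply: subset_leq_card; apply/subsetP => A; rewrite !inE => /shattersP hA.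
apply: (halfspace_shatter_card (y := y)) => B /hA[S /hF[v ->] e]; by exists v.
Qed.

Lemma subset_of_card (T : finType) (A : {set T}) (n : nat) :
  (n <= #|A|)%N -> exists2 B : {set T}, B \subset A & #|B| = n.
Proof.
elim: n => [|n IH] leA; first by exists set0; rewrite ?sub0set ?cards0.
have [B BA cB] := IH (ltnW leA).
have : (0 < #|A :\: B|)%N.
  by rewrite cardsD (setIidPr BA) cB subn_gt0.
case/card_gt0P => x; rewrite inE => /andP[xB xA].
by exists (x |: B); rewrite ?subUset ?sub1set ?xA// cardsU1 xB cB.
Qed.

Definition symdiff (T : finType) (A B : {set T}) : {set T} := (A :\: B) :|: (B :\: A).

Lemma in_symdiff (T : finType) (A B : {set T}) x :
  (x \in symdiff A B) = ((x \in A) != (x \in B)).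
Proof. by rewrite !inE; case: (x \in A); case: (x \in B). Qed.

(* Dudley's sampling argument: if the family were larger than (n+1)^D, then n
   points drawn at random according to w would distinguish all its members,
   which would give more than (n+1)^D half-space traces on n points. *)
Lemma halfspace_packing {R : realFieldType} (D n k : nat) (w : 'I_k -> R)
    (y : 'I_k -> 'rV[R]_D) (C rho : R) (F : {set {set 'I_k}}) :
  (forall i, 0 <= w i) -> \sum_i w i <= C -> 0 < rho ->
  (((n.+1 ^ D).+1 ^ 2)%N%:R * (1 - rho / C) ^+ n < 1 :> R) ->
  (forall S, S \in F -> exists v, S = halfspace y v) ->
  (forall S S', S \in F -> S' \in F -> S != S' ->
     rho <= \sum_(i in symdiff S S') w i) ->
  (#|F| <= n.+1 ^ D)%N.
Proof.
move=> w0 wC rho0 hn hF sepF; rewrite leqNgt; apply/negP => ltF.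
(* Keeping exactly one member more than the bound makes the number of ordered pairs equal to the
   squared factor in the hypothesis on [n]. *)
have [F' F'F cF'] := subset_of_card ltF.
set W := \sum_i w i in wC.
have sdW (A : {set 'I_k}) : \sum_(i in A) w i <= W.
  by rewrite /W [leRHS](bigID (mem A))/= lerDl sumr_ge0.
have rhoW : rho <= W.
  have /card_gt1P[S [S' [SF SF' nS]]] : (1 < #|F'|)%N by rewrite cF' ltnS expn_gt0.
  by apply: le_trans (sdW (symdiff S S')); rewrite sepF// (subsetP F'F).
have W0 : 0 < W := lt_le_trans rho0 rhoW.
have C0 : 0 < C := lt_le_trans W0 wC.
pose good (f : {ffun 'I_n -> 'I_k}) := [forall S in F', forall S' in F',
  (S != S') ==> [exists j, f j \in symdiff S S']].
(* Union bound in unnormalized form: all samples together weigh [W ^+ n], while those that miss the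
   symmetric difference of a given pair weigh at most [(W - rho) ^+ n]. Were no sample good, the
   pairs would have to account for the whole of [W ^+ n]. *)
have [f goodf] : exists f, good f.
  apply/existsP; apply: contraT => /existsPn nogood.
  have tot : W ^+ n = \sum_(f : {ffun 'I_n -> 'I_k}) \prod_j w (f j).
    by rewrite -(bigA_distr_bigA (fun _ => w))/= prodr_const card_ord.
  have : W ^+ n <= \sum_(S in F') \sum_(S' in F') (W - rho) ^+ n.
    rewrite tot; apply: (@le_trans _ _ (\sum_(S in F') \sum_(S' in F' | S != S')
      \sum_(f : {ffun 'I_n -> 'I_k} | f \in ffun_on (~: symdiff S S')) \prod_j w (f j))).
      rewrite [leRHS](_ : _ = \sum_(f : {ffun 'I_n -> 'I_k}) \sum_(S in F')
         \sum_(S' in F' | (S != S') && (f \in ffun_on (~: symdiff S S'))) \prod_j w (f j)); last first.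
        rewrite [RHS]exchange_big/=; apply: eq_bigr => S SF.
        under [LHS]eq_bigr do rewrite big_mkcond/=.
        rewrite exchange_big/=; apply: eq_bigr => f _.
        by rewrite -big_mkcondr/=; apply: eq_bigl => S'; rewrite andbA.
      apply: ler_sum => f _.
      have := nogood f; rewrite negb_forall_in => /existsP[S /andP[SF]].
      rewrite negb_forall_in => /existsP[S' /andP[SF']].
      rewrite negb_imply => /andP[nS /existsPn fS].
      have pr0 : 0 <= \prod_j w (f j) by apply: prodr_ge0.
      rewrite (bigD1 S)//= (bigD1 S')/=; last first.
        rewrite SF' nS/=; apply/ffun_onP => j; rewrite inE; exact: fS.
      by rewrite -addrA lerDl addr_ge0 ?sumr_ge0// => *; rewrite sumr_ge0.
    apply: ler_sum => S SF; rewrite [leRHS](bigID (fun S' => S != S'))/=.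
    rewrite -[leLHS]addr0 lerD ?sumr_ge0//; last first.
      by move=> *; rewrite exprn_ge0// subr_ge0.
    apply: ler_sum => S' /andP[SF' nS].
    rewrite -(bigA_distr_big (mem (~: symdiff S S')) (fun _ => w))/=.
    rewrite prodr_const card_ord lerXn2r ?nnegrE ?subr_ge0 ?sumr_ge0//.
    rewrite lerBrDr; apply: (@le_trans _ _ (\sum_(i in ~: symdiff S S') w i + \sum_(i in symdiff S S') w i)).
      by rewrite lerD2l sepF// (subsetP F'F).
    rewrite addrC /W [leRHS](bigID (mem (symdiff S S')))/= lerD2l.
    by rewrite le_eqVlt; apply/orP; left; apply/eqP/eq_bigl => i; rewrite inE.
  rewrite !sumr_const cF' -mulrnA mulnn => h.
  have : W ^+ n < W ^+ n; last by rewrite ltxx.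
  apply: le_lt_trans h _.
  have le1 : (W - rho) ^+ n <= W ^+ n * (1 - rho / C) ^+ n.
    have h0 : 0 <= W * (1 - rho / C).
      apply: mulr_ge0; first exact: ltW.
      by rewrite subr_ge0 ler_pdivrMr// mul1r (le_trans rhoW).
    rewrite -exprMn lerXn2r ?nnegrE ?subr_ge0//.
    rewrite mulrBr mulr1 lerD2l lerN2 mulrCA ger_pMr//.
    by rewrite ler_pdivrMr// mul1r.
  rewrite -mulr_natl.
  apply: (@le_lt_trans _ _ (((n.+1 ^ D).+1 ^ 2)%N%:R * (W ^+ n * (1 - rho / C) ^+ n))).
    by rewrite ler_wpM2l.
  by rewrite mulrCA gtr_pMr// exprn_gt0.
(* Sample points may repeat, so traces are taken on the index set ['I_n] of the sample; they are
   again half-space traces, of the vectors [y \o f]. *)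
pose tr (S : {set 'I_k}) := [set j | f j \in S].
have trinj : {in F' &, injective tr}.
  move=> S S' SF SF' e; apply/eqP; apply: contraT => nS.
  have /forall_inP/(_ _ SF)/forall_inP/(_ _ SF')/implyP/(_ nS)/existsP[j] := goodf.
  rewrite in_symdiff => /negP; case; apply/eqP.
  by have /setP/(_ j) := e; rewrite !inE.
have : (#|tr @: F'| <= n.+1 ^ D)%N.
  apply: (card_halfspace_traces (y := y \o f)) => _ /imsetP[S /(subsetP F'F)/hF[v ->] ->].
  by exists v; apply/setP => j; rewrite !inE.
by rewrite card_in_imset// cF' ltnn.
Qed.

From mathcomp Require Import all_classical all_reals all_analysis.
From mathcomp Require Import measurable_realfun.
Import numFieldNormedType.Exports.

(** The prefactor is at most [4 ^ D.+1 * n ^ (2 D)], and [(1 - h) ^+ n] is at most [expR (- h n)],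
    which is beaten by the term of degree [2 D + 1] of the exponential series. For [h > 1] the
    choice [n = 1] makes the product negative. *)
Lemma polynomial_lt_geometric {R : realType} (D : nat) (h : R) : 0 < h ->
  exists n, ((n.+1 ^ D).+1 ^ 2)%N%:R * (1 - h) ^+ n < 1.
Proof.
move=> h0; have [h1|h1] := ltP 1 h.
  by exists 1; rewrite expr1 (@lt_trans _ _ 0)// pmulr_rlt0 ?subr_lt0.
pose m := D.*2; pose c := (4 ^ D.+1)%N%:R * m.+1`!%:R / h ^+ m.+1.
have c0 : 0 <= c by rewrite mulr_ge0 ?invr_ge0 ?exprn_ge0 ?mulr_ge0// ltW.
pose n := (Num.truncn c).+1; exists n.
have nc : c < n%:R by exact: truncnS_gt.
have n0 : 0 < n%:R :> R by apply: le_lt_trans nc.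
have e1 : (1 - h) ^+ n <= (expR (h * n%:R))^-1.
  rewrite -expRN -mulNr expRM_natr lerXn2r ?nnegrE ?subr_ge0 ?expR_ge0//.
  exact: expR_ge1Dx.
have e2 : (h * n%:R) ^+ m.+1 / m.+1`!%:R < expR (h * n%:R).
  have := expR_ge1Dxn m (mulr_ge0 (ltW h0) (ltW n0)).
  by apply: lt_le_trans; rewrite ltrDr.
have e3 : ((n.+1 ^ D).+1 ^ 2)%N%:R <= (4 ^ D.+1)%N%:R * n%:R ^+ m :> R.
  rewrite -natrX -natrM ler_nat (@leq_trans ((2 * (2 * n) ^ D) ^ 2))//.
    rewrite leq_exp2r// mul2n -addnn -addn1 leq_add// ?expn_gt0//.
    by case: (D) => // d; rewrite leq_exp2r// mul2n -addnn addnS ltnS leq_addr.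
  rewrite expnMn -expnM expnMn expnS mulnA leq_mul// ?muln2//.
  by rewrite expnS (_ : 4 ^ D = 2 ^ D.*2)%N// -mul2n expnM.
apply: le_lt_trans (ler_pM _ _ e3 e1) _ => //.
  by rewrite exprn_ge0// subr_ge0.
rewrite ltr_pdivrMr ?expR_gt0// mul1r; apply: le_lt_trans e2.
have hm0 : 0 < h ^+ m.+1 by rewrite exprn_gt0.
have ec : c * h ^+ m.+1 = (4 ^ D.+1)%N%:R * m.+1`!%:R by rewrite divfK ?gt_eqF.
rewrite ler_pdivlMr ?ltr0n ?fact_gt0// mulrAC -ec exprMn (exprSr n%:R).
rewrite -mulrA [leLHS]mulrC mulrA ler_wpM2l ?ltW//.
by rewrite mulr_gt0 ?exprn_gt0.
Qed.

(** A maximal [rho]-separated family of half-space traces is a cover, and its size is bounded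
    independently of [k], of the weights and of the points. This independence lets a union bound
    survive as [k] grows. *)
Lemma halfspace_cover {R : realType} (D : nat) (C rho : R) : 0 < C -> 0 < rho ->
  exists N0 : nat, forall (k : nat) (w : 'I_k -> R) (y : 'I_k -> 'rV[R]_D),
    (forall i, 0 <= w i) -> \sum_i w i <= C ->
    exists F : {set {set 'I_k}}, (#|F| <= N0)%N /\
      (forall v, exists2 S, S \in F & \sum_(i in symdiff (halfspace y v) S) w i < rho).
Proof.
move=> C0 rho0.
have [n hn] : exists n, ((n.+1 ^ D).+1 ^ 2)%N%:R * (1 - rho / C) ^+ n < 1 :> R.
  exact: polynomial_lt_geometric (divr_gt0 rho0 C0).
exists (n.+1 ^ D)%N => k w y w0 wC.
pose packing (F : {set {set 'I_k}}) :=
  (forall S, S \in F -> exists v, S = halfspace y v) /\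
  (forall S S', S \in F -> S' \in F -> S != S' -> rho <= \sum_(i in symdiff S S') w i).
have pack_le F : packing F -> (#|F| <= n.+1 ^ D)%N.
  by case=> h1 h2; exact: (halfspace_packing w0 wC rho0 hn h1 h2).
(* Without a cover every packing could be enlarged, so there would be packings of every size,
   against [pack_le]. *)
apply: contrapT => ncover.
have grow F : packing F -> exists2 F', packing F' & #|F'| = #|F|.+1.
  move=> pF; have [v hv] : exists v, forall S, S \in F ->
      rho <= \sum_(i in symdiff (halfspace y v) S) w i.
    apply: contrapT => /forallNP h; apply: ncover; exists F; split; first exact: pack_le.
    move=> v; have /existsNP[S /not_implyP[SF /negP]] := h v.
    by rewrite -ltNge => ?; exists S.
  have symC A B : symdiff A B = symdiff B A :> {set 'I_k} by rewrite /symdiff finset.setUC.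
  have vF : halfspace y v \notin F.
    apply/negP => /hv; rewrite leNgt => /negP; apply.
    by rewrite big1// => i; rewrite in_symdiff eqxx.
  exists (halfspace y v |: F)%SET; last by rewrite cardsU1 vF.
  case: pF => p1 p2; split=> [S|S S'].
    by rewrite in_setU1 => /orP[/eqP->|/p1//]; exists v.
  rewrite !in_setU1 => /orP[/eqP->|SF] /orP[/eqP->|SF'].
  - by rewrite eqxx.
  - by move=> _; exact: hv.
  - by move=> _; rewrite symC; exact: hv.
  - exact: p2.
have : forall j, exists2 F, packing F & #|F| = j.
  elim=> [|j [F /grow[F' pF' cF'] cF]]; last by exists F'; rewrite ?cF' ?cF.
  by exists finset.set0; rewrite ?cards0//; split=> S; rewrite inE.
by move/(_ (n.+1 ^ D).+1) => [F /pack_le + cF]; rewrite cF ltnn.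
Qed.

(** * Sums over the log-linear class *)

(* Peel off the lowest level of g: with m the least positive value,
   g = m 1_{g > 0} + (g - m)^+, and the level sets of (g - m)^+ are among those of g. *)
Lemma layer_cake_bound {R : realFieldType} (k : nat) (a g : 'I_k -> R) (U eta : R) :
  0 <= U -> (forall i, 0 <= g i <= U) ->
  (forall u, 0 <= u -> `|\sum_(i | u < g i) a i| <= eta) ->
  `|\sum_i a i * g i| <= U * eta.
Proof.
have [n] := ubnP #|[pred i | 0 < g i]|.
elim: n g U => // n IH g U /ltnSE cn U0 gU hu.
have eta0 : 0 <= eta by apply: le_trans (hu 0 (lexx _)).
have [/forallP g0|/forallPn[i0 gi0]] := boolP [forall i, g i == 0].
  rewrite big1 ?normr0; first exact: mulr_ge0.
  by move=> i _; rewrite (eqP (g0 i)) mulr0.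
have gp0 : 0 < g i0 by rewrite lt_def gi0; have /andP[] := gU i0.
case: (@Order.TotalTheory.arg_minP _ _ _ i0 (fun i => 0 < g i) g gp0) => j gj minj.
pose m := g j; pose g' i := if 0 < g i then g i - m else 0.
have mU : m <= U by have /andP[] := gU j.
have lvl u : 0 <= u -> (fun i => u < g' i) =1 (fun i => u + m < g i).
  move=> u0 i; rewrite /g'; case: ifPn => gi; first by rewrite ltrBrDr.
  rewrite ltNge u0; apply/esym/negbTE; move: gi; rewrite -!leNgt => gi.
  by rewrite (le_trans gi)// addr_ge0// ltW.
have gE : \sum_i a i * g i = \sum_i a i * g' i + m * \sum_(i | 0 < g i) a i.
  rewrite mulr_sumr [X in _ + X]big_mkcond/= -big_split/=; apply: eq_bigr => i _.
  rewrite /g'; case: ifPn => gi; first by ring.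
  have /andP[gi0' _] := gU i; rewrite -leNgt in gi.
  by rewrite (_ : g i = 0) ?mulr0 ?addr0//; apply/eqP; rewrite eq_le gi gi0'.
rewrite gE (le_trans (ler_normD _ _))// (_ : U * eta = (U - m) * eta + m * eta); last by ring.
apply: lerD; last by rewrite normrM gtr0_norm// ler_wpM2l ?hu// ltW.
apply: IH => [||i|u u0].
- apply: leq_trans cn; apply: proper_card; apply/properP; split.
    apply/fintype.subsetP => i; rewrite !inE /g'; case: ifPn => // _; by rewrite ltxx.
  by exists j; rewrite inE ?gj// /g' gj subrr ltxx.
- by rewrite subr_ge0.
- rewrite /g'; case: ifPn => gi; last by rewrite lexx subr_ge0.
  by rewrite subr_ge0 minj//= lerD2r; have /andP[] := gU i.
- by rewrite (eq_bigl _ _ (lvl u u0)) hu// addr_ge0// ltW.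
Qed.

(** Three pieces. Small residuals against [h] cut at [U] go through the layer cake, where removing
    the large residuals changes a level-set sum by at most [delta / M]. Small residuals against the
    excess of [h] over [U] use that this excess is at most [h ^+ 2 / U]. Large residuals are paired
    with [h] by the arithmetic-geometric inequality with parameter [kappa]. *)
Lemma weighted_sum_bound {R : realFieldType} (k : nat) (w xi h : 'I_k -> R)
    (M delta eta U kappa : R) :
  (forall i, 0 <= w i) -> (forall i, 0 <= h i) ->
  0 < M -> 0 < U -> 0 < kappa ->
  \sum_(i | M < `|xi i|) w i * xi i ^+ 2 <= delta ->
  (forall u, 0 <= u -> `|\sum_(i | u < h i) w i * xi i| <= eta) ->
  `|\sum_i w i * xi i * h i| <=
    U * (eta + delta / M) + delta / kappa + (M / U + kappa) * \sum_i w i * h i ^+ 2.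
Proof.
move=> w0 h0 M0 U0 kappa0 hd heta.
pose xi1 i := if M < `|xi i| then 0 else xi i.
pose xi2 i := if M < `|xi i| then xi i else 0.
have xiE i : xi i = xi1 i + xi2 i by rewrite /xi1 /xi2; case: ifP; rewrite ?add0r ?addr0.
pose g i := Num.min (h i) U.
have sE : \sum_i w i * xi i * h i = \sum_i (w i * xi1 i) * g i +
   \sum_i w i * xi1 i * (h i - g i) + \sum_i w i * xi2 i * h i.
  rewrite -!big_split/=; apply: eq_bigr => i _; rewrite xiE; ring.
have d2 : \sum_i w i * xi2 i ^+ 2 <= delta.
  apply: le_trans hd; rewrite [leRHS]big_mkcond/=; apply: ler_sum => i _.
  by rewrite /xi2; case: ifP; rewrite ?expr0n ?mulr0.
have b1 : `|\sum_i (w i * xi1 i) * g i| <= U * (eta + delta / M).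
  apply: layer_cake_bound => [|i|u u0]; first exact: ltW.
    by rewrite le_min h0 ge_min lexx orbT ltW.
  have [uU|uU] := ltP u U; last first.
    rewrite big_pred0 ?normr0; last first.
      by move=> i; rewrite lt_min [u < U]ltNge uU andbF.
    rewrite addr_ge0 ?divr_ge0 ?(ltW M0)//; first exact: le_trans (heta 0 (lexx _)).
    by apply: le_trans d2; apply: sumr_ge0 => i _; rewrite mulr_ge0 ?sqr_ge0.
  rewrite (eq_bigl (fun i => u < h i)); last by move=> i; rewrite lt_min uU andbT.
  rewrite (_ : \sum_(i | u < h i) w i * xi1 i =
     \sum_(i | u < h i) w i * xi i - \sum_(i | u < h i) w i * xi2 i); last first.
    by rewrite -sumrB; apply: eq_bigr => i _; rewrite xiE; ring.
  rewrite (le_trans (ler_normB _ _))// lerD ?heta//.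
  rewrite ler_pdivlMr// (le_trans _ d2)//.
  rewrite (le_trans (ler_wpM2r (ltW M0) (ler_norm_sum _ _ _)))// mulr_suml.
  rewrite big_mkcond/=; apply: ler_sum => i _; case: ifP => _; last first.
    by rewrite mulr_ge0 ?sqr_ge0.
  rewrite normrM ger0_norm// -mulrA ler_wpM2l// /xi2.
  case: ifPn => [Mx|_]; last by rewrite normr0 mul0r expr0n.
  by rewrite -real_normK ?num_real// expr2 ler_wpM2l// ltW.
have b2 : `|\sum_i w i * xi1 i * (h i - g i)| <= M / U * \sum_i w i * h i ^+ 2.
  rewrite mulr_sumr (le_trans (ler_norm_sum _ _ _))//; apply: ler_sum => i _.
  have gh : 0 <= h i - g i by rewrite subr_ge0 ge_min lexx.
  have hU : h i - g i <= h i ^+ 2 / U.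
    rewrite ler_pdivlMr// /g; have [_|lt] := leP (h i) U.
      by rewrite subrr mul0r sqr_ge0.
    rewrite expr2 ler_pM ?subr_ge0 ?(ltW lt) ?(ltW U0)//.
    by rewrite gerBl ltW.
  rewrite normrM normrM (ger0_norm (w0 i)) (ger0_norm gh) -mulrA.
  rewrite [leRHS](_ : _ = w i * (M * (h i ^+ 2 / U))); last by ring.
  rewrite ler_wpM2l// ler_pM// /xi1; case: ifPn; first by rewrite normr0 ltW.
  by rewrite -leNgt.
have b3 : `|\sum_i w i * xi2 i * h i| <= delta / kappa + kappa * \sum_i w i * h i ^+ 2.
  rewrite (le_trans (ler_norm_sum _ _ _))//.
  apply: (@le_trans _ _ ((\sum_i w i * xi2 i ^+ 2) / kappa + kappa * \sum_i w i * h i ^+ 2)).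
    rewrite mulr_suml mulr_sumr -big_split/=; apply: ler_sum => i _.
    rewrite !normrM ger0_norm// (ger0_norm (h0 i)).
    rewrite [leRHS](_ : _ = w i * (xi2 i ^+ 2 / kappa + kappa * h i ^+ 2)); last by ring.
    rewrite -mulrA ler_wpM2l// -(@ler_pM2l _ kappa)// -(real_normK (num_real (xi2 i))).
    rewrite [leRHS](_ : _ = `|xi2 i| ^+ 2 + (kappa * h i) ^+ 2); last first.
      by field; rewrite gt_eqF.
    rewrite mulrCA; move: (normr_ge0 (xi2 i)) (mulr_ge0 (ltW kappa0) (h0 i)).
    move: `|xi2 i| (kappa * h i) => x y x0 y0.
    by nra.
  by rewrite lerD2r ler_wpM2r// invr_ge0 ltW.
rewrite sE (le_trans (ler_normD _ _))// (le_trans (lerD (ler_normD _ _) (lexx _)))//.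
rewrite (le_trans (lerD (lerD b1 b2) b3))//.
by rewrite mulrDl; lra.
Qed.

(* The coordinates [ln m] and [1] turn the level sets of [exp(x b) / m] into
   homogeneous half-spaces. *)
Definition log_linear_features {R : realType} (p k : nat) (x : 'I_k -> 'rV[R]_p)
  (m : 'I_k -> R) (i : 'I_k) : 'rV[R]_(p + 2) :=
  row_mx (x i) (\row_j (if j == 0 then ln (m i) else 1)).

Lemma log_linear_level_set {R : realType} (p k : nat) (x : 'I_k -> 'rV[R]_p)
    (m : 'I_k -> R) (b : 'rV[R]_p) (u : R) :
  (forall i, 0 < m i) -> 0 <= u ->
  exists v, forall i, (u < expR (dotp (x i) b) / m i) =
                      (i \in halfspace (log_linear_features x m) v).
Proof.
(* At [u = 0] the level set is everything and [ln u] is meaningless; the vector supported on the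
   constant coordinate selects all points. *)
move=> m0; rewrite le_eqVlt => /orP[/eqP<-|u0].
  exists (col_mx 0 (\col_j (if j == 0 then 0 else 1))) => i.
  rewrite inE /log_linear_features mul_row_col mulmx0 add0r mxE !big_ord_recl big_ord0.
  by rewrite !mxE/= mulr0 add0r addr0 mulr1 ltr01 divr_gt0// expR_gt0.
exists (col_mx b^T (\col_j (if j == 0 then - 1 else - ln u))) => i.
rewrite inE /log_linear_features mul_row_col 3!mxE !big_ord_recl big_ord0 !mxE/=.
rewrite ltr_pdivlMr// -{1}(lnK u0) -{1}(lnK (m0 i)) -expRD ltr_expR.
rewrite (_ : \sum_j _ = dotp (x i) b); last by apply: eq_bigr => j _; rewrite mxE.
by rewrite -subr_gt0; congr (0 < _); ring.
Qed.

(** Exchanging [A] for [B] costs at most the sum of [w i * |xi i|] over the symmetric difference: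
    residuals up to [M] are charged to its weight, larger ones satisfy [|xi i| <= xi i ^+ 2 / M]. *)
Lemma sum_symdiff_bound {R : realFieldType} (k : nat) (w xi : 'I_k -> R)
    (A B : {set 'I_k}) (M delta : R) :
  (forall i, 0 <= w i) -> 0 < M ->
  \sum_(i | M < `|xi i|) w i * xi i ^+ 2 <= delta ->
  `|\sum_(i in A) w i * xi i| <=
  `|\sum_(i in B) w i * xi i| + M * \sum_(i in symdiff A B) w i + delta / M.
Proof.
move=> w0 M0 hd.
have step : `|\sum_(i in A) w i * xi i - \sum_(i in B) w i * xi i| <=
    M * \sum_(i in symdiff A B) w i + delta / M.
  apply: (@le_trans _ _ (M * \sum_(i in symdiff A B) w i +
     (\sum_(i | M < `|xi i|) w i * xi i ^+ 2) / M)); last first.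
    by rewrite lerD2l ler_wpM2r// invr_ge0 ltW.
  rewrite mulr_sumr mulr_suml [X in `|X - _|]big_mkcond/= [X in `|_ - X|]big_mkcond/= -sumrB (le_trans (ler_norm_sum _ _ _))//.
  rewrite [X in _ <= X + _]big_mkcond/= [X in _ <= _ + X]big_mkcond/= -big_split/=; apply: ler_sum => i _; rewrite in_symdiff.
  have key : w i * `|xi i| <= M * w i + (if M < `|xi i| then w i * xi i ^+ 2 / M else 0).
    case: ifPn => [lt|]; last by rewrite -leNgt addr0 mulrC => ?; rewrite ler_wpM2r.
    apply: (@le_trans _ _ (w i * xi i ^+ 2 / M)); last by rewrite lerDr mulr_ge0 ?(ltW M0).
    rewrite -mulrA ler_wpM2l// ler_pdivlMr// -real_normK ?num_real// expr2.
    by rewrite ler_wpM2l// ltW.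
  have fin0 : 0 <= (if M < `|xi i| then w i * xi i ^+ 2 / M else 0).
    by case: ifP => // _; apply: divr_ge0 (mulr_ge0 (w0 i) (sqr_ge0 _)) (ltW M0).
  case: (i \in A); case: (i \in B) => /=.
  - by rewrite subrr normr0 add0r.
  - by rewrite subr0 normrM ger0_norm.
  - by rewrite sub0r normrN normrM ger0_norm.
  - by rewrite subrr normr0 add0r.
rewrite -addrA -lerBlDl; apply: le_trans step; exact: lerB_dist.
Qed.

(** Each level set is replaced by a nearby member of the finite cover. Of the two terms [delta / M],
    one pays for this replacement and the other for truncating the residuals. *)
Lemma log_linear_sum_bound {R : realType} (p k : nat) (x : 'I_k -> 'rV[R]_p)
    (m w xi : 'I_k -> R) (F : {set {set 'I_k}}) (M delta eta rho U kappa : R)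
    (b : 'rV[R]_p) :
  (forall i, 0 < m i) -> (forall i, 0 <= w i) ->
  0 < M -> 0 < U -> 0 < kappa ->
  (forall v, exists2 S, S \in F &
     \sum_(i in symdiff (halfspace (log_linear_features x m) v) S) w i < rho) ->
  \sum_(i | M < `|xi i|) w i * xi i ^+ 2 <= delta ->
  (forall S, S \in F -> `|\sum_(i in S) w i * xi i| <= eta) ->
  `|\sum_i w i * xi i * (expR (dotp (x i) b) / m i)| <=
    U * (eta + M * rho + delta / M + delta / M) + delta / kappa
    + (M / U + kappa) * \sum_i w i * (expR (dotp (x i) b) / m i) ^+ 2.
Proof.
move=> m0 w0 M0 U0 kappa0 hF hd heta.
apply: weighted_sum_bound => // [i|u u0].
  by rewrite divr_ge0 ?expR_ge0// ltW.
have [v hv] := log_linear_level_set x b m0 u0.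
rewrite (eq_bigl _ _ hv); have [S SF hS] := hF v.
apply: le_trans (sum_symdiff_bound _ S w0 M0 hd) _.
by rewrite lerD2r lerD ?heta// ler_wpM2l ?(ltW M0)// ltW.
Qed.

Local Open Scope classical_set_scope.

(** * Moments and independence *)


Section product_expectation.
Import HBNNSimple.
Context {R : realType} {d} {Omega : measurableType d} (P : probability Omega R).

Lemma cvg_integral_nondecreasing (f_ : nat -> Omega -> R) (f : Omega -> R) :
  (forall n, measurable_fun setT (f_ n)) -> (forall n w, 0 <= f_ n w) ->
  (forall w n m, (n <= m)%N -> f_ n w <= f_ m w) ->
  (forall w, f_ n w @[n --> \oo] --> f w) ->
  ((\int[P]_w (f_ n w)%:E) @[n --> \oo] --> \int[P]_w (f w)%:E)%E.
Proof.
move=> mf f0 ndf cf.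
rewrite (_ : (\int[P]_w (f w)%:E = \int[P]_w (limn (fun n => (f_ n w)%:E)))%E).
  apply: cvg_monotone_convergence => //.
  - by move=> n; exact/measurable_EFinP.
  - by move=> n w _; rewrite lee_fin.
  - by move=> w _ n m nm; rewrite lee_fin ndf.
apply: eq_integral => w _; apply/esym/cvg_lim => //.
by apply: cvg_EFin; [exact: nearW|exact: cf].
Qed.

(** [Z] stands for the product of the remaining factors, and [B = setT] shows that [K] is its mean.
    The identity passes from indicators to simple functions, then to [g] by monotone convergence. *)
Lemma expectation_mul_indep (X Z : Omega -> R) (K : R) :
  measurable_fun setT X -> measurable_fun setT Z -> (forall w, 0 <= Z w) ->
  (forall B, measurable B ->
     (\int[P]_w (\1_B (X w) * Z w)%:E = P (X @^-1` B) * K%:E)%E) ->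
  forall g : R -> R, measurable_fun setT g -> (forall u, 0 <= g u) ->
  (\int[P]_w (g (X w) * Z w)%:E = \int[P]_w (g (X w))%:E * K%:E)%E.
Proof.
move=> mX mZ Z0 hB g mg g0.
have mXB B : measurable B -> measurable (X @^-1` B).
  by move=> mB; rewrite -[_ @^-1` _]setTI; exact: mX.
have K0 : 0 <= K.
  have := hB setT measurableT; rewrite preimage_setT probability_setT mul1e => h.
  by rewrite -lee_fin -h integral_ge0// => w _; rewrite lee_fin mulr_ge0.
have hs (h : {nnsfun measurableTypeR R >-> R}) :
  (\int[P]_w (h (X w) * Z w)%:E = \int[P]_w (h (X w))%:E * K%:E)%E.
  pose s : seq R := finmap.enum_fset (fset_set (range h)).
  pose I y w : R := \1_(h @^-1` [set y]) (X w).
  (* The absolute value makes each coefficient nonnegative without reference to the range of [h], as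
     the nonnegative linearity of the integral demands. *)
  have hE w : h (X w) = \sum_(y <- s) `|y| * I y w.
    rewrite {1}fimfunE fsbig_finite//= big_seq [RHS]big_seq; apply: eq_bigr => y.
    rewrite in_fset_set// inE => -[u _ <-]; by rewrite ger0_norm ?fun_ge0.
  have mB y : measurable (h @^-1` [set y]) by exact: measurable_funPTI.
  have mI y : measurable_fun setT (I y).
    by apply: (measurableT_comp _ mX); exact: (measurable_indic (mB y)).
  have -> : (\int[P]_w (h (X w))%:E =
     \sum_(y <- s) (`|y|%:E * P (X @^-1` (h @^-1` [set y]))))%E.
    transitivity (\int[P]_w (\sum_(y <- s) (`|y| * I y w)%:E))%E.
      by apply: eq_integral => w _; rewrite hE sumEFin.
    rewrite ge0_integral_sum//; last 2 first.
    - by move=> y; apply/measurable_EFinP; exact: measurable_funM.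
    - by move=> y w _; rewrite lee_fin mulr_ge0.
    apply: eq_bigr => y _; under eq_integral do rewrite EFinM.
    rewrite ge0_integralZl_EFin//; [|by move=> w _; rewrite lee_fin|exact/measurable_EFinP].
    rewrite -(setIT (X @^-1` _)) -integral_indic//; exact: (mXB _ (mB y)).
  transitivity (\sum_(y <- s) (`|y|%:E * (P (X @^-1` (h @^-1` [set y])) * K%:E)))%E.
    transitivity (\int[P]_w (\sum_(y <- s) (`|y| * (I y w * Z w))%:E))%E.
      apply: eq_integral => w _; rewrite hE mulr_suml sumEFin; congr (_%:E).
      by apply: eq_bigr => y _; rewrite mulrA.
    rewrite ge0_integral_sum//; last 2 first.
    - by move=> y; apply/measurable_EFinP; do 2 apply: measurable_funM => //.
    - by move=> y w _; rewrite lee_fin !mulr_ge0.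
    apply: eq_bigr => y _; under eq_integral do rewrite EFinM.
    rewrite ge0_integralZl_EFin//.
    - by rewrite (hB _ (mB y)).
    - by move=> w _; rewrite lee_fin mulr_ge0.
    - by apply/measurable_EFinP; exact: measurable_funM.
  rewrite muleC ge0_sume_distrr//; last by move=> y _; rewrite mule_ge0.
  by apply: eq_bigr => y _; rewrite muleA muleC.
have mEg : measurable_fun [set: measurableTypeR R] (EFin \o g) by exact/measurable_EFinP.
pose gn := nnsfun_approx (@measurableT _ (measurableTypeR R)) mEg.
have gn_cvg u : gn n u @[n --> \oo] --> g u.
  have := @cvg_nnsfun_approx _ _ _ _ (@measurableT _ (measurableTypeR R)) _ mEg
    (fun x _ => g0 x) u I.
  by move=> /fine_cvg.
have gn_nd u n m : (n <= m)%N -> gn n u <= gn m u.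
  by move=> /(nd_nnsfun_approx (@measurableT _ (measurableTypeR R)) mEg)/lefP.
have mgX n : measurable_fun setT (fun w => gn n (X w)).
  by apply: (measurableT_comp _ mX); exact: (measurable_funP (gn n)).
have c1 : (\int[P]_w (gn n (X w))%:E @[n --> \oo] --> \int[P]_w (g (X w))%:E)%E.
  by apply: cvg_integral_nondecreasing => // w n m nm; exact: gn_nd.
have c2 : (\int[P]_w (gn n (X w) * Z w)%:E @[n --> \oo] --> \int[P]_w (g (X w) * Z w)%:E)%E.
  apply: cvg_integral_nondecreasing => [n|n w|w n m nm|w].
  - exact: measurable_funM.
  - exact: mulr_ge0.
  - by rewrite ler_wpM2r// gn_nd.
  - by apply: cvgMl.
have c3 : (\int[P]_w (gn n (X w))%:E * K%:E @[n --> \oo] --> \int[P]_w (g (X w))%:E * K%:E)%E.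
  by apply: cvgeZr.
have c4 : (\int[P]_w (gn n (X w) * Z w)%:E @[n --> \oo] --> \int[P]_w (g (X w))%:E * K%:E)%E.
  by under eq_fun do rewrite hs; exact: c3.
exact: (cvg_unique _ c2 c4).
Qed.

(* [G] is the class of Borel sets for the random effects, and the class of
   singletons [set n%:R] for the counts. *)
Lemma ge0_expectation_prod (I : eqType) (X : I -> Omega -> R) (J : set I)
    (G : set (set R)) :
  (forall i, measurable_fun setT (X i)) -> (forall B, G B -> measurable B) ->
  (forall i (Z : Omega -> R) (K : R), J i -> measurable_fun setT Z ->
     (forall w, 0 <= Z w) -> 0 <= K ->
     (forall B, G B -> (\int[P]_w (\1_B (X i w) * Z w)%:E = P (X i @^-1` B) * K%:E)%E) ->
     forall g : R -> R, measurable_fun setT g -> (forall u, 0 <= g u) ->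
     (\int[P]_w (g (X i w) * Z w)%:E = \int[P]_w (g (X i w))%:E * K%:E)%E) ->
  (forall (s : seq I) (B : I -> set R), uniq s -> (forall i, i \in s -> J i) ->
     (forall i, i \in s -> G (B i)) ->
     P (\bigcap_(i in [set` s]) (X i @^-1` B i)) = (\prod_(i <- s) P (X i @^-1` B i))%E) ->
  forall (s : seq I) (g : I -> R -> R) (e : I -> R), uniq s ->
    (forall i, i \in s -> J i) ->
    (forall i, measurable_fun setT (g i)) -> (forall i u, 0 <= g i u) ->
    (forall i, i \in s -> \int[P]_w (g i (X i w))%:E = (e i)%:E)%E ->
  (\int[P]_w (\prod_(i <- s) g i (X i w))%:E = (\prod_(i <- s) e i)%:E)%E.
Proof.
move=> mX mG step gen s g e us sJ mg g0 ge.
pose Q i (B : set R) : R := fine (P (X i @^-1` B)).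
have mXB i B : measurable B -> measurable (X i @^-1` B).
  by move=> mB; rewrite -[_ @^-1` _]setTI; exact: mX.
have QE i B : measurable B -> P (X i @^-1` B) = (Q i B)%:E.
  by move=> mB; rewrite fineK// fin_num_measure//; exact: mXB.
(* Strengthened for the induction: indices in [s] carry general functions, those in [s'] still carry
   indicators of sets of [G]. When [a] leaves [s], [step] reduces its function to indicators, and
   [a] joins [s']. *)
suff key s' (B : I -> set R) : uniq (s ++ s') -> (forall i, i \in s ++ s' -> J i) ->
    (forall i, i \in s' -> G (B i)) ->
    (\int[P]_w (\prod_(i <- s) g i (X i w) * \prod_(i <- s') \1_(B i) (X i w))%:E
     = (\prod_(i <- s) e i * \prod_(i <- s') Q i (B i))%:E)%E.
  transitivity (\int[P]_w (\prod_(i <- s) g i (X i w) *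
      \prod_(i <- [::]) \1_(set0 : set R) (X i w))%:E)%E.
    by apply: eq_integral => w _; rewrite big_nil mulr1.
  by rewrite (key [::] (fun=> set0)) ?cats0// big_nil mulr1.
have mI i (B' : set R) : measurable B' -> measurable_fun setT (fun w => \1_B' (X i w) : R).
  by move=> mB; apply: (measurableT_comp _ (mX i)); exact: (measurable_indic mB).
elim: s s' B us sJ ge => [|a s IH] s' B us sJ ge us' sJ' GB.
  transitivity (P (\bigcap_(i in [set` s']) (X i @^-1` B i))).
    rewrite -(setIT (\bigcap_(_ in _) _)) -integral_indic//; last first.
      apply: fin_bigcap_measurable => [|i si]; [exact: finite_seq|]; apply: mXB; apply: mG; exact: GB.
    apply: eq_integral => w _; rewrite big_nil mul1r; congr (_%:E).
    rewrite [RHS]indicE; case: (boolP (_ \in _)) => [|]; rewrite ?inE ?notin_setE/=.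
      move=> h; rewrite big_seq big1// => i si; rewrite indicE mem_set//.
      exact: (h i si).
    move=> /existsNP[i /not_implyP[si nB]].
    by rewrite (big_rem i)//= indicE memNset// mul0r.
  rewrite gen// big_nil mul1r -prodEFin; rewrite big_seq [RHS]big_seq.
  by apply: eq_bigr => i si; rewrite QE//; apply: mG; exact: GB.
have [aNs us2] : a \notin s ++ s' /\ uniq (s ++ s') by move: us' => /= /andP[].
pose Z w := \prod_(i <- s) g i (X i w) * \prod_(i <- s') \1_(B i) (X i w).
pose K := \prod_(i <- s) e i * \prod_(i <- s') Q i (B i).
transitivity (\int[P]_w (g a (X a w) * Z w)%:E)%E.
  by apply: eq_integral => w _; rewrite big_cons mulrA.
rewrite (step a Z K)//.
- by rewrite ge ?mem_head// -EFinM big_cons mulrA.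
- by apply: sJ; rewrite mem_head.
- apply: measurable_funM; first by apply: measurable_prod => i _; exact: measurableT_comp.
  apply: measurable_prod => i si; apply: mI; apply: mG; exact: GB.
- by move=> w; rewrite mulr_ge0// prodr_ge0.
- rewrite mulr_ge0//; first rewrite big_seq prodr_ge0// => i si.
    by rewrite -lee_fin -ge ?inE ?si ?orbT// integral_ge0// => w _; rewrite lee_fin.
  by rewrite prodr_ge0// => i _; rewrite fine_ge0.
move=> B' GB'; pose B2 i := if i == a then B' else B i.
have B2E i : i \in s' -> B2 i = B i.
  rewrite /B2; case: eqP => // -> as'; move: aNs; by rewrite mem_cat as' orbT.
transitivity (\int[P]_w (\prod_(i <- s) g i (X i w) *
    \prod_(i <- a :: s') \1_(B2 i) (X i w))%:E)%E.
  apply: eq_integral => w _; rewrite big_cons {1}/B2 eqxx /Z mulrCA; congr (_ * (_ * _))%:E.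
  by rewrite big_seq [RHS]big_seq; apply: eq_bigr => i /B2E->.
rewrite (IH (a :: s') B2).
- rewrite big_cons {1}/B2 eqxx QE; last exact: mG.
  rewrite -EFinM mulrCA /K; congr (_ * (_ * _))%:E.
  by rewrite big_seq [RHS]big_seq; apply: eq_bigr => i /B2E->.
- by move: us2; rewrite cat_uniq => /and3P[].
- by move=> i si; apply: sJ; rewrite inE si orbT.
- by move=> i si; apply: ge; rewrite inE si orbT.
- by move: us'; rewrite -[a :: s]cat1s -catA uniq_catCA.
- by move=> i; rewrite mem_cat inE orbCA => ?; apply: sJ'; rewrite /= inE mem_cat.
- move=> i; rewrite inE => /orP[/eqP->|si]; first by rewrite /B2 eqxx.
  by rewrite B2E//; exact: GB.
Qed.

(** Off a null set exactly one indicator of [X = n] is nonzero, so the series under the integral has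
    the single term [g (X w) * Z w]. *)
Lemma expectation_nat_valued (X Z : Omega -> R) :
  measurable_fun setT X -> measurable_fun setT Z -> (forall w, 0 <= Z w) ->
  P (X @^-1` range (fun n : nat => n%:R : R)) = 1%E ->
  forall g : R -> R, measurable_fun setT g -> (forall u, 0 <= g u) ->
  (\int[P]_w (g (X w) * Z w)%:E =
   \sum_(n <oo) (g n%:R)%:E * \int[P]_w (\1_[set (n%:R : R)] (X w) * Z w)%:E)%E.
Proof.
move=> mX mZ Z0 X1 g mg g0.
pose D := X @^-1` range (fun n : nat => n%:R : R).
have mI (B' : set R) : measurable B' -> measurable_fun setT (fun w => \1_B' (X w) : R).
  by move=> mB; apply: (measurableT_comp _ mX); exact: (measurable_indic mB).
pose F n w := ((g n%:R)%:E * (\1_[set (n%:R : R)] (X w) * Z w)%:E)%E.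
have mF n : measurable_fun setT (F n).
  by apply: measurable_funeM; apply/measurable_EFinP; apply: measurable_funM => //; exact: mI.
have F0 n w : (0 <= F n w)%E by rewrite mule_ge0// lee_fin// mulr_ge0.
transitivity (\int[P]_w (\sum_(n <oo) F n w))%E; last first.
  rewrite integral_nneseries//; apply: eq_eseriesr => n _.
  rewrite ge0_integralZl_EFin//.
  - by move=> w _; rewrite lee_fin mulr_ge0.
  - by apply/measurable_EFinP; apply: measurable_funM => //; exact: mI.
have mD : measurable D.
  rewrite -[D]setTI; apply: mX => //; apply: countable_measurable.
    by move=> u; exact: measurable_set1.
  exact: sub_countable (card_image_le _ _) (countableP _).
have PD0 : P (~` D) = 0%E by rewrite probability_setC// X1 subee.
apply: ge0_ae_eq_integral => //.
- by apply/measurable_EFinP; apply: measurable_funM => //; exact: measurableT_comp.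
- by apply: ge0_emeasurable_sum => // n w _ _; exact: F0.
- by move=> w _; rewrite lee_fin mulr_ge0.
- by move=> w _; exact: nneseries_ge0.
exists (~` D); split; first exact: measurableC.
- exact: PD0.
move=> w /=; apply: contra_not => -[m _ mE] _.
rewrite (@nneseriesD1 _ _ m)// eseries0 ?adde0.
  by rewrite /F indicE mem_set ?mE// mul1r EFinM.
move=> n _ /= nm; rewrite /F indicE memNset ?mul0r ?mule0//= -mE => /eqP.
by rewrite eqr_nat eq_sym (negbTE nm).
Qed.

End product_expectation.

(** Falling factorials cancel against [n!]: the terms below [j] vanish and the rest is the
    exponential series shifted by [j]. Their means are pure powers of [mu], so they pass to mixtures
    without correction terms. *)
Lemma poisson_factorial_moment {R : realType} (mu : R) (j : nat) : 0 <= mu ->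
  (\sum_(n <oo) ((n ^_ j)%:R * pois_pmf mu n)%:E = (mu ^+ j)%:E)%E.
Proof.
move=> mu0; apply/cvg_lim => //; rewrite -(cvg_shiftn j)/=.
rewrite (_ : mu ^+ j = mu ^+ j * expR (- mu) * expR mu); last first.
  by rewrite -mulrA -expRD addNr expR0 mulr1.
rewrite (_ : (fun _ => _) = (fun n => (mu ^+ j * expR (- mu) * series (exp_coeff mu) n)%:E)).
  apply: cvg_EFin; first exact: nearW.
  by apply: cvgMr; exact: is_cvg_series_exp_coeff.
apply/funext => n; rewrite sumEFin; congr (_%:E).
rewrite (big_cat_nat (n := j)) ?leq_addl//= [X in X + _]big_nat [X in X + _]big1 ?add0r; last first.
  by move=> i /andP[_ ij]; rewrite ffact_small// mul0r.
rewrite -{1}(add0n j) big_addn addnK /series/= mulr_sumr; apply: eq_bigr => i _.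
rewrite /exp_coeff/= /pois_pmf exprD.
have : ((i + j) ^_ j)%:R * i`!%:R = (i + j)`!%:R :> R.
  by rewrite -natrM -{2}(addnK j i) ffact_fact// leq_addl.
move=> e; rewrite -e => {e}.
have : (((i + j) ^_ j)%:R * i`!%:R : R) != 0.
  by rewrite -natrM pnatr_eq0 muln_eq0 negb_or -!lt0n ffact_gt0 leq_addl fact_gt0.
rewrite mulf_eq0 negb_or => /andP[a0 b0].
by field; rewrite a0 b0.
Qed.

Section moments.
Context {R : realType} {d} {Omega : measurableType d} (P : probability Omega R).

Lemma ge0_integrable (f : Omega -> R) (e : R) :
  measurable_fun setT f -> (forall w, 0 <= f w) -> (\int[P]_w (f w)%:E = e%:E)%E ->
  P.-integrable setT (EFin \o f).
Proof.
move=> mf f0 fe; apply/integrableP; split; first exact/measurable_EFinP.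
rewrite (_ : \int[P]_x _ = e%:E)%E ?ltry// -fe.
by apply: eq_integral => w _ /=; rewrite ger0_norm.
Qed.

(** Extends the product formula from nonnegative functions to integrable ones of arbitrary sign, as
    the centered residuals require. *)
Lemma expectation_prod (I : eqType) (X : I -> Omega -> R) (J : set I) :
  (forall i, measurable_fun setT (X i)) ->
  (forall (s : seq I) (g : I -> R -> R) (e : I -> R), uniq s ->
    (forall i, i \in s -> J i) ->
    (forall i, measurable_fun setT (g i)) -> (forall i u, 0 <= g i u) ->
    (forall i, i \in s -> \int[P]_w (g i (X i w))%:E = (e i)%:E)%E ->
    (\int[P]_w (\prod_(i <- s) g i (X i w))%:E = (\prod_(i <- s) e i)%:E)%E) ->
  forall (s : seq I) (g : I -> R -> R) (e : I -> R), uniq s ->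
    (forall i, i \in s -> J i) ->
    (forall i, measurable_fun setT (g i)) ->
    (forall i, i \in s -> P.-integrable setT (fun w => (g i (X i w))%:E)) ->
    (forall i, i \in s -> \int[P]_w (g i (X i w))%:E = (e i)%:E)%E ->
  P.-integrable setT (fun w => (\prod_(i <- s) g i (X i w))%:E) /\
  (\int[P]_w (\prod_(i <- s) g i (X i w))%:E = (\prod_(i <- s) e i)%:E)%E.
Proof.
move=> mX hprod s g e us sJ mg ig eg.
have mgX (g' : I -> R -> R) : (forall i, measurable_fun setT (g' i)) ->
    forall i, measurable_fun setT (fun w => g' i (X i w)).
  by move=> mg' i; exact: measurableT_comp.
(* [s'] collects indices whose function is already nonnegative. The head of the list is split into
   positive and negative parts; each part moves into [s'], and the two product formulas are
   subtracted. *)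
suff key s' : uniq (s ++ s') -> (forall i, i \in s ++ s' -> J i) ->
    (forall i, i \in s ++ s' -> P.-integrable setT (fun w => (g i (X i w))%:E)) ->
    (forall i, i \in s ++ s' -> \int[P]_w (g i (X i w))%:E = (e i)%:E)%E ->
    (forall i u, i \in s' -> 0 <= g i u) ->
  P.-integrable setT (fun w => (\prod_(i <- s ++ s') g i (X i w))%:E) /\
  (\int[P]_w (\prod_(i <- s ++ s') g i (X i w))%:E = (\prod_(i <- s ++ s') e i)%:E)%E.
  by have := key [::]; rewrite cats0; apply.
elim: s s' g e {us sJ ig eg} mg => [|a s IH] s' g e mg us sJ ig eg g0.
  rewrite cat0s in us sJ ig eg *.
  have E : (\int[P]_w (\prod_(i <- s') g i (X i w))%:E = (\prod_(i <- s') e i)%:E)%E.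
    rewrite -(hprod s' (fun i u => `|g i u|) e)//.
    - apply: eq_integral => w _; congr (_%:E); apply: eq_big_seq => i si.
      by rewrite ger0_norm// g0.
    - by move=> i; exact: measurableT_comp.
    - move=> i si; rewrite -eg//; apply: eq_integral => w _.
      by rewrite ger0_norm// g0.
  split=> //; apply: (ge0_integrable _ _ E).
  - by apply: measurable_prod => i _; exact: mgX.
  - by move=> w; rewrite big_seq prodr_ge0// => i si; exact: g0.
have [aNs us2] : a \notin s ++ s' /\ uniq (s ++ s') by move: us => /= /andP[].
pose gp i u := if i == a then Num.max (g a u) 0 else g i u.
pose gn i u := if i == a then Num.max (- g a u) 0 else g i u.
have aJ : a \in a :: (s ++ s') by rewrite mem_head.
have mX' i : measurable_fun setT (fun w => g i (X i w)) by exact: mgX.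
have ia := ig _ aJ.
have ip : P.-integrable setT (fun w => (Num.max (g a (X a w)) 0)%:E).
  apply: le_integrable ia => //.
    by apply/measurable_EFinP; apply: measurable_maxr.
  by move=> w _ /=; rewrite lee_fin; case: (lerP 0 (g a (X a w))) => // _; rewrite normr0.
have inn : P.-integrable setT (fun w => (Num.max (- g a (X a w)) 0)%:E).
  apply: le_integrable ia => //.
    by apply/measurable_EFinP; apply: measurable_maxr => //; exact: measurable_funN.
  by move=> w _ /=; rewrite lee_fin; case: (lerP 0 (- g a (X a w))) => // _; rewrite ?normr0 ?normrN.
pose ep i := if i == a then fine (\int[P]_w (Num.max (g a (X a w)) 0)%:E)%E else e i.
pose en i := if i == a then fine (\int[P]_w (Num.max (- g a (X a w)) 0)%:E)%E else e i.
have epn : e a = ep a - en a.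
  apply: EFin_inj; rewrite /ep /en eqxx EFinB !fineK ?integrable_fin_num// -eg//.
  rewrite -integralB//; apply: eq_integral => w _ /=; rewrite -EFinB; congr (_%:E).
  by rewrite /Order.max; case: ltP => h1; case: ltP => h2; lra.
have common (h : I -> R -> R) (f : I -> R) :
    (forall i, i != a -> h i = g i) -> (forall i, i != a -> f i = e i) ->
    (forall u, 0 <= h a u) ->
    measurable_fun setT (h a) ->
    P.-integrable setT (fun w => (h a (X a w))%:E) ->
    (\int[P]_w (h a (X a w))%:E = (f a)%:E)%E ->
    P.-integrable setT (fun w => (h a (X a w) * \prod_(i <- s ++ s') g i (X i w))%:E) /\
    (\int[P]_w (h a (X a w) * \prod_(i <- s ++ s') g i (X i w))%:E =
     (f a * \prod_(i <- s ++ s') e i)%:E)%E.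
  move=> hg fe h0 mh ih ef.
  have hs i : i \in s ++ s' -> i != a by apply: contraTneq => ->.
  have pE w : \prod_(i <- s ++ a :: s') h i (X i w) =
      h a (X a w) * \prod_(i <- s ++ s') g i (X i w).
    rewrite big_cat big_cons/= mulrCA -big_cat; congr (_ * _).
    by apply: eq_big_seq => i /hs/hg->.
  have fE : \prod_(i <- s ++ a :: s') f i = f a * \prod_(i <- s ++ s') e i.
    rewrite big_cat big_cons/= mulrCA -big_cat; congr (_ * _).
    by apply: eq_big_seq => i /hs/fe->.
  have mem i : (i \in s ++ a :: s') = (i \in a :: s ++ s').
    by rewrite !(mem_cat, inE) orbCA.
  have -> : (fun w => (h a (X a w) * \prod_(i <- s ++ s') g i (X i w))%:E) =
      (fun w => (\prod_(i <- s ++ a :: s') h i (X i w))%:E).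
    by apply/funext => w; rewrite pE.
  rewrite -fE; apply: IH.
  - by move=> i; have [->//|/hg->] := eqVneq i a.
  - by move: us; rewrite -[a :: s]cat1s -catA uniq_catCA.
  - by move=> i; rewrite mem; exact: sJ.
  - move=> i; rewrite mem; have [->//|ia' si] := eqVneq i a.
    by rewrite hg//; exact: ig.
  - move=> i; rewrite mem; have [->//|ia' si] := eqVneq i a.
    by rewrite hg// fe//; exact: eg.
  - move=> i u; rewrite inE; have [->//|ia' /= si] := eqVneq i a.
    by rewrite hg//; exact: g0.
have [||||||i1 e1] := common gp ep; rewrite ?/gp ?/ep ?eqxx//.
- by move=> i /negbTE->.
- by move=> i /negbTE->.
- by move=> u; rewrite le_max lexx orbT.
- exact: measurable_maxr.
- by rewrite fineK// integrable_fin_num.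
have [||||||i2 e2] := common gn en; rewrite ?/gn ?/en ?eqxx//.
- by move=> i /negbTE->.
- by move=> i /negbTE->.
- by move=> u; rewrite le_max lexx orbT.
- by apply: measurable_maxr => //; exact: measurable_funN.
- by rewrite fineK// integrable_fin_num.
move: i1 e1 i2 e2; set W := fun w => \prod_(i <- s ++ s') g i (X i w) => i1 e1 i2 e2.
have sE : (fun w => (\prod_(i <- (a :: s) ++ s') g i (X i w))%:E) =
    ((fun w => (gp a (X a w) * W w)%:E) \- (fun w => (gn a (X a w) * W w)%:E))%E.
  apply/funext => w; rewrite big_cons -EFinB -mulrBl; congr (_ * _)%:E.
  by rewrite /gp /gn eqxx /Order.max; case: ltP => h1; case: ltP => h2; lra.
rewrite sE; split; first exact: integrableB.
by rewrite integralB// e1 e2 -EFinB big_cons -mulrBl epn.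
Qed.

Lemma integrable_sqr (X : Omega -> R) (v : R) : measurable_fun setT X ->
  (\int[P]_w (X w ^+ 2)%:E <= v%:E)%E -> P.-integrable setT (fun w => (X w ^+ 2)%:E).
Proof.
move=> mX hv; apply/integrableP; split; first by apply/measurable_EFinP; exact: measurable_funX.
apply: le_lt_trans (ltry v); apply: le_trans hv.
apply: ge0_le_integral => //.
- by apply: measurableT_comp => //; apply/measurable_EFinP; exact: measurable_funX.
- by apply/measurable_EFinP; exact: measurable_funX.
- by move=> w _; rewrite /= ger0_norm// sqr_ge0.
Qed.

Lemma integrable_mul (X Y : Omega -> R) (v v' : R) :
  measurable_fun setT X -> measurable_fun setT Y ->
  (\int[P]_w (X w ^+ 2)%:E <= v%:E)%E -> (\int[P]_w (Y w ^+ 2)%:E <= v'%:E)%E ->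
  P.-integrable setT (fun w => (X w * Y w)%:E).
Proof.
move=> mX mY hX hY.
apply: (@le_integrable _ _ _ _ _ _ _ ((fun w => (X w ^+ 2)%:E) \+ (fun w => (Y w ^+ 2)%:E))%E) => //.
- by apply/measurable_EFinP; exact: measurable_funM.
- move=> w _; rewrite /= lee_fin [leRHS]ger0_norm ?addr_ge0 ?sqr_ge0// normrM.
  rewrite -(real_normK (num_real (X w))) -(real_normK (num_real (Y w))).
  move: (normr_ge0 (X w)) (normr_ge0 (Y w)).
  move: (`|X w|) (`|Y w|) => x y x0 y0; nra.
- by apply: integrableD => //; [exact: integrable_sqr hX|exact: integrable_sqr hY].
Qed.

(** Chebyshev's inequality; orthogonality removes the off-diagonal terms from the second moment of
    the sum. *)
Lemma tail_probability_sum_sqr (k : nat) (Y : 'I_k -> Omega -> R) (v : 'I_k -> R) (a : R) :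
  (forall i, measurable_fun setT (Y i)) ->
  (forall i, (\int[P]_w (Y i w ^+ 2)%:E <= (v i)%:E)%E) ->
  (forall i j, i != j -> (\int[P]_w (Y i w * Y j w)%:E = 0)%E) ->
  0 < a ->
  (P [set w | (a <= `|\sum_(i < k) Y i w|)%R] <= ((\sum_(i < k) v i) / a ^+ 2)%:E)%E.
Proof.
move=> mY hv h0 a0.
have iYY i j : P.-integrable setT (fun w => (Y i w * Y j w)%:E).
  by apply: integrable_mul (hv i) (hv j).
have mS : measurable_fun setT (fun w => \sum_(i < k) Y i w) by exact: measurable_sum.
have S2 : (\int[P]_w ((\sum_(i < k) Y i w) ^+ 2)%:E <= (\sum_(i < k) v i)%:E)%E.
  have -> : (\int[P]_w ((\sum_(i < k) Y i w) ^+ 2)%:E =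
      \sum_(i < k) \int[P]_w (Y i w ^+ 2)%:E)%E.
    transitivity (\int[P]_w (\sum_(i < k) \sum_(j < k) (Y i w * Y j w)%:E))%E.
      apply: eq_integral => w _; rewrite expr2 big_distrlr/= -sumEFin.
      by apply: eq_bigr => i _; rewrite sumEFin.
    rewrite integral_sum//; last first.
      by move=> i; apply: integrable_sum => // j _; exact: iYY.
    apply: eq_bigr => i _; rewrite integral_sum//.
    rewrite (bigD1 i)//= big1 ?adde0; last by move=> j ji; rewrite h0// eq_sym.
    by apply: eq_integral.
  by rewrite -sumEFin; apply: lee_sum => i _; exact: hv.
pose A := [set w | (a <= `|\sum_(i < k) Y i w|)%R].
have mA : measurable A.
  rewrite -[A]setTI; apply: (measurable_fun_le (f := cst a)) => //.
  exact: measurableT_comp.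
rewrite -/A -{1}(setIT A) -integral_indic//.
rewrite mulrC EFinM; apply: le_trans; last first.
  by apply: lee_wpmul2l S2; rewrite lee_fin invr_ge0 sqr_ge0.
rewrite -ge0_integralZl_EFin//; last 3 first.
- by move=> w _; rewrite lee_fin sqr_ge0.
- by apply/measurable_EFinP; exact: measurable_funX.
- by rewrite invr_ge0 sqr_ge0.
apply: ge0_le_integral => //.
- by apply/measurable_EFinP; exact: measurable_indic.
- by apply: measurable_funeM; apply/measurable_EFinP; exact: measurable_funX.
move=> w _; rewrite -EFinM lee_fin indicE.
have [|] := boolP (w \in A); rewrite ?inE/= => wA; last by rewrite mulr_ge0 ?invr_ge0 ?sqr_ge0.
rewrite ler_pdivlMl ?exprn_gt0// mulr1 -(real_normK (num_real (\sum_(i < k) Y i w))).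
by rewrite lerXn2r ?nnegrE ?(ltW a0).
Qed.
End moments.

(** * Mixed Poisson counts *)

(** Falling factorial of a ring element, as counts are real-valued here. It may be negative away
    from the naturals, hence the absolute values around it in the integrals below. *)
Definition falling {R : nzRingType} (j : nat) (u : R) : R := \prod_(i < j) (u - i%:R).

Lemma falling_nat {R : nzRingType} (j n : nat) : falling j (n%:R : R) = (n ^_ j)%:R.
Proof.
elim: j => [|j IH]; first by rewrite /falling big_ord0 ffactn0.
rewrite /falling big_ord_recr/= -/(falling j _) IH ffactnSr natrM.
have [jn|nj] := leqP j n; first by rewrite natrB.
by rewrite ffact_small// !mul0r.
Qed.

(** For [n <= 3] the falling factorial vanishes and [81 = 3 ^ 4] suffices; from [4] on the ratio of
    the two powers is largest at [n = 4], where it is [256 / 24 < 11]. *)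
Lemma expn4_le_ffact4 (n : nat) : (n ^ 4 <= 81 + 11 * n ^_ 4)%N.
Proof.
case: n => [|[|[|[|m]]]] //.
rewrite !ffactnS ffactn0 /= muln1 !expnS expn0 muln1; nia.
Qed.

Section real_integrals.
Context {R : realType} {d} {Omega : measurableType d} (P : probability Omega R).

Lemma integral_prob_cst (c : R) : (\int[P]_w c%:E = c%:E)%E.
Proof.
by rewrite integral_cst// -[RHS]mule1; congr (_ * _)%E; exact: probability_setT.
Qed.

Lemma measurable_ltr_nat (f : Omega -> R) (a : R) : measurable_fun setT f ->
  measurable_fun setT (fun w => (a < f w)%R%:R : R).
Proof.
move=> mf.
rewrite (_ : (fun _ => _) = (fun w => \1_(`]a, +oo[%classic : set R) (f w))); last first.
  apply/funext => w; rewrite indicE; congr (_%:R); congr nat_of_bool.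
  by apply/idP/idP; rewrite inE/= in_itv/= andbT.
by apply: (measurableT_comp _ mf); apply: measurable_indic; exact: measurable_itv.
Qed.

Lemma ge0_integral_EFinD (f g : Omega -> R) :
  measurable_fun setT f -> measurable_fun setT g ->
  (forall w, 0 <= f w) -> (forall w, 0 <= g w) ->
  (\int[P]_w (f w + g w)%:E = \int[P]_w (f w)%:E + \int[P]_w (g w)%:E)%E.
Proof.
move=> mf mg f0 g0; under eq_integral do rewrite EFinD.
by rewrite ge0_integralD// => [w _||w _|]; rewrite ?lee_fin//; apply/measurable_EFinP.
Qed.

Lemma ge0_integral_EFinZ (c : R) (f : Omega -> R) :
  0 <= c -> measurable_fun setT f -> (forall w, 0 <= f w) ->
  (\int[P]_w (c * f w)%:E = c%:E * \int[P]_w (f w)%:E)%E.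
Proof.
move=> c0 mf f0; under eq_integral do rewrite EFinM.
by rewrite ge0_integralZl_EFin// => [w _|]; [rewrite lee_fin|exact/measurable_EFinP].
Qed.

Lemma le_integral_EFin (f g : Omega -> R) :
  measurable_fun setT f -> measurable_fun setT g ->
  (forall w, 0 <= f w) -> (forall w, f w <= g w) ->
  (\int[P]_w (f w)%:E <= \int[P]_w (g w)%:E)%E.
Proof.
move=> mf mg f0 fg; apply: ge0_le_integral => //.
- by move=> w _; rewrite lee_fin.
- exact/measurable_EFinP.
- exact/measurable_EFinP.
- by move=> w _; rewrite lee_fin.
Qed.

Lemma integral_same_law (X Y : Omega -> R) (h : R -> R) :
  measurable_fun setT X -> measurable_fun setT Y ->
  (forall B, measurable B -> P (X @^-1` B) = P (Y @^-1` B)) ->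
  measurable_fun setT h -> (forall u, 0 <= h u) ->
  (\int[P]_w (h (X w))%:E = \int[P]_w (h (Y w))%:E)%E.
Proof.
move=> mX mY XY mh h0.
pose X' : {RV P >-> R} := mfun_Sub (mem_set mX).
pose Y' : {RV P >-> R} := mfun_Sub (mem_set mY).
have mEh : measurable_fun setT (EFin \o h) by exact/measurable_EFinP.
transitivity (\int[distribution P X']_u (h u)%:E)%E.
  by rewrite ge0_integral_distribution.
rewrite [RHS](_ : _ = \int[distribution P Y']_u (h u)%:E)%E; last first.
  by rewrite ge0_integral_distribution.
by apply: eq_measure_integral => B mB _; exact: XY.
Qed.

End real_integrals.

Section mixed_poisson.
Context {R : realType} {d} {Omega : measurableType d} (P : probability Omega R).
Context (I : eqType) (theta N : I -> Omega -> R) (lam : I -> R) (J : set I).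
Hypothesis mtheta : forall i, measurable_fun setT (theta i).
Hypothesis mN : forall i, measurable_fun setT (N i).
Hypothesis theta_ge0 : forall i, J i -> P [set w | theta i w < 0] = 0%E.
Hypothesis lam_gt0 : forall i, 0 < lam i.
Hypothesis cpois : cond_poisson P theta N lam J.

(* [theta i] is nonnegative only almost surely, and [pois_pmf] may be negative at
   a negative mean. *)
Let thp i w := Num.max (theta i w) 0.

Lemma measurable_theta_pos i : measurable_fun setT (thp i).
Proof. exact: measurable_maxr. Qed.

Lemma measurable_theta_neg i : measurable [set w | theta i w < 0].
Proof.
rewrite (_ : [set _ | _] = setT `&` theta i @^-1` `]-oo, 0[); first exact: mtheta.
by apply/seteqP; split => w /=; rewrite in_itv/= => -[].
Qed.

Lemma theta_pos_ae i (f : R -> R) : J i -> measurable_fun setT f ->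
  (\int[P]_w (f (theta i w))%:E = \int[P]_w (f (thp i w))%:E)%E.
Proof.
move=> Ji mf; apply: ae_eq_integral => //.
- by apply/measurable_EFinP; exact: measurableT_comp.
- by apply/measurable_EFinP; apply: measurableT_comp => //; exact: measurable_theta_pos.
exists [set w | theta i w < 0]; split.
- exact: measurable_theta_neg.
- exact: theta_ge0.
move=> w /=; apply: contra_notP => /negP; rewrite -leNgt => h _.
by rewrite /thp max_l.
Qed.

Lemma measurable_pois_pmf n : measurable_fun setT (fun mu : R => pois_pmf mu n).
Proof.
rewrite /pois_pmf; apply: measurable_funM.
  by apply: measurable_funM => //; exact: measurable_funX.
by apply: measurableT_comp => //; exact: measurable_funN.
Qed.

Lemma pois_pmf_ge0 (mu : R) n : 0 <= mu -> 0 <= pois_pmf mu n.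
Proof. by move=> mu0; rewrite /pois_pmf !mulr_ge0 ?exprn_ge0 ?expR_ge0. Qed.

Lemma thp_lam_ge0 i w : 0 <= thp i w * lam i.
Proof. by rewrite mulr_ge0 ?(ltW (lam_gt0 i))// le_max lexx orbT. Qed.

Lemma mixed_poisson_joint i (B : set R) n : J i -> measurable B ->
  (P (theta i @^-1` B `&` N i @^-1` [set n%:R]) =
   \int[P]_w (\1_B (theta i w) * pois_pmf (thp i w * lam i) n)%:E)%E.
Proof.
move=> Ji mB; have Js j : j \in [:: i] -> J j by rewrite inE => /eqP->.
have := @cpois [:: i] (fun=> B) (fun=> n) isT Js (fun=> mB).
rewrite (_ : \bigcap_(j in _) _ = theta i @^-1` B `&` N i @^-1` [set n%:R]); last first.
  apply/seteqP; split => w /=; first by move=> /(_ i); rewrite /= mem_head; apply.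
  by move=> h j /=; rewrite inE => /eqP->.
move=> ->.
transitivity (\int[P]_w (\1_B (theta i w) * pois_pmf (theta i w * lam i) n)%:E)%E.
  by apply: eq_integral => w _; rewrite big_seq1.
have mpm : measurable_fun setT (fun u : R => pois_pmf (u * lam i) n).
  by apply: (measurableT_comp (measurable_pois_pmf n)); exact: measurable_funM.
apply: ae_eq_integral => //.
- apply/measurable_EFinP; apply: measurable_funM.
    by apply: (measurableT_comp _ (mtheta i)); exact: (measurable_indic mB).
  exact: (measurableT_comp mpm).
- apply/measurable_EFinP; apply: measurable_funM.
    by apply: (measurableT_comp _ (mtheta i)); exact: (measurable_indic mB).
  by apply: (measurableT_comp mpm); exact: measurable_theta_pos.
exists [set w | theta i w < 0]; split.
- exact: measurable_theta_neg.
- exact: theta_ge0.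
move=> w /=; apply: contra_notP => /negP; rewrite -leNgt => h _.
by rewrite /thp max_l.
Qed.

(** [N i] is a priori only a real random variable; its joint laws put total mass one on the
    naturals, because the Poisson weights sum to one (the factorial moment of order 0). *)
Lemma mixed_poisson_nat i : J i ->
  P (N i @^-1` range (fun n : nat => n%:R : R)) = 1%E.
Proof.
move=> Ji.
have -> : N i @^-1` range (fun n : nat => n%:R : R) =
    \bigcup_n (theta i @^-1` setT `&` N i @^-1` [set n%:R]).
  apply/seteqP; split => [w [n _ e]|w [n _ [_ e]]]; last by exists n.
  by exists n => //; split.
rewrite measure_bigcup//=; last 2 first.
- move=> n _; rewrite setTI -[X in measurable X]setTI; apply: mN => //.
- apply/trivIsetP => n m _ _ nm; apply/seteqP; split => // w [[_ /= ->] [_ /= /eqP]].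
  by rewrite eqr_nat (negbTE nm).
rewrite (_ : 1%E = \int[P]_w (1%:E))%E; last by rewrite integral_cst// mul1e; exact/esym/probability_setT.
rewrite (@eq_eseriesl _ _ xpredT); last by move=> n; rewrite in_setT.
transitivity (\sum_(n <oo) \int[P]_w (pois_pmf (thp i w * lam i) n)%:E)%E.
  apply: eq_eseriesr => n _; rewrite mixed_poisson_joint//.
  by apply: eq_integral => w _; rewrite indicT mul1r.
rewrite -integral_nneseries//.
- apply: eq_integral => w _; rewrite -(expr0 (thp i w * lam i)).
  rewrite -(poisson_factorial_moment 0 (thp_lam_ge0 i w)).
  by apply: eq_eseriesr => n _; rewrite ffactn0 mul1r.
- move=> n; apply/measurable_EFinP; apply: (measurableT_comp (measurable_pois_pmf n)).
  by apply: measurable_funM => //; exact: measurable_theta_pos.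
- by move=> n w _; rewrite lee_fin pois_pmf_ge0// thp_lam_ge0.
Qed.

Lemma measurable_falling j : measurable_fun setT (@falling R j).
Proof.
rewrite /falling; apply: measurable_prod => i _; exact: measurable_funB.
Qed.

(** The event [theta i] in [B] is kept so that large and small random effects can be treated
    separately in the tail estimate. *)
Lemma mixed_poisson_factorial_moment i (B : set R) j : J i -> measurable B ->
  (\int[P]_w (`|falling j (N i w)| * \1_B (theta i w))%:E =
   \int[P]_w ((thp i w * lam i) ^+ j * \1_B (theta i w))%:E)%E.
Proof.
move=> Ji mB.
have mI : measurable_fun setT (fun w => \1_B (theta i w) : R).
  by apply: (measurableT_comp _ (mtheta i)); exact: (measurable_indic mB).
have mpm n : measurable_fun setT (fun w => pois_pmf (thp i w * lam i) n).
  apply: (measurableT_comp (measurable_pois_pmf n)).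
  by apply: measurable_funM => //; exact: measurable_theta_pos.
have I0 w : 0 <= (\1_B (theta i w) : R) by rewrite indicE.
have mf : measurable_fun setT (fun u : R => `|falling j u|).
  by apply: measurableT_comp => //; exact: measurable_falling.
have f0 (u : R) : 0 <= `|falling j u| by [].
rewrite (expectation_nat_valued (mN i) mI I0 (mixed_poisson_nat Ji) mf f0).
transitivity (\sum_(n <oo) \int[P]_w (((n ^_ j)%:R * pois_pmf (thp i w * lam i) n)
     * \1_B (theta i w))%:E)%E.
  apply: eq_eseriesr => n _; rewrite falling_nat ger0_norm//.
  have -> : (\int[P]_w (\1_[set (n%:R : R)] (N i w) * \1_B (theta i w))%:E =
     P (theta i @^-1` B `&` N i @^-1` [set n%:R]))%E.
    rewrite -[X in P X]setIT -integral_indic//; last first.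
      apply: measurableI; rewrite -[X in measurable X]setTI; [exact: mtheta|exact: mN].
    by apply: eq_integral => w _; rewrite indicI/= mulrC.
  rewrite mixed_poisson_joint// -ge0_integralZl_EFin//.
  - by apply: eq_integral => w _; rewrite -EFinM -mulrA (mulrC (\1_B _)).
  - by move=> w _; rewrite lee_fin mulr_ge0// pois_pmf_ge0// thp_lam_ge0.
  - by apply/measurable_EFinP; exact: measurable_funM.
rewrite -integral_nneseries//.
- apply: eq_integral => w _; rewrite EFinM -(poisson_factorial_moment j (thp_lam_ge0 i w)).
  rewrite muleC -nneseriesZl; last first.
    by move=> n _; rewrite lee_fin mulr_ge0// pois_pmf_ge0// thp_lam_ge0.
  by apply: eq_eseriesr => n _; rewrite EFinM muleC.
- move=> n; apply/measurable_EFinP; apply: measurable_funM => //.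
  exact: measurable_funM.
- by move=> n w _; rewrite lee_fin mulr_ge0// mulr_ge0// pois_pmf_ge0// thp_lam_ge0.
Qed.

Lemma mixed_poisson_eq_integral i (f g : Omega -> R) : J i ->
  measurable_fun setT f -> measurable_fun setT g ->
  (forall w n, N i w = n%:R -> f w = g w) ->
  (\int[P]_w (f w)%:E = \int[P]_w (g w)%:E)%E.
Proof.
move=> Ji mf mg fg; apply: ae_eq_integral => //; try exact/measurable_EFinP.
pose D := N i @^-1` range (fun n : nat => n%:R : R).
have mD : measurable D.
  rewrite -[D]setTI; apply: mN => //; apply: countable_measurable.
    by move=> u; exact: measurable_set1.
  exact: sub_countable (card_image_le _ _) (countableP _).
have PD0 : P (~` D) = 0%E by rewrite probability_setC// mixed_poisson_nat// subee.
exists (~` D); split; [exact: measurableC|exact: PD0|].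
by move=> w /=; apply: contra_not => -[n _ nE] _; rewrite (fg w n).
Qed.

Lemma mixed_poisson_le_integral i (f g : Omega -> R) : J i ->
  measurable_fun setT f -> measurable_fun setT g ->
  (forall w, 0 <= f w) -> (forall w, 0 <= g w) ->
  (forall w n, N i w = n%:R -> f w <= g w) ->
  (\int[P]_w (f w)%:E <= \int[P]_w (g w)%:E)%E.
Proof.
move=> Ji mf mg f0 g0 fg.
(* At natural counts [f] agrees with the minimum of [f] and [g], and this minimum is below [g]
   everywhere. *)
rewrite (@mixed_poisson_eq_integral i f (fun w => Num.min (f w) (g w)))//.
- apply: le_integral_EFin => // [|w|w]; first exact: measurable_minr.
    by rewrite le_min f0 g0.
  by rewrite ge_min lexx orbT.
- exact: measurable_minr.
- by move=> w n /fg h; rewrite min_l.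
Qed.

Variable m2 : R.
Hypothesis theta1 : forall i, J i -> (\int[P]_w (theta i w)%:E = 1)%E.
Hypothesis theta2 : forall i, J i -> (\int[P]_w (theta i w ^+ 2)%:E = m2%:E)%E.

Lemma thp_ge0 i w : 0 <= thp i w.
Proof. by rewrite le_max lexx orbT. Qed.

Lemma thp1 i : J i -> (\int[P]_w (thp i w)%:E = 1)%E.
Proof. by move=> Ji; rewrite -(theta_pos_ae (f := id))// theta1. Qed.

Lemma thp2 i : J i -> (\int[P]_w (thp i w ^+ 2)%:E = m2%:E)%E.
Proof.
by move=> Ji; rewrite -(theta_pos_ae (f := fun u => u ^+ 2))// theta2.
Qed.

Lemma measurable_thpX i j : measurable_fun setT (fun w => thp i w ^+ j).
Proof. by apply: measurable_funX; exact: measurable_theta_pos. Qed.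

Lemma mixed_poisson_moment i j : J i ->
  (\int[P]_w (`|falling j (N i w)|)%:E = (lam i ^+ j)%:E * \int[P]_w (thp i w ^+ j)%:E)%E.
Proof.
move=> Ji; have := mixed_poisson_factorial_moment j Ji measurableT.
under eq_integral do rewrite indicT mulr1.
under [X in _ = X]eq_integral do rewrite indicT mulr1 exprMn mulrC.
move=> ->; rewrite ge0_integral_EFinZ//.
- by rewrite exprn_ge0// ltW.
- exact: measurable_thpX.
- by move=> w; rewrite exprn_ge0// thp_ge0.
Qed.

Lemma mixed_poisson_norm_mean i : J i -> (\int[P]_w (`|N i w|)%:E = (lam i)%:E)%E.
Proof.
move=> Ji; have := mixed_poisson_moment 1 Ji.
under eq_integral do rewrite /falling big_ord1 subr0.
by under [X in _ = (_ * X)%E]eq_integral do rewrite expr1; rewrite thp1// mule1 expr1.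
Qed.

Lemma mixed_poisson_integrable i : J i -> P.-integrable setT (fun w => (N i w)%:E).
Proof.
move=> Ji; apply/integrableP; split; first exact/measurable_EFinP.
by rewrite (_ : \int[P]_x _ = (lam i)%:E)%E ?ltry// -mixed_poisson_norm_mean.
Qed.

Lemma mixed_poisson_mean i : J i -> (\int[P]_w (N i w - lam i)%:E = 0)%E.
Proof.
move=> Ji; under eq_integral do rewrite EFinB.
rewrite integralB//=; last 2 first.
- exact: mixed_poisson_integrable.
- exact: finite_measure_integrable_cst.
rewrite integral_prob_cst.
rewrite (@mixed_poisson_eq_integral i (N i) (fun w => `|N i w|))//.
- by rewrite mixed_poisson_norm_mean// subee.
- exact: measurableT_comp.
- by move=> w n ->; rewrite ger0_norm.
Qed.

Lemma mixed_poisson_variance i : J i ->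
  (\int[P]_w ((N i w - lam i) ^+ 2)%:E = (lam i + (m2 - 1) * lam i ^+ 2)%:E)%E.
Proof.
move=> Ji; have l0 := ltW (lam_gt0 i).
have mA : measurable_fun setT (fun w => (N i w - lam i) ^+ 2).
  by apply: measurable_funX; exact: measurable_funB.
have mNn : measurable_fun setT (fun w => `|N i w|) by exact: measurableT_comp.
have mF j : measurable_fun setT (fun w => `|falling j (N i w)|).
  by apply: measurableT_comp => //; apply: measurableT_comp => //; exact: measurable_falling.
(* The term [2 lam N] is moved to the left so that all integrands are nonnegative and additivity
   holds before finiteness of the variance is known. On naturals the identity is
   [(n - l)^2 + 2 l n = n (n - 1) + n + l^2]. *)
have : (\int[P]_w ((N i w - lam i) ^+ 2 + 2 * lam i * `|N i w|)%:E =
  \int[P]_w ((`|falling 2 (N i w)| + `|falling 1 (N i w)|) + lam i ^+ 2)%:E)%E.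
  apply: (mixed_poisson_eq_integral Ji).
  - by apply: measurable_funD => //; exact: measurable_funM.
  - by do 2 apply: measurable_funD => //.
  move=> w n e; rewrite e !falling_nat !ger0_norm// ffactn1 ffactnS ffactn1 natrM.
  case: n e => [|n] _ /=; first by ring.
  by rewrite -(natr1 n); ring.
rewrite ge0_integral_EFinD//; last 3 first.
- exact: measurable_funM.
- by move=> w; rewrite sqr_ge0.
- by move=> w; rewrite !mulr_ge0.
rewrite ge0_integral_EFinD//; last 2 first.
- exact: measurable_funD.
- by move=> w; rewrite sqr_ge0.
rewrite ge0_integral_EFinD// ge0_integral_EFinZ ?mulr_ge0// mixed_poisson_norm_mean//.
rewrite !mixed_poisson_moment// thp2// integral_prob_cst.
rewrite (_ : (\int[P]_w (thp i w ^+ 1)%:E = 1)%E); last exact: thp1.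
rewrite mule1 -!EFinM -!EFinD; case: (integral _ _ _) => [r||]//=.
by rewrite -EFinD => -[h]; congr (_%:E); lra.
Qed.

(* On [theta > K] the conditional second moment of [N] suffices; on [theta <= K]
   the conditional fourth moment of [N] is bounded. *)
Lemma mixed_poisson_tail i (K M : R) : J i -> 0 <= K -> 0 < M ->
  (\int[P]_w ((N i w - lam i) ^+ 2 * (M * (1 + lam i) < `|N i w - lam i|)%R%:R)%:E <=
   ((1 + lam i) ^+ 2)%:E *
   (\int[P]_w ((thp i w ^+ 2 + thp i w + 1) * \1_(`]K, +oo[%classic : set R) (theta i w))%:E +
    ((82 + 11 * K ^+ 4) / M ^+ 2)%:E))%E.
Proof.
move=> Ji K0 M0; have l0 := ltW (lam_gt0 i); set l := lam i.
pose I1 w : R := \1_(`]K, +oo[%classic : set R) (theta i w).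
pose I2 w : R := \1_(`]-oo, K]%classic : set R) (theta i w).
have mI1 : measurable_fun setT I1.
  by apply: (measurableT_comp _ (mtheta i)); apply: measurable_indic; exact: measurable_itv.
have mI2 : measurable_fun setT I2.
  by apply: (measurableT_comp _ (mtheta i)); apply: measurable_indic; exact: measurable_itv.
have I10 w : 0 <= I1 w by rewrite /I1 indicE.
have I20 w : 0 <= I2 w by rewrite /I2 indicE.
have mF j : measurable_fun setT (fun w => `|falling j (N i w)|).
  by apply: measurableT_comp => //; apply: measurableT_comp => //; exact: measurable_falling.
pose c := (M ^+ 2 * (1 + l) ^+ 2)^-1.
have c0 : 0 <= c by rewrite invr_ge0 mulr_ge0 ?sqr_ge0.
have mT1 j : measurable_fun setT (fun w => `|falling j (N i w)| * I1 w) by exact: measurable_funM.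
have mT2 j : measurable_fun setT (fun w => `|falling j (N i w)| * I2 w) by exact: measurable_funM.
have T10 j w : 0 <= `|falling j (N i w)| * I1 w by rewrite mulr_ge0.
have T20 j w : 0 <= `|falling j (N i w)| * I2 w by rewrite mulr_ge0.
(* [f1] majorizes the integrand where [theta > K], by [(N - l)^2 <= N^2 + l^2]. [f2] does so where
   [theta <= K]: beyond the threshold [(N - l)^2] is at most [c (N - l)^4], and the fourth power is
   bounded by [N^4 + l^4]. *)
pose f1 w := `|falling 2 (N i w)| * I1 w + (`|falling 1 (N i w)| * I1 w + l ^+ 2 * I1 w).
pose f2 w := c * (11 * (`|falling 4 (N i w)| * I2 w) + (81 + l ^+ 4) * I2 w).
have mf1 : measurable_fun setT f1.
  by rewrite /f1; apply: measurable_funD => //; apply: measurable_funD => //; exact: measurable_funM.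
have mf2 : measurable_fun setT f2.
  rewrite /f2; apply: measurable_funM => //; apply: measurable_funD; exact: measurable_funM.
have f10 w : 0 <= f1 w by rewrite /f1 !addr_ge0// mulr_ge0// sqr_ge0.
have l40 : 0 <= 81 + l ^+ 4 :> R by rewrite addr_ge0// exprn_ge0.
have f20 w : 0 <= f2 w by rewrite /f2 mulr_ge0// addr_ge0// mulr_ge0.
apply: (@le_trans _ _ (\int[P]_w (f1 w + f2 w)%:E)%E).
  apply: (mixed_poisson_le_integral Ji).
  - apply: measurable_funM.
      by apply: measurable_funX; exact: measurable_funB.
    apply: measurable_ltr_nat; apply: measurableT_comp => //; exact: measurable_funB.
  - exact: measurable_funD.
  - by move=> w; rewrite mulr_ge0 ?sqr_ge0.
  - by move=> w; rewrite addr_ge0.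
  move=> w n e; rewrite /f1 /f2 e !falling_nat !(ger0_norm (ler0n _ _)).
  have [Kw|Kw] := ltP K (theta i w).
    have -> : I1 w = 1 by rewrite /I1 indicE mem_set//= in_itv/= Kw.
    have -> : I2 w = 0 by rewrite /I2 indicE memNset//= in_itv/= leNgt Kw.
    rewrite !mulr1 !mulr0 addr0 mulr0 addr0.
    have nsq : (n ^_ 2)%:R + (n ^_ 1)%:R = n%:R ^+ 2 :> R.
      rewrite ffactn1 ffactnS ffactn1 natrM; case: (n) => [|n'] /=; first by ring.
      by rewrite -(natr1 n'); ring.
    rewrite addrA nsq; apply: (@le_trans _ _ ((n%:R - l) ^+ 2)).
      by rewrite ler_piMr ?sqr_ge0// lern1 leq_b1.
    by rewrite sqrrB lerD2r gerBl mulrn_wge0// mulr_ge0.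
  have -> : I1 w = 0 by rewrite /I1 indicE memNset//= in_itv/= andbT ltNge Kw.
  have -> : I2 w = 1 by rewrite /I2 indicE mem_set//= in_itv/=.
  rewrite !mulr0 !mulr1 !add0r; case: ltP => [b|_]; last first.
    by rewrite mulr0 mulr_ge0// addr_ge0// mulr_ge0.
  rewrite mulr1 /c ler_pdivlMl ?mulr_gt0 ?exprn_gt0// ?ltr_wpDr//.
  have A4 : (n%:R - l) ^+ 4 <= n%:R ^+ 4 + l ^+ 4.
    have sq0 (u v : R) : 0 <= u -> 0 <= v -> (u - v) ^+ 2 <= u ^+ 2 + v ^+ 2.
      by move=> u0 v0; rewrite sqrrB lerD2r gerBl mulrn_wge0// mulr_ge0.
    have p4 (u : R) : u ^+ 4 = u ^+ 2 ^+ 2 by rewrite -exprM.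
    rewrite !p4.
    apply: (@le_trans _ _ ((n%:R ^+ 2 - l ^+ 2) ^+ 2)); last by rewrite sq0 ?sqr_ge0.
    rewrite subr_sqr [in leRHS]exprMn (expr2 ((n%:R - l) ^+ 2)) ler_wpM2l ?sqr_ge0// -subr_ge0.
    rewrite (_ : _ - _ = 4 * (n%:R * l)); last by ring.
    by rewrite !mulr_ge0.
  apply: (@le_trans _ _ ((n%:R - l) ^+ 4)).
    rewrite -exprMn [leRHS](_ : _ = `|n%:R - l| ^+ 2 * (n%:R - l) ^+ 2); last first.
      by rewrite real_normK ?num_real// -exprD.
    rewrite ler_wpM2r ?sqr_ge0// lerXn2r ?nnegrE//; last exact: ltW.
    by rewrite mulr_ge0 ?(ltW M0)// addr_ge0.
  apply: le_trans A4 _; rewrite addrA lerD2r addrC -natrM -natrD -natrX ler_nat.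
  exact: expn4_le_ffact4.
rewrite ge0_integral_EFinD// ge0_muleDr; last 2 first.
- by apply: integral_ge0 => w _; rewrite lee_fin mulr_ge0 ?addr_ge0 ?sqr_ge0 ?thp_ge0.
- by rewrite lee_fin divr_ge0 ?sqr_ge0// addr_ge0// mulr_ge0// exprn_ge0.
have mth j : measurable_fun setT (fun w => thp i w ^+ j) := measurable_thpX i j.
have mth1 : measurable_fun setT (thp i) := measurable_theta_pos i.
have th0 w := thp_ge0 i w.
apply: leeD.
  have mQ j : measurable_fun setT (fun w => (thp i w * l) ^+ j * I1 w).
    by apply: measurable_funM => //; apply: measurable_funX; exact: measurable_funM.
  have Q0 j w : 0 <= (thp i w * l) ^+ j * I1 w.
    by rewrite mulr_ge0// exprn_ge0// mulr_ge0.
  have mlI : measurable_fun setT (fun w => l ^+ 2 * I1 w) by exact: measurable_funM.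
  have lI0 w : 0 <= l ^+ 2 * I1 w by rewrite mulr_ge0// sqr_ge0.
  have -> : (\int[P]_w (f1 w)%:E =
      \int[P]_w ((thp i w * l) ^+ 2 * I1 w + ((thp i w * l) ^+ 1 * I1 w + l ^+ 2 * I1 w))%:E)%E.
    rewrite /f1 !ge0_integral_EFinD//; try exact: measurable_funD; try by move=> w; rewrite addr_ge0.
    by rewrite !(mixed_poisson_factorial_moment _ Ji)//; exact: measurable_itv.
  rewrite -ge0_integral_EFinZ ?sqr_ge0//; last 2 first.
  - apply: measurable_funM => //; apply: measurable_funD => //; exact: measurable_funD.
  - by move=> w; rewrite mulr_ge0 ?addr_ge0 ?sqr_ge0.
  apply: le_integral_EFin.
  - by do 2 apply: measurable_funD => //.
  - apply: measurable_funM => //; apply: measurable_funM => //; apply: measurable_funD => //.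
    exact: measurable_funD.
  - by move=> w; rewrite !addr_ge0.
  - move=> w; rewrite -!mulrDl mulrA ler_wpM2r// ?expr1.
    have := th0 w; move: (thp i w) l0 => t; rewrite -/l => l0 t0.
    have := mulr_ge0 l0 t0; have := mulr_ge0 l0 (mulr_ge0 t0 t0); nra.
have mR j : measurable_fun setT (fun w => (thp i w * l) ^+ j * I2 w).
  by apply: measurable_funM => //; apply: measurable_funX; exact: measurable_funM.
have R0 j w : 0 <= (thp i w * l) ^+ j * I2 w.
  by rewrite mulr_ge0// exprn_ge0// mulr_ge0.
have -> : (\int[P]_w (f2 w)%:E =
    \int[P]_w (c * (11 * ((thp i w * l) ^+ 4 * I2 w) + (81 + l ^+ 4) * I2 w))%:E)%E.
  rewrite /f2 !ge0_integral_EFinZ//; try (apply: measurable_funD; exact: measurable_funM);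
    try by move=> w; rewrite addr_ge0// mulr_ge0.
  rewrite !ge0_integral_EFinD//; try exact: measurable_funM; try by move=> w; rewrite mulr_ge0.
  rewrite !ge0_integral_EFinZ//.
  by rewrite !(mixed_poisson_factorial_moment _ Ji)//; exact: measurable_itv.
rewrite -EFinM -(integral_prob_cst P); apply: le_integral_EFin => //.
- apply: measurable_funM => //; apply: measurable_funD; exact: measurable_funM.
- by move=> w; rewrite mulr_ge0// addr_ge0// mulr_ge0.
move=> w; have [Kw|Kw] := ltP K (theta i w).
  rewrite (_ : I2 w = 0) ?mulr0 ?addr0 ?mulr0; last by rewrite /I2 indicE memNset//= in_itv/= leNgt Kw.
  by rewrite mulr_ge0 ?sqr_ge0// divr_ge0 ?sqr_ge0// addr_ge0// mulr_ge0// exprn_ge0.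
rewrite (_ : I2 w = 1); last by rewrite /I2 indicE mem_set//= in_itv/=.
have tK : thp i w <= K by rewrite ge_max Kw.
rewrite !mulr1 /c mulrC ler_pdivrMr ?mulr_gt0 ?exprn_gt0// ?ltr_wpDr//.
rewrite [leRHS](_ : _ = (82 + 11 * K ^+ 4) * (1 + l) ^+ 4); last by field; rewrite gt_eqF.
(* The constant 82 collects the 81 of [expn4_le_ffact4] and the coefficient 1 of [l ^+ 4]. *)
have l1 : 1 <= (1 + l) ^+ 4 by rewrite exprn_ege1// lerDl.
have l2 : l ^+ 4 <= (1 + l) ^+ 4 by rewrite lerXn2r ?nnegrE ?addr_ge0// lerDr.
have l3 : (thp i w * l) ^+ 4 <= K ^+ 4 * (1 + l) ^+ 4.
  rewrite exprMn ler_pM ?exprn_ge0// ?lerXn2r ?nnegrE//.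
have K4 : 0 <= K ^+ 4 by rewrite exprn_ge0.
by lra.
Qed.
End mixed_poisson.

Section mixed_poisson_family.
Context {R : realType} {d} {Omega : measurableType d} (P : probability Omega R).
Context (I : eqType) (theta N : I -> Omega -> R) (lam : I -> R) (J : set I).
Hypothesis mtheta : forall i, measurable_fun setT (theta i).
Hypothesis mN : forall i, measurable_fun setT (N i).
Hypothesis theta_ge0 : forall i, J i -> P [set w | theta i w < 0] = 0%E.
Hypothesis lam_gt0 : forall i, 0 < lam i.
Hypothesis cpois : cond_poisson P theta N lam J.

(** Independence passes from the random effects to the counts: the joint probability of given counts
    is the mean of a product of functions of the separate [theta i], which factorizes. Singletons
    suffice for the second use of [ge0_expectation_prod], the counts being almost surely natural. *)
Lemma mixed_poisson_prod : mutually_independent P theta J ->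
  forall (s : seq I) (g : I -> R -> R) (e : I -> R), uniq s ->
    (forall i, i \in s -> J i) ->
    (forall i, measurable_fun setT (g i)) -> (forall i u, 0 <= g i u) ->
    (forall i, i \in s -> \int[P]_w (g i (N i w))%:E = (e i)%:E)%E ->
  (\int[P]_w (\prod_(i <- s) g i (N i w))%:E = (\prod_(i <- s) e i)%:E)%E.
Proof.
move=> indep.
have theta_prod := @ge0_expectation_prod _ _ _ P I theta J measurable mtheta (fun _ => id)
  (fun i Z K _ mZ Z0 _ => expectation_mul_indep (mtheta i) mZ Z0).
have {}theta_prod := theta_prod _.
have {}theta_prod : forall (s : seq I) (g : I -> R -> R) (e : I -> R), uniq s ->
    (forall i, i \in s -> J i) ->
    (forall i, measurable_fun setT (g i)) -> (forall i u, 0 <= g i u) ->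
    (forall i, i \in s -> \int[P]_w (g i (theta i w))%:E = (e i)%:E)%E ->
  (\int[P]_w (\prod_(i <- s) g i (theta i w))%:E = (\prod_(i <- s) e i)%:E)%E.
  apply: theta_prod => s B us sJ mB.
  have := indep s (fun i => if i \in s then B i else setT) us sJ.
  rewrite (_ : \bigcap_(i in [set` s]) _ = \bigcap_(i in [set` s]) (theta i @^-1` B i)); last first.
    by apply: eq_bigcapr => i /= ->.
  move=> -> //; last by move=> i; case: ifP => // si; exact: mB.
  by apply: eq_big_seq => i ->.
pose G : set (set R) := [set B | exists n : nat, B = [set n%:R]].
apply: (@ge0_expectation_prod _ _ _ P I N J G) => //.
- by move=> B [n ->]; exact: measurable_set1.
- move=> i Z K Ji mZ Z0 K0 hB g mg g0.
  have N1 : P (N i @^-1` range (fun n : nat => n%:R : R)) = 1%E.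
    exact: (mixed_poisson_nat mtheta mN theta_ge0 lam_gt0 cpois).
  rewrite (expectation_nat_valued (mN i) mZ Z0 N1 mg g0).
  transitivity (\int[P]_w (g (N i w) * K)%:E)%E; last first.
    under eq_integral do rewrite mulrC.
    rewrite ge0_integral_EFinZ// 1?muleC//; exact: measurableT_comp.
  rewrite (expectation_nat_valued (mN i) (measurable_cst K) (fun=> K0) N1 mg g0).
  apply: eq_eseriesr => n _; congr (_ * _)%E; rewrite hB; last by exists n.
  under [RHS]eq_integral do rewrite mulrC.
  have mNn : measurable (N i @^-1` [set (n%:R : R)]).
    by rewrite -[_ @^-1` _]setTI; exact: mN.
  rewrite ge0_integral_EFinZ//.
    by rewrite muleC -{1}[N i @^-1` _]setIT -integral_indic.
  exact: (measurable_indic mNn).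
move=> s B us sJ GB.
have [n nB] : exists n : I -> nat, forall i, i \in s -> B i = [set (n i)%:R].
  have h i : exists n : nat, i \in s -> B i = [set n%:R].
    by have [/GB[n ->]|_] := boolP (i \in s); [exists n|exists 0%N].
  by have [n hn] := choice h; exists n.
pose q i (u : R) := pois_pmf (Num.max u 0 * lam i) (n i).
have mq i : measurable_fun setT (q i).
  apply: (measurableT_comp (measurable_pois_pmf (n i))); apply: measurable_funM => //.
  exact: measurable_maxr.
have q0 i u : 0 <= q i u.
  by apply: pois_pmf_ge0; rewrite mulr_ge0 ?(ltW (lam_gt0 i))// le_max lexx orbT.
have single i : i \in s -> P (N i @^-1` B i) = (\int[P]_w (q i (theta i w))%:E)%E.
  move=> si; have := mixed_poisson_joint mtheta theta_ge0 cpois (n i) (sJ _ si) measurableT.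
  rewrite preimage_setT setTI nB// => ->.
  by apply: eq_integral => w _; rewrite indicT mul1r.
have mNB i : i \in s -> measurable (N i @^-1` B i).
  by move=> si; rewrite -[_ @^-1` _]setTI nB//; exact: mN.
pose e i := fine (P (N i @^-1` B i)).
have := cpois n us sJ (fun=> measurableT).
rewrite (_ : \bigcap_(i in _) _ = \bigcap_(i in [set` s]) (N i @^-1` B i)); last first.
  by apply: eq_bigcapr => i /= si; rewrite preimage_setT setTI nB.
move=> ->; transitivity (\int[P]_w (\prod_(i <- s) q i (theta i w))%:E)%E; last first.
  rewrite (theta_prod s q e)//.
    by rewrite -prodEFin; apply: eq_big_seq => i si; rewrite /e fineK// fin_num_measure//; exact: mNB.
  by move=> i si; rewrite -single// /e fineK// fin_num_measure//; exact: mNB.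
have pos : {ae P, forall w, all (fun i => 0 <= theta i w) s}.
  elim: s {us GB nB single mNB} sJ => [_|i s IH sJ]; first exact: aeW.
  have h : {ae P, forall w, 0 <= theta i w}.
    exists [set w | theta i w < 0]; split.
    - exact: measurable_theta_neg.
    - by apply: theta_ge0; apply: sJ; rewrite mem_head.
    - by move=> w /= /negP; rewrite -ltNge.
  have {}IH : {ae P, forall w, all (fun i => 0 <= theta i w) s}.
    by apply: IH => j js; apply: sJ; rewrite inE js orbT.
  by apply: filterS2 h IH => w /= -> ->.
apply: ae_eq_integral => //.
- apply/measurable_EFinP; apply: measurable_prod => i _; apply: measurable_funM.
    by rewrite indicT; exact: measurable_cst.
  by apply: (measurableT_comp (measurable_pois_pmf (n i))); exact: measurable_funM.
- by apply/measurable_EFinP; apply: measurable_prod => i _; exact: measurableT_comp.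
apply: filterS pos => w /allP pos _; congr (_%:E); apply: eq_big_seq => i si.
by rewrite /q indicT mul1r max_l// pos.
Qed.

(** The level [K] is chosen for one index by dominated convergence and serves all indices because
    the random effects have the same law; only then is [M] chosen, against the fourth-moment
    term. *)
Lemma mixed_poisson_uniform_integrability (m2 delta : R) :
  identically_distributed P theta J ->
  (forall i, J i -> (\int[P]_w (theta i w)%:E = 1)%E) ->
  (forall i, J i -> (\int[P]_w (theta i w ^+ 2)%:E = m2%:E)%E) -> 0 < delta ->
  exists2 M, 0 < M & forall i, J i ->
  (\int[P]_w ((N i w - lam i) ^+ 2 * (M * (1 + lam i) < `|N i w - lam i|)%R%:R)%:E <=
   (delta * (1 + lam i) ^+ 2)%:E)%E.
Proof.
move=> idd th1 th2 delta0.
have [[i0 Ji0]|nJ] := pselect (exists i, J i); last first.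
  by exists 1 => // i Ji; exfalso; apply: nJ; exists i.
pose f i w : R := Num.max (theta i w) 0 ^+ 2 + Num.max (theta i w) 0 + 1.
pose h K (u : R) : R := (Num.max u 0 ^+ 2 + Num.max u 0 + 1) * \1_(`]K, +oo[%classic : set R) u.
have mmax : measurable_fun setT (fun u : R => Num.max u 0) by exact: measurable_maxr.
have mh K : measurable_fun setT (h K).
  apply: measurable_funM; last by apply: measurable_indic; exact: measurable_itv.
  apply: measurable_funD => //; apply: measurable_funD => //; exact: measurable_funX.
have max0 (u : R) : 0 <= Num.max u 0 by rewrite le_max lexx orbT.
have h0 K u : 0 <= h K u by rewrite mulr_ge0 ?addr_ge0 ?sqr_ge0.
have mf : measurable_fun setT (f i0).
  apply: measurable_funD => //; apply: measurable_funD => //; last exact: measurable_maxr.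
  by apply: measurable_funX; exact: measurable_maxr.
have f0 w : 0 <= f i0 w by rewrite !addr_ge0 ?sqr_ge0.
have intf : P.-integrable setT (EFin \o f i0).
  apply: (ge0_integrable (e := m2 + 1 + 1)) => //.
  have mt : measurable_fun setT (fun w => Num.max (theta i0 w) 0) by exact: measurable_maxr.
  rewrite ge0_integral_EFinD//; last 2 first.
  - by apply: measurable_funD => //; exact: measurable_funX.
  - by move=> w; rewrite addr_ge0 ?sqr_ge0.
  rewrite ge0_integral_EFinD//; last 2 first.
  - exact: measurable_funX.
  - by move=> w; rewrite sqr_ge0.
  by rewrite (thp2 mtheta theta_ge0 th2)// (thp1 mtheta theta_ge0 th1)// integral_prob_cst.
have tail : (\int[P]_w (h n%:R (theta i0 w))%:E @[n --> \oo] --> 0)%E.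
  have [] := @dominated_convergence _ _ _ P setT measurableT
     (fun n w => (h n%:R (theta i0 w))%:E) (cst 0%E) (EFin \o f i0).
  - by move=> n; apply/measurable_EFinP; exact: measurableT_comp.
  - exact: measurable_cst.
  - apply: aeW => w _; apply: cvg_near_cst.
    exists (Num.truncn `|theta i0 w|).+1 => // n /= wn.
    rewrite /h indicE memNset ?mulr0//= in_itv/= andbT; apply/negP; rewrite -leNgt.
    rewrite (le_trans (ler_norm _))// (le_trans (ltW (truncnS_gt _)))// ler_nat; exact: wn.
  - exact: intf.
  - apply: aeW => w n _; rewrite /= lee_fin ger0_norm// /h /f indicE.
    by case: (_ \in _); rewrite ?mulr1// mulr0; exact: f0.
  by move=> _ _; rewrite integral0.
have [n hn] : exists n : nat, (\int[P]_w (h n%:R (theta i0 w))%:E <= (delta / 2)%:E)%E.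
  have d2 : (0 < (delta / 2)%:E)%E by rewrite lte_fin divr_gt0.
  have /fine_cvgP[fin /cvgr_le/(_ (delta / 2))] := tail.
  rewrite divr_gt0// => /(_ isT) near_le.
  have [n _ nP] : \forall n \near \oo, (\int[P]_w (h n%:R (theta i0 w))%:E <= (delta / 2)%:E)%E.
    by apply: filterS2 fin near_le => n nf /=; rewrite -lee_fin fineK.
  by exists n; apply: nP => /=.
pose c : R := 82 + 11 * n%:R ^+ 4.
have c0 : 0 < c by rewrite /c ltr_pwDl// mulr_ge0// exprn_ge0.
(* This makes [c / M ^+ 2] equal to [delta / 2]; the tail of [theta] takes the other half. *)
exists (Num.sqrt (2 * c / delta)); first by rewrite sqrtr_gt0 divr_gt0// mulr_gt0.
move=> i Ji; have M0 : 0 < Num.sqrt (2 * c / delta) by rewrite sqrtr_gt0 divr_gt0// mulr_gt0.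
apply: le_trans (mixed_poisson_tail mtheta mN theta_ge0 lam_gt0 cpois Ji (ler0n R n) M0) _.
rewrite (mulrC delta) [in leRHS]EFinM; apply: lee_wpmul2l; first by rewrite lee_fin sqr_ge0.
rewrite [leRHS](_ : _ = (delta / 2)%:E + (delta / 2)%:E)%E; last first.
  by rewrite -EFinD; congr (_%:E); lra.
apply: leeD.
  apply: le_trans hn; rewrite le_eqVlt; apply/orP; left; apply/eqP.
  by apply: (@integral_same_law _ _ _ P (theta i) (theta i0) (h n%:R)) => // B mB; exact: idd.
rewrite lee_fin sqr_sqrtr; last by rewrite divr_ge0 ?mulr_ge0 ?(ltW c0) ?(ltW delta0).
rewrite -/c le_eqVlt; apply/orP; left; apply/eqP.
by field; rewrite !gt_eqF.
Qed.
End mixed_poisson_family.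

(** * Events of high probability *)

Section high_probability.
Context {R : realType} {d} {Omega : measurableType d} (P : probability Omega R).

(** [E k] may quantify over all parameters [b], an uncountable family, and so need not be
    measurable; hence the measurable exceptional set. *)
Definition off_small_set (e : R) (E : nat -> Omega -> Prop) :=
  \forall k \near \oo, exists2 B, measurable B /\ (P B <= e%:E)%E &
    forall w, ~ B w -> E k w.

Definition with_high_probability (E : nat -> Omega -> Prop) :=
  forall e, 0 < e -> off_small_set e E.

Lemma off_small_setS (e : R) (E F : nat -> Omega -> Prop) :
  (\forall k \near \oo, forall w, E k w -> F k w) -> off_small_set e E -> off_small_set e F.
Proof.
by move=> EF; apply: filterS2 EF => k EF [B mB hB]; exists B => // w /hB/EF.
Qed.

Lemma off_small_setI (e f : R) (E F : nat -> Omega -> Prop) :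
  off_small_set e E -> off_small_set f F ->
  off_small_set (e + f) (fun k w => E k w /\ F k w).
Proof.
apply: filterS2 => k [B [mB PB] hB] [C [mC PC] hC]; exists (B `|` C); last first.
  by move=> w nBC; split; [apply: hB|apply: hC]; apply: contra_not nBC; [left|right].
split; first exact: measurableU.
rewrite EFinD; apply: le_trans (leeD PB PC); exact: measureU2.
Qed.

Lemma with_high_probabilityS (E F : nat -> Omega -> Prop) :
  (\forall k \near \oo, forall w, E k w -> F k w) ->
  with_high_probability E -> with_high_probability F.
Proof. by move=> EF hE e e0; apply: off_small_setS EF _; exact: hE. Qed.

Lemma with_high_probabilityI (E F : nat -> Omega -> Prop) :
  with_high_probability E -> with_high_probability F ->
  with_high_probability (fun k w => E k w /\ F k w).
Proof.
move=> hE hF e e0; rewrite (splitr e).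
by apply: off_small_setI; [apply: hE|apply: hF]; rewrite divr_gt0.
Qed.

Lemma with_high_probability_forall (n : nat) (E : nat -> nat -> Omega -> Prop) :
  (forall t, (t < n)%N -> with_high_probability (E t)) ->
  with_high_probability (fun k w => forall t, (t < n)%N -> E t k w).
Proof.
elim: n => [_|n IH hE].
  move=> e e0; apply: nearW => k; exists set0 => //.
  by split=> //; rewrite measure0 lee_fin ltW.
have h1 := with_high_probabilityI (IH (fun t tn => hE t (leqW tn))) (hE n (leqnn _)).
apply: with_high_probabilityS h1; apply: nearW => k w [h2 h3] t.
by rewrite ltnS leq_eqVlt => /orP[/eqP->|/h2].
Qed.

Lemma cvg_probability_with_high_probability (E : nat -> set Omega) :
  (forall k, measurable (E k)) -> with_high_probability (fun k w => E k w) ->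
  (P (E k) @[k --> \oo] --> 1)%E.
Proof.
move=> mE hE; apply/fine_cvgP; split.
  by apply: nearW => k; rewrite fin_num_measure.
apply/cvgrPdist_le => e e0; have := hE e e0; apply: filterS => k [B [mB PB] hB].
have PE1 : (P (E k) <= 1)%E by exact: probability_le1.
have PEf : P (E k) \is a fin_num by rewrite fin_num_measure.
rewrite /= ger0_norm ?subr_ge0; last by rewrite -lee_fin fineK.
rewrite lerBlDr -lee_fin EFinD fineK//.
rewrite -(probability_setT P) (_ : setT = B `|` E k); last first.
  by apply/seteqP; split => // w _; have [|/hB] := pselect (B w); [left|right].
apply: le_trans (leeD PB (lexx _)); exact: measureU2.
Qed.

Lemma off_small_set_markov (f : nat -> Omega -> R) (b e a : R) :
  (forall k, measurable_fun setT (f k)) -> (forall k w, 0 <= f k w) ->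
  (\forall k \near \oo, (\int[P]_w (f k w)%:E <= (b * k%:R)%:E)%E) ->
  0 < a -> b / a <= e ->
  off_small_set e (fun k w => f k w <= a * k%:R).
Proof.
move=> mf f0 hf a0 ba.
have k0 : \forall k \near \oo, (0 < k)%N by exists 1%N.
apply: filterS2 hf k0 => k hk k0; exists [set w | a * k%:R <= f k w]; last first.
  by move=> w /negP; rewrite -ltNge => /ltW.
have mA : measurable [set w | a * k%:R <= f k w].
  rewrite -[X in measurable X]setTI; exact: (measurable_fun_le (f := cst (a * k%:R))).
split=> //; rewrite -[X in P X]setIT -integral_indic//.
have ak0 : 0 < a * k%:R by rewrite mulr_gt0// ltr0n.
apply: (@le_trans _ _ ((a * k%:R)^-1%:E * \int[P]_w (f k w)%:E)%E).
  rewrite -ge0_integral_EFinZ ?invr_ge0 ?(ltW ak0)//; apply: le_integral_EFin => //.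
  - exact: measurable_funM.
  - move=> w; rewrite indicE; have [|] := boolP (w \in _); rewrite ?inE/= => h.
      by rewrite ler_pdivlMl// mulr1.
    by rewrite mulr_ge0 ?invr_ge0 ?(ltW ak0).
apply: (@le_trans _ _ ((a * k%:R)^-1%:E * (b * k%:R)%:E)%E).
  by apply: lee_wpmul2l => //; rewrite lee_fin invr_ge0 ltW.
rewrite -EFinM lee_fin; apply: le_trans ba; rewrite le_eqVlt; apply/orP; left; apply/eqP.
by field; rewrite pnatr_eq0 -lt0n k0 gt_eqF.
Qed.

(** The threshold for [k] does not depend on the coefficients [b], because they will be indicators
    of cover sets, which change with [k]. *)
Lemma weak_law (Y : nat -> Omega -> R) (v : nat -> R) :
  (forall i, measurable_fun setT (Y i)) ->
  (forall i, (\int[P]_w (Y i w ^+ 2)%:E <= (v i)%:E)%E) ->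
  (forall i j, i != j -> (\int[P]_w (Y i w * Y j w)%:E = 0)%E) ->
  (forall e, 0 < e -> \forall k \near \oo, \sum_(i < k) v i <= e * k%:R ^+ 2) ->
  forall (a e : R), 0 < a -> 0 < e ->
  \forall k \near \oo, forall b : 'I_k -> R, (forall i, `|b i| <= 1) ->
    (P [set w | (a * k%:R <= `|\sum_(i < k) b i * Y i w|)%R] <= e%:E)%E.
Proof.
move=> mY vY Y0 hv a e a0 e0.
have h1 := hv (e * a ^+ 2) (mulr_gt0 e0 (exprn_gt0 2 a0)).
have k0 : \forall k \near \oo, (0 < k)%N by exists 1%N.
apply: filterS2 h1 k0 => k h1 k0 b b1.
have ak0 : 0 < a * k%:R by rewrite mulr_gt0// ltr0n.
apply: le_trans (tail_probability_sum_sqr (v := fun i : 'I_k => v i) _ _ _ ak0) _.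
- by move=> i; exact: measurable_funM.
- move=> i; apply: le_trans (vY i); apply: le_integral_EFin.
  + by apply: measurable_funX; exact: measurable_funM.
  + exact: measurable_funX.
  + by move=> w; rewrite sqr_ge0.
  + move=> w; rewrite exprMn ler_piMl ?sqr_ge0// -real_normK ?num_real//.
    by rewrite exprn_ile1.
- move=> i j ij; under eq_integral do rewrite mulrACA EFinM.
  by rewrite integralZl ?(integrable_mul _ _ (vY i) (vY j))// Y0 ?mule0.
rewrite lee_fin ler_pdivrMr ?exprn_gt0//; apply: le_trans h1 _.
by rewrite -mulrA -exprMn.
Qed.

End high_probability.

(** * A uniform law of large numbers *)

Section uniform_law.
Context {R : realType} {d} {Omega : measurableType d} (P : probability Omega R).

Lemma union_bound (T : eqType) (s : seq T) (B : T -> set Omega) (e : R) :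
  (forall x, measurable (B x)) -> (forall x, (P (B x) <= e%:E)%E) ->
  exists2 B', measurable B' /\ (P B' <= ((size s)%:R * e)%:E)%E &
    forall w, ~ B' w -> forall x, x \in s -> ~ B x w.
Proof.
move=> mB PB; elim: s => [|x s [B' [mB' PB'] hB']].
  by exists set0 => //; split=> //; rewrite measure0 mul0r.
exists (B x `|` B').
  split; first exact: measurableU.
  rewrite /= -natr1 mulrDl mul1r addrC EFinD; apply: le_trans (leeD (PB x) PB').
  exact: measureU2.
move=> w nB y; rewrite inE => /orP[/eqP->|ys].
  by apply: contra_not nB; left.
by apply: hB' ys; apply: contra_not nB; right.
Qed.

(** The deterministic bound is applied with weights [m i ^+ 2 / k], normalized residuals [A i / m i]
    and functions [expR (dotp (x i) b) / m i]. The weights have total mass at most [C], as the cover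
    needs. The mask [msk] discards policyholders for whom the period is absent. *)
Lemma uniform_cross_sum (p : nat) (x : nat -> 'rV[R]_p) (msk : nat -> bool)
    (m : nat -> R) (A : nat -> Omega -> R) (V C : R) :
  (forall i, 0 < m i) -> (forall i, measurable_fun setT (A i)) ->
  (forall i, (\int[P]_w (A i w ^+ 2)%:E <= (V * m i ^+ 2)%:E)%E) ->
  (forall i j, i != j -> (\int[P]_w (A i w * A j w)%:E = 0)%E) ->
  (forall delta, 0 < delta -> exists2 M, 0 < M & forall i,
    (\int[P]_w (A i w ^+ 2 * (M * m i < `|A i w|)%R%:R)%:E <= (delta * m i ^+ 2)%:E)%E) ->
  0 < C -> (forall k, \sum_(i < k) m i ^+ 2 <= C * k%:R) ->
  (forall e, 0 < e -> \forall k \near \oo, \sum_(i < k) m i ^+ 4 <= e * k%:R ^+ 2) ->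
  forall rho, 0 < rho ->
  with_high_probability P (fun k w => forall b : 'rV[R]_p,
    `|\sum_(i < k) (msk i)%:R * A i w * expR (dotp (x i) b)| <=
    rho * (k%:R + \sum_(i < k) (msk i)%:R * expR (dotp (x i) b) ^+ 2)).
Proof.
move=> m0 mA A2 A0 UI C0 hm2 hm4 rho rho0 e e0.
(* With the values below, [M / U] and [kappa] are each [rho / 2], while the constant terms are
   [rho / 4], [rho / 4], [rho / 8] and [rho / 16], in total [11 / 16] of [rho]. *)
pose kappa := rho / 2; pose delta := rho ^+ 2 / 32.
have kappa0 : 0 < kappa by rewrite divr_gt0.
have delta0 : 0 < delta by rewrite divr_gt0// exprn_gt0.
(* Markov's inequality at level [delta] then leaves probability [delta1 * C / delta = e / 2]. *)
pose delta1 := e / 2 * delta / C.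
have delta10 : 0 < delta1 by rewrite !divr_gt0// mulr_gt0// divr_gt0.
have [M M0 hM] := UI _ delta10.
pose U := 2 * M / rho; have U0 : 0 < U by rewrite divr_gt0// mulr_gt0.
pose eta := rho ^+ 2 / (8 * M); pose rho' := rho ^+ 2 / (8 * M ^+ 2).
have eta0 : 0 < eta by rewrite divr_gt0 ?exprn_gt0// mulr_gt0.
have rho'0 : 0 < rho' by rewrite divr_gt0 ?exprn_gt0// mulr_gt0 ?exprn_gt0.
have [N0 hN0] := @halfspace_cover R (p + 2) C rho' C0 rho'0.
pose f k w := \sum_(i < k) A i w ^+ 2 * (M * m i < `|A i w|)%R%:R.
have mA2 i : measurable_fun setT (fun w => A i w ^+ 2 * (M * m i < `|A i w|)%R%:R : R).
  apply: measurable_funM; first exact: measurable_funX.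
  by apply: measurable_ltr_nat; exact: measurableT_comp.
have E1 : off_small_set P (e / 2) (fun k w => f k w <= delta * k%:R).
  apply: (off_small_set_markov (b := delta1 * C)) => //.
  - by move=> k; apply: measurable_sum => i; exact: mA2.
  - by move=> k w; apply: sumr_ge0 => i _; rewrite mulr_ge0 ?sqr_ge0.
  - apply: nearW => k; rewrite /f; under eq_integral do rewrite -sumEFin.
    rewrite ge0_integral_sum//; last 2 first.
    + by move=> i; apply/measurable_EFinP; exact: mA2.
    + by move=> i w _; rewrite lee_fin mulr_ge0 ?sqr_ge0.
    apply: (@le_trans _ _ (\sum_(i < k) (delta1 * m i ^+ 2)%:E)%E).
      by apply: lee_sum => i _; exact: hM.
    rewrite sumEFin lee_fin -mulr_sumr -[leRHS]mulrA; apply: ler_wpM2l; first exact: ltW.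
    exact: hm2.
  - by rewrite /delta1 divfK ?gt_eqF// mulfK ?gt_eqF.
pose e' := e / 2 / N0.+1%:R.
have e'0 : 0 < e' by rewrite divr_gt0// divr_gt0.
have E2 : off_small_set P (e / 2) (fun k w => exists F : {set {set 'I_k}},
    (forall v, exists2 S, S \in F &
       \sum_(i in symdiff (halfspace (log_linear_features (fun i : 'I_k => x i) (fun i : 'I_k => m i)) v) S)
          ((msk i)%:R * m i ^+ 2 / k%:R) < rho') /\
    (forall S, S \in F -> `|\sum_(i in S) ((msk i)%:R * m i ^+ 2 / k%:R) * (A i w / m i)| <= eta)).
  (* Weight times normalized residual is [m i * A i / k], whose numerator has second moment at most
     [V * m i ^+ 4]; this is where the fourth powers enter. *)
  have wl := @weak_law _ _ _ P (fun i w => m i * A i w) (fun i => V * m i ^+ 4) _ _ _ _ _ _ eta0 e'0.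
  have k0 : \forall k \near \oo, (0 < k)%N by exists 1%N.
  apply: filterS2 k0 (wl _ _ _ _) => [k k0 wlk|i|i|i j ij|a a0].
  - have kR0 : 0 < k%:R :> R by rewrite ltr0n.
    pose wt (i : 'I_k) : R := (msk i)%:R * m i ^+ 2 / k%:R.
    have wt0 i : 0 <= wt i by rewrite divr_ge0 ?ler0n// mulr_ge0 ?sqr_ge0.
    have wtC : \sum_i wt i <= C.
      rewrite -mulr_suml ler_pdivrMr//; apply: le_trans (hm2 k); apply: ler_sum => i _.
      by rewrite ler_piMl ?sqr_ge0// lern1 leq_b1.
    have [F [cF hF]] := hN0 k wt (log_linear_features (fun i : 'I_k => x i) (fun i : 'I_k => m i)) wt0 wtC.
    pose bS (S : {set 'I_k}) (i : 'I_k) : R := (msk i && (i \in S))%:R.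
    have bS1 S i : `|bS S i| <= 1 by rewrite ger0_norm// lern1 leq_b1.
    pose BS S := [set w | (eta * k%:R <= `|\sum_(i < k) bS S i * (m i * A i w)|)%R].
    have mBS S : measurable (BS S).
      rewrite -[X in measurable X]setTI; apply: (measurable_fun_le (f := cst _)) => //.
      apply: measurableT_comp => //; apply: measurable_sum => i.
      by apply: measurable_funM => //; exact: measurable_funM.
    have [B' [mB' PB'] hB'] := union_bound (enum F) mBS (fun S => wlk (bS S) (bS1 S)).
    exists B'.
      split=> //; apply: le_trans PB' _; rewrite lee_fin -cardE /e' mulrA ler_pdivrMr ?ltr0n//.
      by rewrite mulrC ler_wpM2l ?ler_nat ?(leq_trans cF)// divr_ge0// ltW.
    move=> w nB'; exists F; split=> // S SF.
    have := hB' _ nB' S; rewrite mem_enum => /(_ SF) /negP; rewrite -ltNge => /ltW hS.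
    rewrite (_ : \sum_(i in S) _ = (\sum_(i < k) bS S i * (m i * A i w)) / k%:R); last first.
      rewrite mulr_suml [LHS]big_mkcond/=; apply: eq_bigr => i _; rewrite /bS.
      case: (i \in S); rewrite ?andbT ?andbF ?mul0r//.
      by field; rewrite !gt_eqF.
    by rewrite normrM normfV (ger0_norm (ler0n _ _)) ler_pdivrMr.
  - exact: measurable_funM.
  - rewrite (_ : \int[P]_w _ = (m i ^+ 2)%:E * \int[P]_w (A i w ^+ 2)%:E)%E; last first.
      rewrite -ge0_integral_EFinZ ?sqr_ge0//; first by apply: eq_integral => w _; rewrite exprMn.
      - exact: measurable_funX.
      - by move=> w; rewrite sqr_ge0.
    rewrite (_ : (V * m i ^+ 4)%:E = (m i ^+ 2)%:E * (V * m i ^+ 2)%:E)%E; last first.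
      by rewrite -EFinM; congr (_%:E); ring.
    by apply: lee_wpmul2l => //; rewrite lee_fin sqr_ge0.
  - under eq_integral do rewrite mulrACA EFinM.
    by rewrite integralZl ?(integrable_mul _ _ (A2 i) (A2 j))// A0 ?mule0.
  - have V1 : 0 < `|V| + 1 by rewrite ltr_wpDl.
    have := hm4 (a / (`|V| + 1)) (divr_gt0 a0 V1).
    apply: filterS => k hk; rewrite -mulr_sumr.
    have s0 : 0 <= \sum_(i < k) m i ^+ 4 by apply: sumr_ge0 => i _; rewrite exprn_ge0// ltW.
    apply: (@le_trans _ _ ((`|V| + 1) * \sum_(i < k) m i ^+ 4)).
      by rewrite ler_wpM2r// (le_trans (ler_norm _))// lerDl.
    by rewrite -ler_pdivlMl// mulrA (mulrC _^-1).
rewrite (splitr e); apply: off_small_setS (off_small_setI E1 E2).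
have k0 : \forall k \near \oo, (0 < k)%N by exists 1%N.
apply: filterS k0 => k k0 w [h1 [F [hF hS]]] b.
have kR0 : 0 < k%:R :> R by rewrite ltr0n.
have wt0 (i : 'I_k) : 0 <= (msk i)%:R * m i ^+ 2 / k%:R.
  by rewrite divr_ge0 ?ler0n// mulr_ge0 ?sqr_ge0.
have hd : \sum_(i < k | M < `|A i w / m i|) (msk i)%:R * m i ^+ 2 / k%:R * (A i w / m i) ^+ 2 <= delta.
  apply: (@le_trans _ _ (f k w / k%:R)); last by rewrite ler_pdivrMr.
  rewrite /f mulr_suml big_mkcond/=; apply: ler_sum => i _.
  have -> : (M < `|A i w / m i|) = (M * m i < `|A i w|).
    by rewrite normrM normfV (gtr0_norm (m0 i)) ltr_pdivlMr.
  case: ifP => _; last by rewrite mulr0 mul0r.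
  rewrite mulr1 [leLHS](_ : _ = (msk i)%:R * (A i w ^+ 2 / k%:R)); last first.
    by field; rewrite !gt_eqF.
  by rewrite ler_piMl ?divr_ge0 ?sqr_ge0// lern1 leq_b1.
have := log_linear_sum_bound b (fun i : 'I_k => m0 i) wt0 M0 U0 kappa0 hF hd hS.
rewrite (_ : \sum_(i < k) (msk i)%:R * m i ^+ 2 / k%:R * (A i w / m i) * (expR (dotp (x i) b) / m i)
  = (\sum_(i < k) (msk i)%:R * A i w * expR (dotp (x i) b)) / k%:R); last first.
  by rewrite mulr_suml; apply: eq_bigr => i _; field; rewrite !gt_eqF.
rewrite (_ : \sum_(i < k) (msk i)%:R * m i ^+ 2 / k%:R * (expR (dotp (x i) b) / m i) ^+ 2
  = (\sum_(i < k) (msk i)%:R * expR (dotp (x i) b) ^+ 2) / k%:R); last first.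
  by rewrite mulr_suml; apply: eq_bigr => i _; field; rewrite !gt_eqF.
set q := \sum_(i < k) _; rewrite normrM normfV (ger0_norm (ler0n _ _)) ler_pdivrMr// => h.
apply: le_trans h _; rewrite [leRHS]mulrDr mulrDl; apply: lerD.
  rewrite ler_wpM2r// [leLHS](_ : _ = rho * (11 / 16)); last first.
    by rewrite /eta /rho' /U /delta /kappa; field; rewrite !gt_eqF.
  by rewrite ger_pMr// ler_pdivrMr// mul1r ler_nat.
rewrite -mulrA divfK ?gt_eqF// (_ : M / U + kappa = rho)//.
by rewrite /U /kappa; field; rewrite !gt_eqF.
Qed.
End uniform_law.

(** * Deterministic estimates: growth of the weights and the final comparison *)

(** Convergence of the means, and not just their boundedness, forces [L i ^+ 2 = o(i)]; the sum of
    fourth powers is then at most [o(k)] times a sum of squares of order [k]. *)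
Lemma cesaro_weights {R : realType} (L : nat -> R) (c : R) :
  (forall i, 0 <= L i) ->
  (k%:R^-1 * \sum_(i < k) L i ^+ 2) @[k --> \oo] --> c ->
  (exists2 C, 0 < C & forall k, \sum_(i < k) (1 + L i) ^+ 2 <= C * k%:R) /\
  (forall e, 0 < e -> \forall k \near \oo, \sum_(i < k) (1 + L i) ^+ 4 <= e * k%:R ^+ 2).
Proof.
move=> L0 Lc; pose u k := k%:R^-1 * \sum_(i < k) L i ^+ 2.
have m2 i : (1 + L i) ^+ 2 <= 2 + 2 * L i ^+ 2.
  have := sqr_ge0 (1 - L i); rewrite sqrrB sqrrD; lra.
have uE k : \sum_(i < k) L i ^+ 2 = u k * k%:R.
  case: k => [|k]; first by rewrite big_ord0 mulr0.
  by rewrite /u mulrAC mulVf ?mul1r// pnatr_eq0.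
have [B B0 uB] : exists2 B, 0 < B & forall k, u k <= B.
  have /cvg_seq_bounded/pinfty_ex_gt0[B B0 hB] : cvgn u by apply/cvg_ex; exists c.
  by exists B => // k; apply: le_trans (ler_norm _) _; exact: hB.
have hC k : \sum_(i < k) (1 + L i) ^+ 2 <= (2 + 2 * B) * k%:R.
  apply: (@le_trans _ _ (\sum_(i < k) (2 + 2 * L i ^+ 2))); first by apply: ler_sum.
  rewrite big_split/= sumr_const card_ord -[2 *+ k]mulr_natr -mulr_sumr uE [leRHS]mulrDl lerD2l.
  by rewrite mulrA ler_wpM2r// ler_wpM2l.
split; first by exists (2 + 2 * B) => //; rewrite addr_gt0// mulr_gt0.
have C0 : 0 < 2 + 2 * B by rewrite addr_gt0// mulr_gt0.
move: (2 + 2 * B) C0 hC => C C0 hC e e0.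
have q0 : 0 < e / (2 * C) by rewrite divr_gt0// mulr_gt0.
have small : \forall i \near \oo, (1 + L i) ^+ 2 <= e / (2 * C) * i%:R.
  move: (e / (2 * C)) q0 => q q0.
  have cu : u i.+1 - u i @[i --> \oo] --> c - c by apply: cvgB => //; rewrite cvg_shiftS.
  rewrite subrr in cu; have /cvgr_le/(_ (q / 8)) := cu; rewrite divr_gt0// => /(_ isT) h1.
  have h2 : \forall i \near \oo, (4 + 4 * B) / q <= i%:R :> R by apply: nbhs_infty_ger.
  apply: filterS2 h1 h2 => i /= h1 h2; apply: le_trans (m2 i) _.
  (* Consecutive means differ by [o(1)], so recovering one summand from two of them costs only
     [o(i)]. *)
  have LE : L i ^+ 2 = (u i.+1 - u i) * i%:R + u i.+1.
    have := uE i.+1; rewrite big_ord_recr/= uE -natr1; lra.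
  move: h2; rewrite ler_pdivrMr// => h2.
  have : (u i.+1 - u i) * i%:R <= q / 8 * i%:R by rewrite ler_wpM2r.
  have := uB i.+1; rewrite LE; nra.
have [n _ hn] := small.
pose D := \sum_(i < n) (1 + L i) ^+ 4.
have D0 : 0 <= D by apply: sumr_ge0 => i _; rewrite exprn_ge0// addr_ge0.
have key k : \sum_(i < k) (1 + L i) ^+ 4 <= D + e / 2 * k%:R ^+ 2.
  apply: (@le_trans _ _ (D + \sum_(i < k) e / (2 * C) * k%:R * (1 + L i) ^+ 2)); last first.
    rewrite lerD2l -mulr_sumr.
    apply: (@le_trans _ _ (e / (2 * C) * k%:R * (C * k%:R))).
      by rewrite ler_wpM2l// mulr_ge0// divr_ge0 ?mulr_ge0 ?(ltW e0) ?(ltW C0).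
    rewrite le_eqVlt; apply/orP; left; apply/eqP; field; rewrite gt_eqF//.
  have [kn|/ltnW nk] := leqP k n.
    rewrite (big_ord_widen n (fun i => (1 + L i) ^+ 4) kn) /D [X in _ <= X + _](bigID (fun i : 'I_n => (i < k)%N))/=.
    rewrite -addrA lerDl addr_ge0 ?sumr_ge0// => i _; first by rewrite exprn_ge0// addr_ge0.
    by rewrite mulr_ge0 ?sqr_ge0// mulr_ge0// ltW.
  rewrite -!(big_mkord predT (fun i => (1 + L i) ^+ 4)) (big_cat_nat (n := n))//= big_mkord lerD2l.
  rewrite -(big_mkord predT (fun i => e / (2 * C) * k%:R * (1 + L i) ^+ 2)).
  rewrite [leRHS](big_cat_nat (n := n))//= -[leLHS]add0r lerD//.
    by rewrite sumr_ge0// => i _; rewrite mulr_ge0 ?sqr_ge0// mulr_ge0// ltW.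
  rewrite big_nat [leRHS]big_nat; apply: ler_sum => i /andP[ni ik].
  rewrite (_ : (1 + L i) ^+ 4 = (1 + L i) ^+ 2 * (1 + L i) ^+ 2); last by rewrite -exprD.
  rewrite ler_wpM2r ?sqr_ge0//; apply: le_trans (hn i ni) _.
  by rewrite ler_wpM2l ?ler_nat ?(ltnW ik) ?(ltW q0).
have : \forall k \near \oo, 2 * D / e <= k%:R :> R.
  by apply: nbhs_infty_ger.
apply: filterS2 (_ : \forall k \near \oo, (0 < k)%N) => [k k0 hk|]; last by exists 1%N.
apply: le_trans (key k) _.
rewrite [leRHS](_ : _ = e / 2 * k%:R ^+ 2 + e / 2 * k%:R ^+ 2); last by field.
rewrite lerD2r; move: hk; rewrite ler_pdivrMr// => hk.
have k1 : 1 <= k%:R :> R by rewrite ler1n.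
have : k%:R * e <= k%:R ^+ 2 * e by rewrite ler_wpM2r ?(ltW e0)// expr2 ler_peMl.
lra.
Qed.

(** The budget is [delta * k] plus the square [F]. One half of each pays for the cross terms
    ([step1]), the other half for the denominator ([step2]). *)
Lemma quadratic_form_dominates {R : realType} (z C delta : R) : 0 < C -> 0 < delta ->
  exists2 rho, 0 < rho & \forall k \near \oo, forall (a L Lh S : 'I_k -> R),
    (forall i, a i = S i - L i) ->
    `|\sum_i a i * Lh i| <= rho * (k%:R + \sum_i Lh i ^+ 2) ->
    `|\sum_i a i * L i| <= rho * (k%:R + \sum_i L i ^+ 2) ->
    \sum_i L i ^+ 2 <= C * k%:R ->
    delta * k%:R <= \sum_i (a i ^+ 2 - S i) ->
    z * Num.sqrt (2 * \sum_i Lh i ^+ 2) <= \sum_i ((S i - Lh i) ^+ 2 - S i).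
Proof.
move=> C0 delta0; pose rho := Num.min (1 / 8) (delta / (2 * (4 + 6 * C))).
have rho0 : 0 < rho by rewrite lt_min !divr_gt0// mulr_gt0// addr_gt0// mulr_gt0.
exists rho => //.
pose kappa := Num.min (1 / 8) (delta / (16 * C)).
have kappa0 : 0 < kappa by rewrite lt_min !divr_gt0// mulr_gt0.
have : \forall k \near \oo, z ^+ 2 / kappa / delta <= k%:R :> R by apply: nbhs_infty_ger.
apply: filterS => k hk a L Lh S aE h1 h2 hL hS.
pose F := \sum_i (Lh i - L i) ^+ 2.
have F0 : 0 <= F by apply: sumr_ge0 => i _; rewrite sqr_ge0.
have k0 : 0 <= k%:R :> R by [].
set Q := \sum_i Lh i ^+ 2 in h1 *; set QL := \sum_i L i ^+ 2 in h2 hL.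
have QF : Q <= 2 * F + 2 * QL.
  rewrite /Q /F /QL !mulr_sumr -big_split/=; apply: ler_sum => i _.
  have := sqr_ge0 (Lh i - 2 * L i); rewrite sqrrB sqrrB; nra.
have Q0 : 0 <= Q by apply: sumr_ge0 => i _; rewrite sqr_ge0.
have -> : \sum_i ((S i - Lh i) ^+ 2 - S i) =
    \sum_i (a i ^+ 2 - S i) - 2 * \sum_i a i * Lh i + 2 * \sum_i a i * L i + F.
  rewrite !mulr_sumr -sumrB -!big_split/=; apply: eq_bigr => i _; rewrite aE; ring.
move: h1 h2 hS; set X := \sum_i a i * Lh i; set Y := \sum_i a i * L i.
set G := \sum_i _; rewrite !ler_norml => /andP[_ h1] /andP[h2 _] hS.
have r8 : rho <= 1 / 8 by rewrite ge_min lexx.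
have rd : rho * (4 + 6 * C) <= delta / 2.
  apply: (@le_trans _ _ (delta / (2 * (4 + 6 * C)) * (4 + 6 * C))).
    by rewrite ler_wpM2r ?ge_min ?lexx ?orbT// addr_ge0// mulr_ge0// ltW.
  have C6 : 0 < 4 + 6 * C by rewrite addr_gt0// mulr_gt0.
  by rewrite le_eqVlt; apply/orP; left; apply/eqP; field; rewrite gt_eqF.
have step1 : 2 * X - 2 * Y <= delta / 2 * k%:R + F / 2.
  apply: (@le_trans _ _ (rho * (4 + 6 * C) * k%:R + 4 * rho * F)); last first.
    by apply: lerD; [rewrite ler_wpM2r | rewrite mulrC ler_wpM2l//; lra].
  have : rho * Q <= rho * (2 * F + 2 * (C * k%:R)).
    by rewrite ler_wpM2l ?(ltW rho0)// (le_trans QF)// lerD2l ler_wpM2l.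
  have : rho * QL <= rho * (C * k%:R) by rewrite ler_wpM2l ?(ltW rho0).
  move: h1 h2; rewrite !mulrDr; lra.
have step2 : z * Num.sqrt (2 * Q) <= F / 2 + delta / 2 * k%:R.
  set s := Num.sqrt _; have s2 : s ^+ 2 = 2 * Q by rewrite sqr_sqrtr// mulr_ge0.
  have am : z * s <= kappa * s ^+ 2 + z ^+ 2 / (4 * kappa).
    rewrite -subr_ge0 (_ : _ - _ = (2 * kappa * s - z) ^+ 2 / (4 * kappa)); last first.
      by field; rewrite gt_eqF.
    by rewrite divr_ge0 ?sqr_ge0// mulr_ge0// ltW.
  apply: le_trans am _; rewrite s2.
  have kap8 : kappa <= 1 / 8 by rewrite ge_min lexx.
  have kapC : kappa * C <= delta / 16.
    apply: (@le_trans _ _ (delta / (16 * C) * C)).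
      by rewrite ler_wpM2r ?ge_min ?lexx ?orbT// ltW.
    by rewrite le_eqVlt; apply/orP; left; apply/eqP; field; rewrite gt_eqF.
  have zk : z ^+ 2 / (4 * kappa) <= delta / 4 * k%:R.
    move: hk; rewrite ler_pdivrMr// => hk.
    rewrite [leLHS](_ : _ = (z ^+ 2 / kappa) / 4); last by field; rewrite gt_eqF.
    lra.
  have : kappa * Q <= kappa * (2 * F + 2 * (C * k%:R)).
    by rewrite ler_wpM2l ?(ltW kappa0)// (le_trans QF)// lerD2l ler_wpM2l.
  have : kappa * F <= 1 / 8 * F by rewrite ler_wpM2r.
  have : kappa * C * k%:R <= delta / 16 * k%:R by rewrite ler_wpM2r.
  rewrite !mulrDr; lra.
lra.
Qed.

(** * The saturated model *)

Lemma with_high_probability_weak_law {R : realType} {d} {Omega : measurableType d}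
    (P : probability Omega R) (Y : nat -> Omega -> R) (v : nat -> R) :
  (forall i, measurable_fun setT (Y i)) ->
  (forall i, (\int[P]_w (Y i w ^+ 2)%:E <= (v i)%:E)%E) ->
  (forall i j, i != j -> (\int[P]_w (Y i w * Y j w)%:E = 0)%E) ->
  (forall e, 0 < e -> \forall k \near \oo, \sum_(i < k) v i <= e * k%:R ^+ 2) ->
  forall a : R, 0 < a ->
  with_high_probability P (fun k w => `|\sum_(i < k) Y i w| <= a * k%:R).
Proof.
move=> mY vY Y0 hv a a0 e e0; apply: filterS (weak_law mY vY Y0 hv a0 e0) => k hk.
exists [set w | a * k%:R <= `|\sum_(i < k) Y i w|]; last first.
  by move=> w /= /negP; rewrite -ltNge => /ltW.
split.
  rewrite -[X in measurable X]setTI; apply: (measurable_fun_le (f := cst _)) => //.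
  by apply: measurableT_comp => //; exact: measurable_sum.
have E w : \sum_(i < k) 1 * Y i w = \sum_(i < k) Y i w.
  by apply: eq_bigr => i _; rewrite mul1r.
have := hk (fun=> 1); rewrite (_ : [set _ | _] = [set w | a * k%:R <= `|\sum_(i < k) Y i w|]).
  by apply => i; rewrite normr1.
by apply/seteqP; split => w /=; rewrite E.
Qed.

Lemma sqr_sum_le {R : realDomainType} (n : nat) (z : 'I_n -> R) :
  (\sum_i z i) ^+ 2 <= n%:R * \sum_i z i ^+ 2.
Proof.
have h : 2 * (\sum_i z i) ^+ 2 <= 2 * (n%:R * \sum_i z i ^+ 2).
  rewrite expr2 big_distrlr/= mulr_sumr.
  apply: (@le_trans _ _ (\sum_i \sum_j (z i ^+ 2 + z j ^+ 2))).
    apply: ler_sum => i _; rewrite mulr_sumr; apply: ler_sum => j _.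
    by have := sqr_ge0 (z i - z j); rewrite sqrrB; lra.
  rewrite (eq_bigr (fun i => n%:R * z i ^+ 2 + \sum_j z j ^+ 2)); last first.
    by move=> i _; rewrite big_split/= sumr_const card_ord mulr_natl.
  rewrite big_split/= sumr_const card_ord -mulr_sumr -mulr_natl; lra.
by lra.
Qed.

Section saturated_model.
Context {R : realType} {d : measure_display} {Omega : measurableType d}
  (P : probability Omega R).
Context (p : nat) (T : nat -> nat) (x : nat -> nat -> 'rV[R]_p) (beta : 'rV[R]_p)
  (theta N : nat * nat -> Omega -> R) (tau2 : R) (Tm : nat).
Local Notation lam := (fun s : nat * nat => expR (dotp (x s.1 s.2) beta)).
Local Notation J := (obs_dom T).
Hypothesis T_le : forall i, (T i <= Tm)%N.
Hypothesis mtheta : forall s, measurable_fun setT (theta s).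
Hypothesis indep : mutually_independent P theta J.
Hypothesis idd : identically_distributed P theta J.
Hypothesis theta_ge0 : forall s, J s -> P [set w | theta s w < 0] = 0%E.
Hypothesis theta1 : forall s, J s -> (\int[P]_w (theta s w)%:E = 1)%E.
Hypothesis theta2 : forall s, J s -> (\int[P]_w (theta s w ^+ 2)%:E = (tau2 + 1)%:E)%E.
Hypothesis tau2_gt0 : 0 < tau2.
Hypothesis mN : forall s, measurable_fun setT (N s).
Hypothesis cpois : cond_poisson P theta N lam J.

Let lam_gt0 s : 0 < lam s. Proof. exact: expR_gt0. Qed.

Let msk (s : nat * nat) : R := (s.2 < T s.1)%N%:R.

Let mskP s : msk s = 1 /\ J s \/ msk s = 0.
Proof. by rewrite /msk /obs_dom /=; case: ltnP => h; [left|right]. Qed.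

Lemma masked_product_mean0 (g : nat * nat -> R -> R) (s : seq (nat * nat)) :
  (forall s, measurable_fun setT (g s)) ->
  (forall s, J s -> P.-integrable setT (fun w => (g s (N s w))%:E)) ->
  (forall s, J s -> \int[P]_w (g s (N s w))%:E = 0)%E ->
  uniq s -> s != [::] ->
  (\int[P]_w (\prod_(i <- s) (msk i * g i (N i w)))%:E = 0)%E.
Proof.
move=> mg ig g0 us s0.
have [sJ|/existsNP[i /not_implyP[si nJ]]] := pselect (forall i, i \in s -> J i); last first.
  apply: integral0_eq => w _; rewrite (big_rem i)//=.
  have [[_ /nJ//]|->] := mskP i; by rewrite !mul0r.
have pr := mixed_poisson_prod mtheta mN theta_ge0 lam_gt0 cpois indep.
have [_ E] := expectation_prod mN pr us sJ mg (fun i si => ig i (sJ i si)) (fun i si => g0 i (sJ i si)).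
transitivity (\int[P]_w (\prod_(i <- s) g i (N i w))%:E)%E.
  apply: eq_integral => w _; congr (_%:E); apply: eq_big_seq => i /sJ Ji.
  by rewrite /msk Ji mul1r.
by rewrite E; case: s s0 {us sJ E} => // a s _; rewrite big_cons mul0r.
Qed.

Definition residual i t (w : Omega) : R := msk (i, t) * (N (i, t) w - lam (i, t)).
Definition total_rate i : R := \sum_(t < T i) lam (i, nat_of_ord t).
Definition weight i : R := 1 + total_rate i.

Lemma total_rate_ge0 i : 0 <= total_rate i.
Proof. by apply: sumr_ge0 => t _; exact: expR_ge0. Qed.

Lemma rate_le_total i t : (t < T i)%N -> lam (i, t) <= total_rate i.
Proof.
move=> tT; rewrite /total_rate (bigD1 (Ordinal tT))//= lerDl.
by apply: sumr_ge0 => ? _; exact: expR_ge0.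
Qed.

Lemma weight_ge1 i : 1 <= weight i.
Proof. by rewrite lerDl total_rate_ge0. Qed.

Lemma weight_gt0 i : 0 < weight i.
Proof. exact: lt_le_trans (weight_ge1 i). Qed.

Lemma measurable_residual i t : measurable_fun setT (residual i t).
Proof. by apply: measurable_funM => //; exact: measurable_funB. Qed.

Lemma centered_count_integrable s : J s ->
  P.-integrable setT (fun w => (N s w - lam s)%:E).
Proof.
move=> Js; under eq_fun do rewrite EFinB; apply: integrableB => //.
  exact: (mixed_poisson_integrable mtheta mN theta_ge0 lam_gt0 cpois theta1).
exact: finite_measure_integrable_cst.
Qed.

Lemma centered_count_mean s : J s -> (\int[P]_w (N s w - lam s)%:E = 0)%E.
Proof. exact: (mixed_poisson_mean mtheta mN theta_ge0 lam_gt0 cpois theta1). Qed.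

Lemma residual_orthogonal i t j t' : (i, t) != (j, t') ->
  (\int[P]_w (residual i t w * residual j t' w)%:E = 0)%E.
Proof.
move=> ne; rewrite -(@masked_product_mean0 (fun s u => u - lam s) [:: (i, t); (j, t')])//.
- by apply: eq_integral => w _; rewrite big_cons big_seq1.
- by move=> s; exact: measurable_funB.
- exact: centered_count_integrable.
- exact: centered_count_mean.
- by rewrite /= inE ne.
Qed.

Lemma residual_sqr i t :
  (\int[P]_w (residual i t w ^+ 2)%:E = (msk (i, t) * (lam (i, t) + tau2 * lam (i, t) ^+ 2))%:E)%E.
Proof.
rewrite /residual; have [[-> Js]|->] := mskP (i, t); last first.
  by rewrite mul0r; apply: integral0_eq => w _; rewrite mul0r expr0n.
under eq_integral do rewrite mul1r.
rewrite (mixed_poisson_variance mtheta mN theta_ge0 lam_gt0 cpois theta1 theta2)//.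
by rewrite mul1r addrK.
Qed.

Lemma residual_sqr_le i t :
  (\int[P]_w (residual i t w ^+ 2)%:E <= ((1 + tau2) * weight i ^+ 2)%:E)%E.
Proof.
rewrite residual_sqr lee_fin; have [[-> Js]|->] := mskP (i, t); last first.
  by rewrite mul0r mulr_ge0 ?sqr_ge0// addr_ge0// ltW.
have l0 := ltW (lam_gt0 (i, t)); have l1 := rate_le_total Js; have w1 := weight_ge1 i.
have lw : lam (i, t) <= weight i by rewrite (le_trans l1)// lerDr.
rewrite mul1r; move: (lam (i, t)) l0 lw {l1} => l l0 lw.
have l2 : l ^+ 2 <= weight i ^+ 2 by rewrite lerXn2r ?nnegrE// (le_trans l0).
have : l <= weight i ^+ 2 by rewrite (le_trans lw)// expr2 ler_peMl// (le_trans ler01).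
have : tau2 * l ^+ 2 <= tau2 * weight i ^+ 2 by rewrite ler_wpM2l// ltW.
rewrite mulrDl mul1r; lra.
Qed.

Lemma residual_uniform_integrability (delta : R) : 0 < delta ->
  exists2 M, 0 < M & forall i t,
    (\int[P]_w (residual i t w ^+ 2 * (M * weight i < `|residual i t w|)%R%:R)%:E
     <= (delta * weight i ^+ 2)%:E)%E.
Proof.
move=> delta0.
have [M M0 hM] := mixed_poisson_uniform_integrability mtheta mN theta_ge0 lam_gt0 cpois
  idd theta1 theta2 delta0.
exists M => // i t; have mr := measurable_residual i t.
have [[m1 Js]|m0] := mskP (i, t); last first.
  rewrite integral0_eq; first by rewrite lee_fin mulr_ge0 ?sqr_ge0// ltW.
  by move=> w _; rewrite /residual m0 mul0r expr0n mul0r.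
have lw : 1 + lam (i, t) <= weight i by rewrite lerD2l; exact: rate_le_total.
have l0 : 0 <= 1 + lam (i, t) by rewrite addr_ge0 ?expR_ge0.
apply: (@le_trans _ _ (delta * (1 + lam (i, t)) ^+ 2)%:E); last first.
  by rewrite lee_fin ler_wpM2l ?(ltW delta0)// lerXn2r ?nnegrE// (le_trans l0).
apply: le_trans (hM _ Js); rewrite /residual; under eq_integral do rewrite m1 mul1r.
have mc : measurable_fun setT (fun w => N (i, t) w - lam (i, t)) by exact: measurable_funB.
have mi a : measurable_fun setT (fun w => (N (i, t) w - lam (i, t)) ^+ 2 *
    (a < `|N (i, t) w - lam (i, t)|)%R%:R : R).
  apply: measurable_funM; first exact: measurable_funX.
  by apply: measurable_ltr_nat; exact: measurableT_comp.
apply: le_integral_EFin => //.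
- by move=> w; rewrite mulr_ge0 ?sqr_ge0.
- move=> w; rewrite ler_wpM2l ?sqr_ge0// ler_nat.
  have : M * weight i < `|N (i, t) w - lam (i, t)| ->
      M * (1 + lam (i, t)) < `|N (i, t) w - lam (i, t)|.
    by apply: le_lt_trans; rewrite ler_wpM2l// ltW.
  by case: (M * weight i < _) => // ->.
Qed.

Lemma residual_product_orthogonal i j t t' : i != j -> t != t' ->
  (\int[P]_w ((residual i t w * residual i t' w) * (residual j t w * residual j t' w))%:E = 0)%E.
Proof.
move=> ij tt'.
rewrite -(@masked_product_mean0 (fun s u => u - lam s) [:: (i, t); (i, t'); (j, t); (j, t')])//.
- by apply: eq_integral => w _; rewrite !big_cons big_nil mulr1 /residual !mulrA.
- by move=> s; exact: measurable_funB.
- exact: centered_count_integrable.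
- exact: centered_count_mean.
- by rewrite /= !inE !xpair_eqE !eqxx (negbTE ij) (negbTE tt') ?andbF.
Qed.

Lemma residual_product_sqr i t t' : t != t' ->
  (\int[P]_w ((residual i t w * residual i t' w) ^+ 2)%:E <=
   ((1 + tau2) ^+ 2 * weight i ^+ 4)%:E)%E.
Proof.
move=> tt'; have [[m1 Js]|m0] := mskP (i, t); last first.
  rewrite integral0_eq; first by rewrite lee_fin mulr_ge0 ?sqr_ge0// exprn_ge0// ltW// weight_gt0.
  by move=> w _; rewrite /residual m0 !mul0r expr0n.
have [[m1' Js']|m0] := mskP (i, t'); last first.
  rewrite integral0_eq; first by rewrite lee_fin mulr_ge0 ?sqr_ge0// exprn_ge0// ltW// weight_gt0.
  by move=> w _; rewrite /residual m0 !mul0r mulr0 expr0n.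
have pr := mixed_poisson_prod mtheta mN theta_ge0 lam_gt0 cpois indep.
pose e (s : nat * nat) : R := lam s + tau2 * lam s ^+ 2.
have := pr [:: (i, t); (i, t')] (fun s u => (u - lam s) ^+ 2) e.
rewrite /= inE xpair_eqE eqxx/= (negbTE tt') => /(_ isT) prE.
have -> : (\int[P]_w ((residual i t w * residual i t' w) ^+ 2)%:E = (e (i, t) * e (i, t'))%:E)%E.
  rewrite -(_ : \prod_(s <- [:: (i, t); (i, t')]) e s = e (i, t) * e (i, t')); last first.
    by rewrite big_cons big_seq1.
  rewrite -prE.
  - apply: eq_integral => w _; rewrite big_cons big_seq1 /residual m1 m1' !mul1r.
    by rewrite exprMn.
  - by move=> s; rewrite !inE => /orP[/eqP->|/eqP->].
  - by move=> s; apply: measurable_funX; exact: measurable_funB.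
  - by move=> s u; rewrite sqr_ge0.
  - move=> s ss; have Jss : J s by move: ss; rewrite !inE => /orP[/eqP->|/eqP->].
    rewrite (mixed_poisson_variance mtheta mN theta_ge0 lam_gt0 cpois theta1 theta2)//.
    by rewrite addrK.
have h t0 : msk (i, t0) = 1 -> e (i, t0) <= (1 + tau2) * weight i ^+ 2.
  by move=> mt; have := residual_sqr_le i t0; rewrite residual_sqr lee_fin mt mul1r.
have e0 s : 0 <= e s by rewrite /e addr_ge0 ?expR_ge0// mulr_ge0 ?sqr_ge0// ltW.
rewrite lee_fin [leRHS](_ : _ = ((1 + tau2) * weight i ^+ 2) * ((1 + tau2) * weight i ^+ 2)); last by ring.
by rewrite ler_pM ?h.
Qed.

Variable M : R.
Hypothesis M_gt0 : 0 < M.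

Let trunc (s : nat * nat) (u : R) : R := Num.min ((u - lam s) ^+ 2) ((M * weight s.1) ^+ 2).
Let truncE s : R := fine (\int[P]_w (trunc s (N s w))%:E)%E.

Let trunc_ge0 s u : 0 <= trunc s u.
Proof. by rewrite le_min !sqr_ge0. Qed.

Let trunc_le s u : trunc s u <= (M * weight s.1) ^+ 2.
Proof. by rewrite ge_min lexx orbT. Qed.

Let measurable_trunc s : measurable_fun setT (trunc s).
Proof. by apply: measurable_minr => //; apply: measurable_funX; exact: measurable_funB. Qed.

Let mtN s : measurable_fun setT (fun w => trunc s (N s w)).
Proof. exact: measurableT_comp. Qed.

Let integral_trunc_le s : (\int[P]_w (trunc s (N s w))%:E <= ((M * weight s.1) ^+ 2)%:E)%E.
Proof.
by rewrite -(integral_prob_cst P); apply: le_integral_EFin.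
Qed.

Let truncEK s : (\int[P]_w (trunc s (N s w))%:E = (truncE s)%:E)%E.
Proof.
rewrite fineK// ge0_fin_numE; first exact: le_lt_trans (integral_trunc_le s) (ltry _).
by apply: integral_ge0 => w _; rewrite lee_fin.
Qed.

Let truncE_bounds s : 0 <= truncE s <= (M * weight s.1) ^+ 2.
Proof.
rewrite -!lee_fin -truncEK integral_trunc_le andbT.
by apply: integral_ge0 => w _; rewrite lee_fin.
Qed.

Definition truncated_deviation i t w : R :=
  msk (i, t) * (trunc (i, t) (N (i, t) w) - truncE (i, t)).

Lemma truncated_deviation_sqr i t :
  (\int[P]_w (truncated_deviation i t w ^+ 2)%:E <= (M ^+ 4 * weight i ^+ 4)%:E)%E.
Proof.
have md : measurable_fun setT (truncated_deviation i t).
  by apply: measurable_funM => //; exact: measurable_funB.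
rewrite -(integral_prob_cst P); apply: le_integral_EFin => //.
- exact: measurable_funX.
- by move=> w; rewrite sqr_ge0.
move=> w; rewrite -exprMn (_ : _ ^+ 4 = ((M * weight i) ^+ 2) ^+ 2); last by rewrite -exprM.
rewrite -[leLHS]real_normK ?num_real// lerXn2r ?nnegrE ?sqr_ge0//.
rewrite /truncated_deviation normrM; have [[-> _]|->] := mskP (i, t); last first.
  by rewrite normr0 mul0r sqr_ge0.
rewrite normr1 mul1r; have /andP[e0 e1] := truncE_bounds (i, t).
have t0 := trunc_ge0 (i, t) (N (i, t) w); have t1 := trunc_le (i, t) (N (i, t) w).
rewrite ler_norml; apply/andP; move: e0 e1 t0 t1 => /=; split; lra.
Qed.

Lemma truncated_deviation_orthogonal i j t : i != j ->
  (\int[P]_w (truncated_deviation i t w * truncated_deviation j t w)%:E = 0)%E.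
Proof.
move=> ij.
rewrite -(@masked_product_mean0 (fun s u => trunc s u - truncE s) [:: (i, t); (j, t)])//.
- by apply: eq_integral => w _; rewrite big_cons big_seq1.
- by move=> s; exact: measurable_funB.
- move=> s _; under eq_fun do rewrite EFinB; apply: integrableB => //.
    exact: (ge0_integrable (mtN s) _ (truncEK s)).
  exact: finite_measure_integrable_cst.
- move=> s _; under eq_integral do rewrite EFinB.
  rewrite integralB//; last 2 first.
  - exact: (ge0_integrable (mtN s) _ (truncEK s)).
  - exact: finite_measure_integrable_cst.
  by rewrite truncEK integral_prob_cst subee.
- by rewrite /= inE xpair_eqE (negbTE ij).
Qed.

Lemma truncated_mean_ge (delta : R) i t : (t < T i)%N ->
  (\int[P]_w (residual i t w ^+ 2 * (M * weight i < `|residual i t w|)%R%:R)%:E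
     <= (delta * weight i ^+ 2)%:E)%E ->
  lam (i, t) + tau2 * lam (i, t) ^+ 2 - delta * weight i ^+ 2 <= truncE (i, t).
Proof.
move=> tT hd; rewrite lerBlDr -lee_fin [in leRHS]EFinD -truncEK; apply: le_trans (leeD (lexx _) hd).
have m1 : msk (i, t) = 1 by rewrite /msk tT.
have := residual_sqr i t; rewrite m1 mul1r => <-.
have mr := measurable_residual i t.
have mi : measurable_fun setT (fun w => residual i t w ^+ 2 *
    (M * weight i < `|residual i t w|)%R%:R : R).
  apply: measurable_funM; first exact: measurable_funX.
  by apply: measurable_ltr_nat; exact: measurableT_comp.
rewrite -ge0_integral_EFinD//; last by move=> w; rewrite mulr_ge0 ?sqr_ge0.
apply: le_integral_EFin => //.
- exact: measurable_funX.
- exact: measurable_funD.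
- by move=> w; rewrite sqr_ge0.
move=> w; rewrite /trunc /residual m1 mul1r /=.
set A := N (i, t) w - lam (i, t).
have [AM|AM] := ltP (M * weight i) `|A|.
  by rewrite mulr1 lerDr le_min !sqr_ge0.
rewrite mulr0 addr0 min_l//.
by rewrite -real_normK ?num_real// lerXn2r ?nnegrE// mulr_ge0 ?(ltW M_gt0)// ltW// weight_gt0.
Qed.

Hypothesis weight4 : forall e, 0 < e ->
  \forall k \near \oo, \sum_(i < k) weight i ^+ 4 <= e * k%:R ^+ 2.

Let weight4Z v e : 0 <= v -> 0 < e ->
  \forall k \near \oo, \sum_(i < k) v * weight i ^+ 4 <= e * k%:R ^+ 2.
Proof.
move=> v0 e0; have v1 : 0 < v + 1 by rewrite ltr_wpDl.
have := weight4 (divr_gt0 e0 v1); apply: filterS => k hk; rewrite -mulr_sumr.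
have s0 : 0 <= \sum_(i < k) weight i ^+ 4.
  by apply: sumr_ge0 => i _; rewrite exprn_ge0// ltW// weight_gt0.
apply: (@le_trans _ _ ((v + 1) * \sum_(i < k) weight i ^+ 4)).
  by rewrite ler_wpM2r// lerDl.
by rewrite -ler_pdivlMl// mulrA (mulrC _^-1).
Qed.

Lemma sum_periods (F : nat -> R) i :
  \sum_(t < T i) F t = \sum_(t < Tm) msk (i, nat_of_ord t) * F t.
Proof.
rewrite (big_ord_widen Tm F (T_le i)) big_mkcond/=; apply: eq_bigr => t _.
by rewrite /msk/=; case: ifP; rewrite ?mul1r ?mul0r.
Qed.

Lemma quadratic_lower_bound (delta C eta : R) : 0 < delta -> 0 < eta ->
  (forall i t, (\int[P]_w (residual i t w ^+ 2 *
       (M * weight i < `|residual i t w|)%R%:R)%:E <= (delta * weight i ^+ 2)%:E)%E) ->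
  (forall k, \sum_(i < k) weight i ^+ 2 <= C * k%:R) ->
  with_high_probability P (fun k w =>
    tau2 * \sum_(i < k) total_rate i ^+ 2 <= Tm%:R * (
      \sum_(i < k) ((\sum_(t < T i) (N (nat_of_ord i, nat_of_ord t) w - lam (nat_of_ord i, nat_of_ord t))) ^+ 2
                     - \sum_(t < T i) N (nat_of_ord i, nat_of_ord t) w)
      + (Tm%:R * (2 * eta + delta * C + Tm%:R * eta)) * k%:R)).
Proof.
move=> delta0 eta0 hM hC.
have tau1 : 0 <= 1 + tau2 by rewrite addr_ge0// ltW.
have E3 t : with_high_probability P (fun k w => `|\sum_(i < k) truncated_deviation i t w| <= eta * k%:R).
  apply: (with_high_probability_weak_law (Y := fun i => truncated_deviation i t) (v := fun i => M ^+ 4 * weight i ^+ 4)) => // [i|i|i j ij|e e0].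
  - by apply: measurable_funM => //; exact: measurable_funB.
  - exact: truncated_deviation_sqr.
  - exact: truncated_deviation_orthogonal.
  - by apply: weight4Z => //; rewrite exprn_ge0// ltW.
have E4 t : with_high_probability P (fun k w => `|\sum_(i < k) residual i t w| <= eta * k%:R).
  apply: (with_high_probability_weak_law (Y := fun i => residual i t) (v := fun i => (1 + tau2) * weight i ^+ 4)) => // [i|i|i j ij|e e0].
  - exact: measurable_residual.
  - apply: le_trans (residual_sqr_le i t) _; rewrite lee_fin ler_wpM2l//.
    by rewrite ler_weXn2l// weight_ge1.
  - by apply: residual_orthogonal; rewrite xpair_eqE (negbTE ij).
  - exact: weight4Z.
have E5 t t' : with_high_probability P (fun k w => t != t' ->
    `|\sum_(i < k) residual i t w * residual i t' w| <= eta * k%:R).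
  have [->|tt'] := eqVneq t t'.
    by move=> e e0; apply: nearW => k; exists set0 => //; split; rewrite ?measure0 ?lee_fin// ltW.
  apply: with_high_probabilityS (with_high_probability_weak_law
    (Y := fun i w => residual i t w * residual i t' w) (v := fun i => (1 + tau2) ^+ 2 * weight i ^+ 4) _ _ _ _ eta0) => [|i|i|i j ij|e e0].
  - by apply: nearW => k w h _.
  - by apply: measurable_funM; exact: measurable_residual.
  - exact: residual_product_sqr.
  - exact: residual_product_orthogonal.
  - by apply: weight4Z => //; exact: sqr_ge0.
have := with_high_probabilityI
  (with_high_probability_forall (fun t (_ : (t < Tm)%N) => E3 t))
  (with_high_probabilityI
    (with_high_probability_forall (fun t (_ : (t < Tm)%N) => E4 t))
    (with_high_probability_forall (fun t (_ : (t < Tm)%N) =>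
       with_high_probability_forall (fun t' (_ : (t' < Tm)%N) => E5 t t')))).
apply: with_high_probabilityS; apply: nearW => k w [h3 [h4 h5]].
have aE i : \sum_(t < T i) (N (i, nat_of_ord t) w - lam (i, nat_of_ord t)) =
    \sum_(t < Tm) residual i t w.
  by rewrite (sum_periods (fun t => N (i, t) w - lam (i, t))).
pose Q (i : nat) (t : nat) : R := residual i t w ^+ 2 - msk (i, t) * N (i, t) w.
have GE : \sum_(i < k) ((\sum_(t < T i) (N (nat_of_ord i, nat_of_ord t) w - lam (nat_of_ord i, nat_of_ord t))) ^+ 2
                     - \sum_(t < T i) N (nat_of_ord i, nat_of_ord t) w) =
   \sum_(t < Tm) \sum_(i < k) Q i t +
   \sum_(t < Tm) \sum_(t' < Tm | t' != t) \sum_(i < k) residual i t w * residual i t' w.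
  rewrite exchange_big/=.
  under [X in _ + X]eq_bigr do rewrite exchange_big/=.
  rewrite [X in _ + X]exchange_big/= -big_split/=; apply: eq_bigr => i _.
  rewrite aE (sum_periods (fun t => N (nat_of_ord i, t) w)) /Q sumrB addrAC; congr (_ - _).
  rewrite -big_split/= expr2 big_distrlr/=; apply: eq_bigr => t _.
  by rewrite (bigD1 t)//= -expr2.
have l5 : - (Tm%:R * (Tm%:R * eta) * k%:R) <=
    \sum_(t < Tm) \sum_(t' < Tm | t' != t) \sum_(i < k) residual i t w * residual i t' w.
  have -> : - (Tm%:R * (Tm%:R * eta) * k%:R) = \sum_(t < Tm) \sum_(t' < Tm) - (eta * k%:R).
    have cst (u : R) : \sum_(t < Tm) u = Tm%:R * u by rewrite sumr_const card_ord mulr_natl.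
    by rewrite !cst; ring.
  apply: ler_sum => t _; rewrite [leLHS](bigD1 t)//= -[leRHS]add0r lerD//.
    by rewrite oppr_le0 mulr_ge0// ltW.
  apply: ler_sum => t' tt'; have := h5 t (ltn_ord t) t' (ltn_ord t').
  by rewrite eq_sym => /(_ tt'); rewrite ler_norml => /andP[].
have lQ t : (t < Tm)%N -> - (2 * eta * k%:R) + \sum_(i < k) (tau2 * (msk (nat_of_ord i, t) * lam (nat_of_ord i, t) ^+ 2)
     - delta * weight i ^+ 2) <= \sum_(i < k) Q i t.
  move=> tTm.
  apply: (@le_trans _ _ (\sum_(i < k) truncated_deviation i t w - \sum_(i < k) residual i t w +
      \sum_(i < k) (tau2 * (msk (nat_of_ord i, t) * lam (nat_of_ord i, t) ^+ 2) - delta * weight i ^+ 2))).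
    rewrite lerD2r; have := h3 t tTm; have := h4 t tTm.
    rewrite !ler_norml => /andP[_ u1] /andP[u2 _]; lra.
  rewrite -sumrB -big_split/=; apply: ler_sum => i _.
  rewrite /Q /truncated_deviation /residual; have [[m1 Js]|->] := mskP (nat_of_ord i, t); last first.
    rewrite !mul0r expr0n/= !subrr mulr0 add0r sub0r oppr_le0 mulr_ge0 ?sqr_ge0//.
    exact: ltW.
  rewrite m1 !mul1r.
  have := truncated_mean_ge Js (hM i t).
  have : trunc (nat_of_ord i, t) (N (nat_of_ord i, t) w) <= (N (nat_of_ord i, t) w - lam (nat_of_ord i, t)) ^+ 2.
    by rewrite ge_min lexx.
  lra.
have lQs : - (Tm%:R * (2 * eta + delta * C) * k%:R) +
    tau2 * \sum_(i < k) \sum_(t < Tm) msk (nat_of_ord i, nat_of_ord t) * lam (nat_of_ord i, nat_of_ord t) ^+ 2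
    <= \sum_(t < Tm) \sum_(i < k) Q i t.
  apply: (@le_trans _ _ (\sum_(t < Tm) (- (2 * eta * k%:R) +
     \sum_(i < k) (tau2 * (msk (nat_of_ord i, nat_of_ord t) * lam (nat_of_ord i, nat_of_ord t) ^+ 2)
     - delta * weight i ^+ 2)))); last first.
    by apply: ler_sum => t _; exact: lQ.
  rewrite big_split/= sumr_const card_ord -[X in _ <= X + _]mulr_natl.
  under [X in _ <= _ + X]eq_bigr do rewrite sumrB -!mulr_sumr.
  rewrite sumrB -mulr_sumr exchange_big/= sumr_const card_ord -[X in _ - X]mulr_natl.
  have : Tm%:R * (delta * \sum_(i < k) weight i ^+ 2) <= Tm%:R * (delta * (C * k%:R)).
    by rewrite ler_wpM2l// ler_wpM2l ?hC// ltW.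
  lra.
have cs : \sum_(i < k) total_rate i ^+ 2 <=
    Tm%:R * \sum_(i < k) \sum_(t < Tm) msk (nat_of_ord i, nat_of_ord t) * lam (nat_of_ord i, nat_of_ord t) ^+ 2.
  rewrite mulr_sumr; apply: ler_sum => i _.
  rewrite /total_rate (sum_periods (fun t => lam (nat_of_ord i, t))).
  apply: le_trans (sqr_sum_le _) _; rewrite ler_wpM2l//; apply: ler_sum => t _.
  by rewrite exprMn ler_wpM2r ?sqr_ge0// /msk; case: (_ < _)%N; rewrite ?expr1n ?expr0n.
rewrite GE; apply: (@le_trans _ _ (tau2 * (Tm%:R * \sum_(i < k) \sum_(t < Tm)
    msk (nat_of_ord i, nat_of_ord t) * lam (nat_of_ord i, nat_of_ord t) ^+ 2))).
  by rewrite ler_wpM2l// ltW.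
rewrite mulrCA ler_wpM2l//; lra.
Qed.

Lemma cross_term_bound (C rho : R) : 0 < C -> 0 < rho ->
  (forall k, \sum_(i < k) weight i ^+ 2 <= C * k%:R) ->
  with_high_probability P (fun k w => forall b : 'rV[R]_p,
    `|\sum_(i < k) (\sum_(t < T i) (N (nat_of_ord i, nat_of_ord t) w - lam (nat_of_ord i, nat_of_ord t))) *
       (\sum_(t < T i) expR (dotp (x i t) b))| <=
    rho * (k%:R + \sum_(i < k) (\sum_(t < T i) expR (dotp (x i t) b)) ^+ 2)).
Proof.
move=> C0 rho0 hC; pose rho' := rho / (Tm%:R ^+ 2 + 1).
have Tm1 : 0 < Tm%:R ^+ 2 + 1 :> R by rewrite ltr_wpDl// sqr_ge0.
have rho'0 : 0 < rho' by rewrite divr_gt0.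
have E t t' : with_high_probability P (fun k w => forall b : 'rV[R]_p,
    `|\sum_(i < k) msk (nat_of_ord i, t') * residual i t w * expR (dotp (x i t') b)| <=
    rho' * (k%:R + \sum_(i < k) msk (nat_of_ord i, t') * expR (dotp (x i t') b) ^+ 2)).
  apply: (@uniform_cross_sum _ _ _ P p (fun i => x i t') (fun i => (t' < T i)%N) weight
    (fun i => residual i t) (1 + tau2) C) => //.
  - exact: weight_gt0.
  - by move=> i; exact: measurable_residual.
  - by move=> i; exact: residual_sqr_le.
  - by move=> i j ij; apply: residual_orthogonal; rewrite xpair_eqE (negbTE ij).
  - by move=> delta /residual_uniform_integrability[M' M'0 hM]; exists M'.
have := with_high_probability_forall (fun t (_ : (t < Tm)%N) =>
       with_high_probability_forall (fun t' (_ : (t' < Tm)%N) => E t t')).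
apply: with_high_probabilityS; apply: nearW => k w h b.
pose f (i : nat) (t : nat) : R := expR (dotp (x i t) b).
pose Lh i : R := \sum_(t < Tm) msk (i, nat_of_ord t) * f i t.
have LhE i : \sum_(t < T i) expR (dotp (x i t) b) = Lh i by rewrite (sum_periods (f i)).
under eq_bigr do rewrite LhE (sum_periods (fun t => N (_, t) w - lam (_, t))).
under [X in _ <= _ * (_ + X)]eq_bigr do rewrite LhE.
have msk0 s : 0 <= msk s by rewrite /msk.
have f0 i t : 0 <= f i t by exact: expR_ge0.
have sub (t' : 'I_Tm) : \sum_(i < k) msk (nat_of_ord i, nat_of_ord t') * f i t' ^+ 2 <= \sum_(i < k) Lh i ^+ 2.
  apply: ler_sum => i _.
  have le1 : msk (nat_of_ord i, nat_of_ord t') * f i t' <= Lh i.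
    by rewrite /Lh (bigD1 t')//= lerDl sumr_ge0// => j _; rewrite mulr_ge0.
  have -> : msk (nat_of_ord i, nat_of_ord t') * f i t' ^+ 2 = (msk (nat_of_ord i, nat_of_ord t') * f i t') ^+ 2.
    by rewrite exprMn /msk; case: (_ < _)%N; rewrite ?expr1n ?expr0n.
  by rewrite lerXn2r ?nnegrE ?mulr_ge0// (le_trans _ le1)// mulr_ge0.
have -> : \sum_(i < k) (\sum_(t < Tm) msk (nat_of_ord i, nat_of_ord t) *
      (N (nat_of_ord i, nat_of_ord t) w - lam (nat_of_ord i, nat_of_ord t))) * Lh i =
    \sum_(t < Tm) \sum_(t' < Tm) \sum_(i < k) msk (nat_of_ord i, nat_of_ord t') * residual i t w * f i t'.
  under [RHS]eq_bigr do rewrite exchange_big/=.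
  rewrite exchange_big/=; apply: eq_bigr => i _; rewrite big_distrlr/=.
  by apply: eq_bigr => t _; apply: eq_bigr => t' _; rewrite /residual; ring.
set Q := \sum_(i < k) Lh i ^+ 2.
have kQ : 0 <= k%:R + Q by rewrite addr_ge0// sumr_ge0// => i _; rewrite sqr_ge0.
have cst (u : R) : \sum_(t < Tm) u = Tm%:R * u by rewrite sumr_const card_ord mulr_natl.
apply: (@le_trans _ _ (\sum_(t < Tm) \sum_(t' < Tm) rho' * (k%:R + Q))).
  apply: le_trans (ler_norm_sum _ _ _) _; apply: ler_sum => t _.
  apply: le_trans (ler_norm_sum _ _ _) _; apply: ler_sum => t' _.
  apply: le_trans (h t (ltn_ord t) t' (ltn_ord t') b) _.
  by rewrite ler_wpM2l ?(ltW rho'0)// lerD2l; exact: sub.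
have key : Tm%:R * (Tm%:R * rho') <= rho.
  have -> : Tm%:R * (Tm%:R * rho') = Tm%:R ^+ 2 * rho / (Tm%:R ^+ 2 + 1) by rewrite /rho'; ring.
  by rewrite ler_pdivrMr// mulrC ler_wpM2l ?(ltW rho0)// lerDl.
rewrite !cst (_ : Tm%:R * _ = Tm%:R * (Tm%:R * rho') * (k%:R + Q)); last by ring.
by rewrite ler_wpM2r.
Qed.

End saturated_model.

Lemma measurable_T_pin {R : realType} {d} {Omega : measurableType d} (T : nat -> nat)
    (Nobs lamhat : nat * nat -> Omega -> R) (k : nat) :
  (forall s, measurable_fun setT (Nobs s)) -> (forall s, measurable_fun setT (lamhat s)) ->
  measurable_fun setT (fun w => T_pin T (fun s => Nobs s w) (fun s => lamhat s w) k).
Proof.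
move=> mN ml; rewrite /T_pin; apply: measurable_funM.
  apply: measurable_sum => i; apply: measurable_funB; last by apply: measurable_sum => t.
  apply: measurable_funX; apply: measurable_sum => t; exact: measurable_funB.
rewrite (_ : (fun _ => _) = (fun w => (Num.sqrt (2 * \sum_(i < k)
    (\sum_(t < T i) lamhat (nat_of_ord i, nat_of_ord t) w) ^+ 2)) `^ (-1))); last first.
  by apply/funext => w; rewrite powR_inv1// sqrtr_ge0.
have ms : measurable_fun setT (@Num.sqrt R).
  by apply: continuous_measurable_fun; exact: sqrt_continuous.
apply: (measurableT_comp (measurable_powR (-1))); apply: (measurableT_comp ms).
apply: measurable_funM => //; apply: measurable_sum => i.
by apply: measurable_funX; apply: measurable_sum => t.
Qed.

Theorem theorem1 (R : realType) (d : measure_display) (Omega : measurableType d)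
  (P : probability Omega R)
  (p : nat) (T : nat -> nat) (x : nat -> nat -> 'rV[R]_p) (beta : 'rV[R]_p)
  (theta N : nat * nat -> Omega -> R) (tau2 : R)
  (betahat : nat -> Omega -> 'rV[R]_p)
  (c : R) (alpha z : R) :
  (* max_i T_i bounded *)
  (exists Tmax, forall i, (T i <= Tmax)%N) ->
  (* random effects theta_it: i.i.d., mean 1, variance tau^2 > 0 *)
  (forall s, measurable_fun setT (theta s)) ->
  mutually_independent P theta (obs_dom T) ->
  identically_distributed P theta (obs_dom T) ->
  (forall s, obs_dom T s -> P [set w | theta s w < 0] = 0%E) ->
  (forall s, obs_dom T s -> theta s \in Lfun P 2%:E) ->
  (forall s, obs_dom T s -> ('E_P[theta s] = 1)%E) ->
  (forall s, obs_dom T s -> ('V_P[theta s] = tau2%:E)%E) ->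
  0 < tau2 ->
  (* counts: conditionally independent Poisson(theta_it * lambda_it),
     lambda_it = exp(x_it^T beta) *)
  (forall s, measurable_fun setT (N s)) ->
  cond_poisson P theta N (fun s => expR (dotp (x s.1 s.2) beta)) (obs_dom T) ->
  (* (1/k) sum_i (sum_t lambda_it)^2 converges to a positive constant *)
  0 < c ->
  (fun k : nat => k%:R^-1 * \sum_(i < k)
      (\sum_(t < T i) expR (dotp (x i t) beta)) ^+ 2) @ \oo --> c ->
  (* betahat: MLE of beta in the Poisson regression on the first k policyholders
     (a maximizer of the Poisson likelihood whenever one exists), measurable *)
  (forall k (j : 'I_p), measurable_fun setT (fun w => betahat k w 0 j)) ->
  (forall k w, (exists b, forall b', pois_loglik T x (fun s => N s w) k b'
                                     <= pois_loglik T x (fun s => N s w) k b) ->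
     forall b', pois_loglik T x (fun s => N s w) k b'
                <= pois_loglik T x (fun s => N s w) k (betahat k w)) ->
  (* z is the (1 - alpha) quantile of N(0,1) *)
  0 < alpha < 1 ->
  std_normal_cdf z = (1 - alpha)%:E ->
  (* the test rejects with probability tending to one *)
  (fun k : nat => P [set w | z <= T_pin T (fun s => N s w)
         (fun s => expR (dotp (x s.1 s.2) (betahat k w))) k]) @ \oo --> 1%E.
Proof.
move=> [Tm0 hTm] mth indep idd th0 thL2 thE thV tau0 mN cp c0 cvgc mbeta _ _ _.
pose Tm := Tm0.+1; have T_le i : (T i <= Tm)%N by rewrite (leq_trans (hTm i)).
have theta1 s : obs_dom T s -> (\int[P]_w (theta s w)%:E = 1)%E.
  by move=> /thE; rewrite expectation.unlock.
have theta2 s : obs_dom T s -> (\int[P]_w (theta s w ^+ 2)%:E = (tau2 + 1)%:E)%E.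
  move=> Js; have := thV s Js; rewrite varianceE ?thL2// (thE s Js) expectation.unlock.
  rewrite expe2 mule1; case: (integral _ _ _) => [r||]//=.
  by rewrite -EFinB => -[h]; congr (_%:E); lra.
pose L := total_rate T x beta.
have L0 i : 0 <= L i by exact: total_rate_ge0.
have [[C C0 hC] h4] := cesaro_weights L0 cvgc.
pose delta0 := tau2 * c / (4 * Tm%:R).
have Tm0' : 0 < Tm%:R :> R by rewrite ltr0n.
have delta00 : 0 < delta0 by rewrite divr_gt0 ?mulr_gt0.
have [rho rho0 hq] := quadratic_form_dominates z C0 delta00.
pose eta := tau2 * c / (8 * Tm%:R ^+ 2 * (2 + Tm%:R)).
have T2 : 0 < 2 + Tm%:R :> R by rewrite ltr_wpDl.
have eta0 : 0 < eta by rewrite divr_gt0 ?mulr_gt0 ?exprn_gt0.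
pose delta := tau2 * c / (8 * Tm%:R ^+ 2 * C).
have delta0' : 0 < delta by rewrite divr_gt0 ?mulr_gt0 ?exprn_gt0.
have [M M0 hM] := residual_uniform_integrability mth idd th0 theta1 theta2 mN cp delta0'.
have W1 := quadratic_lower_bound T_le mth indep th0 theta1 theta2 tau0 mN cp M0 h4 delta0' eta0 hM hC.
have W2 := cross_term_bound T_le mth indep idd th0 theta1 theta2 tau0 mN cp h4 C0 rho0 hC.
have Llow : \forall k \near \oo, c / 2 * k%:R <= \sum_(i < k) L i ^+ 2.
  have /cvgr_ge/(_ (c / 2)) := cvgc; rewrite ltr_pdivrMr// ltr_pMr// ltr1n => /(_ isT) h.
  apply: filterS2 h (_ : \forall k \near \oo, (0 < k)%N) => [k h k0|]; last by exists 1%N.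
  by move: h; rewrite ler_pdivlMl ?ltr0n// mulrC.
apply: (cvg_probability_with_high_probability (E := fun k => [set w | z <= T_pin T
    (fun s => N s w) (fun s => expR (dotp (x s.1 s.2) (betahat k w))) k])).
  move=> k; rewrite -[X in measurable X]setTI.
  apply: (measurable_fun_le (f := cst z)) => //.
  apply: (@measurable_T_pin _ _ _ T N (fun s w => expR (dotp (x s.1 s.2) (betahat k w)))) => // s.
  apply: measurableT_comp => //; apply: measurable_sum => j.
  by apply: measurable_funM => //; exact: mbeta.
apply: with_high_probabilityS (with_high_probabilityI W1 W2).
have k0 : \forall k \near \oo, (0 < k)%N by exists 1%N.
near=> k => w [h1 h2] /=.
have kR0 : 0 < k%:R :> R by rewrite ltr0n; near: k.
have Llk : c / 2 * k%:R <= \sum_(i < k) L i ^+ 2 by near: k.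
pose Lh (i : 'I_k) : R := \sum_(t < T i) expR (dotp (x i t) (betahat k w)).
have Lh2 : 0 < 2 * \sum_i Lh i ^+ 2.
  have [i Ti] : exists i : 'I_k, (0 < T i)%N.
    apply: contrapT => /forallNP h; move: Llk; rewrite big1; last first.
      move=> i _; rewrite /L /total_rate big1 ?expr0n// => t _; exfalso.
      by apply: (h i); exact: leq_ltn_trans (ltn_ord t).
    by rewrite leNgt !mulr_gt0.
  have Lhi : 0 < Lh i.
    rewrite /Lh (bigD1 (Ordinal Ti))//= ltr_pwDl ?expR_gt0//.
    by apply: sumr_ge0 => t _; exact: expR_ge0.
  rewrite mulr_gt0// (bigD1 i)//= ltr_pwDl ?exprn_gt0//.
  by apply: sumr_ge0 => j _; rewrite sqr_ge0.
rewrite /T_pin ler_pdivlMr ?sqrtr_gt0//.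
have hqk : forall (a L Lh S : 'I_k -> R),
    (forall i, a i = S i - L i) ->
    `|\sum_i a i * Lh i| <= rho * (k%:R + \sum_i Lh i ^+ 2) ->
    `|\sum_i a i * L i| <= rho * (k%:R + \sum_i L i ^+ 2) ->
    \sum_i L i ^+ 2 <= C * k%:R ->
    delta0 * k%:R <= \sum_i (a i ^+ 2 - S i) ->
    z * Num.sqrt (2 * \sum_i Lh i ^+ 2) <= \sum_i ((S i - Lh i) ^+ 2 - S i).
  by near: k.
under [leRHS]eq_bigr do rewrite sumrB.
apply: (hqk (fun i => \sum_(t < T i) (N (nat_of_ord i, nat_of_ord t) w - expR (dotp (x i t) beta)))
  (fun i => L i) Lh (fun i => \sum_(t < T i) N (nat_of_ord i, nat_of_ord t) w)).
- by move=> i; rewrite sumrB.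
- exact: h2.
- exact: h2.
- apply: le_trans (hC k); apply: ler_sum => i _.
  by rewrite lerXn2r ?nnegrE ?addr_ge0// lerDr.
- have e1 : Tm%:R * (2 * eta + delta * C + Tm%:R * eta) = delta0.
    by rewrite /eta /delta /delta0; field; rewrite !gt_eqF.
  have e2 : tau2 * (c / 2 * k%:R) = Tm%:R * (2 * (delta0 * k%:R)).
    by rewrite /delta0; field; rewrite gt_eqF.
  have : Tm%:R * (2 * (delta0 * k%:R)) <= tau2 * \sum_(i < k) L i ^+ 2.
    by rewrite -e2 ler_wpM2l// ltW.
  move=> /le_trans/(_ h1); rewrite ler_pM2l// e1 /=; lra.
Unshelve. all: by end_near.
Qed.
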